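(* Let $\Omega\subset\mathbb C^m$ be a bounded domain, let $\mathfrak K$ and $K$ be positive definite kernels on $\Omega$ with $\mathfrak K(w,w)>0$ and $K(w,w)>0$ for all $w\in\Omega$, and let $\boldsymbol M=(M_1,\ldots,M_m)$ be the tuple of multiplications by the coordinate functions on the reproducing kernel Hilbert space $\mathcal H_K$ of holomorphic functions on $\Omega$. Assume that the adjoint tuple $\boldsymbol M^*=(M_1^*,\ldots,M_m^* )$ belongs to $B_1(\Omega^* )$, $\Omega^*=\{\bar z:z\in\Omega\}$. Then the matrix-valued function $$\Big(\frac{\partial^2}{\partial w_i\,\partial\bar w_j}\log\big(\mathfrak K(w,w)^{-1}K(w,w)\big)\Big)_{i,j=1}^m$$ is a positive definite function (on some non-empty connected open subset of $\Omega$) if and only if the multiplication tuple $\boldsymbol M$ is infinitely divisible with respect to $\mathfrak K$.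
   Context: Positive definite kernel: a function $L:U\times U\to M_n(\mathbb C)$ ($n\ge1$, $U\subseteq\mathbb C^m$ open), holomorphic in the first variable and anti-holomorphic in the second, is a positive definite kernel on $U$ if $\sum_{p,q}\langle L(u_p,u_q)\xi_q,\xi_p\rangle_{\mathbb C^n}\ge0$ for all finite choices $u_1,\ldots,u_l\in U$, $\xi_1,\ldots,\xi_l\in\mathbb C^n$ (scalar kernels: $n=1$). Positive definite function: a real analytic ($M_n(\mathbb C)$-valued) function $G$ on a connected open set $U$ is a positive definite function on $U$ if its polarization $\widetilde G$ (the unique function on $U\times U$, holomorphic in the first variable, anti-holomorphic in the second, with $\widetilde G(w,w)=G(w)$) is defined on $U\times U$ and is a positive definite kernel on $U$. Infinite divisibility: let $L$ be holomorphic in the first and anti-holomorphic in the second variable on $U\times U$, positive on the diagonal; $L^t$ ($t>0$) is the polarization of $w\mapsto L(w,w)^t$, and $L$ is infinitely divisible on $U$ if for every $t>0$, $L^t$ is (defined on $U\times U$ and) a positive definite kernel on $U$. The tuple $\boldsymbol M$ on $\mathcal H_K$ is infinitely divisible with respect to $\mathfrak K$ if $\mathfrak K(z,w)^{-1}K(z,w)$ is infinitely divisible on some non-empty (connected) open subset $\Omega_0$ of $\Omega$. $B_1(D)$ for a bounded domain $D\subset\mathbb C^m$: the commuting tuples $\boldsymbol T=(T_1,\ldots,T_m)$ of bounded operators on a separable complex Hilbert space $\mathcal H$ such that for all $w\in D$ the operator $D_{\boldsymbol T-w}:x\mapsto((T_1-w_1)x,\ldots,(T_m-w_m)x)$ has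 closed range and one-dimensional kernel, and the span of $\{\ker D_{\boldsymbol T-w}:w\in D\}$ is dense in $\mathcal H$. *)

(* Defs.v *)
From HB Require Import structures.
From mathcomp Require Import all_boot all_order all_algebra.
From mathcomp Require Import complex.
From mathcomp Require Import all_classical all_reals all_analysis.
Set Implicit Arguments.
Unset Strict Implicit.
Unset Printing Implicit Defensive.
Import Order.TTheory GRing.Theory Num.Theory numFieldNormedType.Exports.
Local Open Scope classical_set_scope.
Local Open Scope complex_scope.
Local Open Scope ring_scope.

(* R[i] as a one-dimensional normed space over itself, so that R[i] and
   'rV[R[i]]_m carry their usual topologies. *)
#[warnings="-redundant-canonical-projection"]
HB.instance Definition _ (R : realType) := NormedModule.copy R[i] R[i]^o.

Section Kernels.
Variables (R : realType) (m : nat).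
Local Notation C := R[i].
Local Notation V := 'rV[C]_m.

Definition domain (U : set V) : Prop := [/\ open U, connected U & U !=set0].

Definition conj_set (U : set V) : set V := [set map_mx Num.conj z | z in U].

(* Differentiability is Fréchet differentiability over the field R[i]. *)
Definition holomorphic (U : set V) (f : V -> C) : Prop :=
  forall z, U z -> differentiable f z.

Definition antiholomorphic (U : set V) (f : V -> C) : Prop :=
  holomorphic U (fun z => Num.conj (f z)).

(* Kernels and functions on U are total; only their values on U matter. *)
Definition sesquiholomorphic n (U : set V) (L : V -> V -> 'M[C]_n) : Prop :=
  forall i j,
    (forall w, U w -> holomorphic U (fun z => L z w i j)) /\
    (forall z, U z -> antiholomorphic U (fun w => L z w i j)).

Definition cdot n (x y : 'cV[C]_n) : C := \sum_i x i 0 * Num.conj (y i 0).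

(* The order of R[i] makes 0 <= s mean that s is real and nonnegative. *)
Definition positive_definite_kernel n (U : set V) (L : V -> V -> 'M[C]_n) :
    Prop :=
  sesquiholomorphic U L /\
  forall (l : nat) (u : 'I_l -> V) (xi : 'I_l -> 'cV[C]_n),
    (forall p, U (u p)) ->
    0 <= \sum_(p < l) \sum_(q < l) cdot (L (u p) (u q) *m xi q) (xi p).

(* Scalar kernels are the case n = 1. *)
Definition scalar_fun (G : V -> C) : V -> 'M[C]_1 := fun w => (G w)%:M.
Definition scalar_kernel (L : V -> V -> C) : V -> V -> 'M[C]_1 :=
  fun z w => (L z w)%:M.

Definition polarization n (U : set V) (G : V -> 'M[C]_n)
    (Gt : V -> V -> 'M[C]_n) : Prop :=
  sesquiholomorphic U Gt /\ forall w, U w -> Gt w w = G w.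

(* Real analyticity of G on U is implied by the existence of a polarization
   defined on U x U. *)
Definition positive_definite_function n (U : set V) (G : V -> 'M[C]_n) :
    Prop :=
  exists2 Gt, polarization U G Gt & positive_definite_kernel U Gt.

Definition diag_power (L : V -> V -> C) (t : R) : V -> C :=
  fun w => (complex.Re (L w w) `^ t)%:C.

Definition diag_log (L : V -> V -> C) : V -> C :=
  fun w => (ln (complex.Re (L w w)))%:C.

Definition infinitely_divisible (U : set V) (L : V -> V -> C) : Prop :=
  [/\ sesquiholomorphic U (scalar_kernel L),
      forall w, U w -> 0 < L w w &
      forall t : R, 0 < t ->
        exists2 Lt, polarization U (scalar_fun (diag_power L t)) Lt &
                    positive_definite_kernel U Lt].

Definition kernel_quotient (kk K : V -> V -> C) : V -> V -> C :=
  fun z w => (kk z w)^-1 * K z w.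

(* Infinite divisibility of the multiplication tuple on H_K with respect to kk.
   The nonvanishing of kk on Omega0 x Omega0 says that the quotient is actually
   defined there (as inversion is total, with 0^-1 = 0). *)
Definition infinitely_divisible_wrt (Omega : set V) (kk K : V -> V -> C) :
    Prop :=
  exists Omega0 : set V,
    [/\ domain Omega0, Omega0 `<=` Omega,
        forall z w, Omega0 z -> Omega0 w -> kk z w != 0 &
        infinitely_divisible Omega0 (kernel_quotient kk K)].

(* Derivative along v with respect to a real parameter. *)
Definition real_dderive (f : V -> C) (v : V) : V -> C := fun w =>
  derive1 (fun t : R => complex.Re (f (w + t%:C *: v))) 0 +i*
  derive1 (fun t : R => complex.Im (f (w + t%:C *: v))) 0.

(* d/dw_i = (d/dx_i - i d/dy_i) / 2 and d/d(bar w_i) = (d/dx_i + i d/dy_i) / 2 *)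
Definition wirtinger (i : 'I_m) (f : V -> C) : V -> C := fun w =>
  (real_dderive f (delta_mx 0 i) w
   - 'i%C * real_dderive f ('i%C *: delta_mx 0 i) w) / 2.
Definition wirtinger_bar (i : 'I_m) (f : V -> C) : V -> C := fun w =>
  (real_dderive f (delta_mx 0 i) w
   + 'i%C * real_dderive f ('i%C *: delta_mx 0 i) w) / 2.

Definition log_hessian (L : V -> V -> C) : V -> 'M[C]_m := fun w =>
  \matrix_(i, j) wirtinger i (wirtinger_bar j (diag_log L)) w.

Section Operators.
Variable H : completeNormedModType C.

(* H, with inner product dot (linear in the first argument) inducing its norm,
   is the Hilbert space H_K: ev identifies its elements with holomorphic
   functions on Omega, and the functions K(-, w) are reproducing. *)
Definition is_rkhs (Omega : set V) (K : V -> V -> C)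
    (dot : {dot H for Num.conj}) (ev : H -> V -> C) : Prop :=
  [/\ forall f, dot f f = `|f| ^+ 2,
      forall z, Omega z -> forall a f g, ev (a *: f + g) z = a * ev f z + ev g z,
      forall f, (forall z, Omega z -> ev f z = 0) -> f = 0,
      forall f, holomorphic Omega (ev f) &
      forall w, Omega w -> exists2 kw : H,
        forall z, Omega z -> ev kw z = K z w &
        forall f, dot f kw = ev f w].

Definition coordinate_multiplication (Omega : set V) (ev : H -> V -> C)
    (M : 'I_m -> {linear H -> H}) : Prop :=
  forall i, continuous (M i) /\
    forall f z, Omega z -> ev (M i f) z = z 0 i * ev f z.

Definition adjoint_tuple (dot : {dot H for Num.conj})
    (T S : 'I_m -> {linear H -> H}) : Prop :=
  forall i x y, dot (T i x) y = dot x (S i y).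

(* The operator D_(T - w) : H -> H^m; H^m carries the product topology. *)
Definition D_shift (T : 'I_m -> {linear H -> H}) (w : V) : H -> 'rV[H]_m :=
  fun x => \row_i (T i x - w 0 i *: x).

Definition ker_shift (T : 'I_m -> {linear H -> H}) (w : V) : set H :=
  [set x | D_shift T w x = 0].

Definition linear_span (A : set H) : set H :=
  [set x | exists (l : nat) (a : 'I_l -> C) (y : 'I_l -> H),
     (forall k, A (y k)) /\ x = \sum_k a k *: y k].

Definition one_dimensional (A : set H) : Prop :=
  exists2 x : H, x != 0 & A = [set a *: x | a in [set: C]].

Definition separable_space : Prop := exists2 S : set H, countable S & dense S.

Definition B1 (D : set V) (T : 'I_m -> {linear H -> H}) : Prop :=
  [/\ separable_space,
      forall i, continuous (T i),
      forall i j x, T i (T j x) = T j (T i x),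
      forall w, D w ->
        closed (range (D_shift T w)) /\ one_dimensional (ker_shift T w) &
      dense (linear_span (\bigcup_(w in D) ker_shift T w))].

End Operators.
End Kernels.

(* Main.v *)
Require Import Defs.
From HB Require Import structures.
From mathcomp Require Import all_boot all_order all_algebra.
From mathcomp Require Import complex ring lra spectral.
From mathcomp Require Import all_classical all_reals all_analysis.
Set Implicit Arguments.
Unset Strict Implicit.
Unset Printing Implicit Defensive.
Import Order.TTheory GRing.Theory Num.Theory numFieldNormedType.Exports.
Local Open Scope classical_set_scope.
Local Open Scope complex_scope.
Local Open Scope ring_scope.

(** Both properties are local statements about L = K / kk, each claimed on some open set, so it
   is enough to move from one small ball to a smaller one. On a small ball centred on a point b the
   values L z w stay near the positive number L b b, so L = exp l for a bounded function l that is
   holomorphic in z, antiholomorphic in w and satisfies l w z = conj (l z w) ([log_quotient]).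
   On the diagonal l is log L, and the Wirtinger Hessian of log L at w is the value at (w, w) of the
   mixed derivatives d_i dbar_j l ([wirtinger_hessian]). As a polarization is determined by the
   diagonal ([sesq_uniqueness]), infinite divisibility near b means that exp (t l) is a positive
   definite kernel for all t > 0, and the condition on the Hessian means that (z, i), (w, j) |->
   d_i dbar_j l (z, w) is one. It remains to compare these two conditions.

   If every exp (t l) is positive definite, then so is every second difference of the kernel
   (exp (t l) - 1) / t, because the constant 1 drops out; as t tends to 0, the second differences of l
   are positive definite, and after rescaling they converge to the Hessian of l
   ([log_kernels_hessian]). Conversely, if the Hessian is positive definite, integrating it along the
   segments from b to z and from b to w shows that l z w - l z b - l b w + l b b is a positive
   definite kernel ([hessian_log_kernel]). By Schur's product theorem so are the powers and, in the
   limit, the exponentials of it, and exp (t l) differs from such an exponential by a factor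
   f(z) conj (f(w)) ([pdk_exp_of_normalized]).

   Kernels are only separately holomorphic, so they must first be shown to be bounded on some ball;
   this is a Baire category argument ([separately_continuous_bounded]). The ball it yields need not
   contain a prescribed point, which is harmless here.

   The function theory rests on one estimate. Goursat's theorem applied to loops that contract the
   circle to a point gives |f z| <= C max |f| ([cauchy_crude]); applied to powers of f it becomes the
   maximum principle, and after division by zeros of f it becomes a Schwarz lemma with several zeros
   ([zeros_in_disc]). One zero gives Lipschitz bounds, hence Taylor bounds with explicit constants,
   hence differentiability of limits and of derivatives; arbitrarily many zeros give the uniqueness
   of polarizations. Constants are far from sharp: each derivative costs a fixed factor of the
   radius. *)

(** * Real-valued norms and first-order expansions *)

Section RealNorm.
Variable R : realType.
Local Notation C := R[i].

(** The norm of a complex normed module takes values in the complex numbers; its real part is the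
   same number in the real field, where linear arithmetic is available. *)
Definition rnorm (E : normedModType C) (x : E) : R := complex.Re `|x|.

Lemma rnormE (E : normedModType C) (x : E) : `|x| = (rnorm x)%:C.
Proof. by rewrite RRe_real //; exact: normr_real. Qed.

Lemma rnorm_ge0 (E : normedModType C) (x : E) : 0 <= rnorm x.
Proof. by rewrite -lecR -rnormE normr_ge0. Qed.

Lemma rnorm0 (E : normedModType C) : rnorm (0 : E) = 0.
Proof. by apply: complexI; rewrite -rnormE normr0. Qed.

Lemma rnorm_eq0 (E : normedModType C) (x : E) : rnorm x = 0 -> x = 0.
Proof. by move=> h; apply/normr0_eq0; rewrite rnormE h. Qed.

Lemma rnormD (E : normedModType C) (x y : E) : rnorm (x + y) <= rnorm x + rnorm y.
Proof. by rewrite -lecR rmorphD /= -!rnormE ler_normD. Qed.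

Lemma rnormN (E : normedModType C) (x : E) : rnorm (- x) = rnorm x.
Proof. by apply: complexI; rewrite -!rnormE normrN. Qed.

Lemma rnormB (E : normedModType C) (x y : E) : rnorm (x - y) = rnorm (y - x).
Proof. by rewrite -rnormN opprB. Qed.

Lemma rnormZ (E : normedModType C) (a : C) (x : E) : rnorm (a *: x) = rnorm a * rnorm x.
Proof. by apply: complexI; rewrite rmorphM /= -!rnormE normrZ. Qed.

Lemma rnormM (x y : C) : rnorm (x * y) = rnorm x * rnorm y.
Proof. by apply: complexI; rewrite rmorphM /= -!rnormE normrM. Qed.

Lemma rnorm1 : rnorm (1 : C) = 1.
Proof. by apply: complexI; rewrite -rnormE normr1. Qed.

Lemma rnormX (x : C) n : rnorm (x ^+ n) = rnorm x ^+ n.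
Proof. by elim: n => [|n IH]; rewrite ?rnorm1 // !exprS rnormM IH. Qed.

Lemma rnormV (x : C) : rnorm x^-1 = (rnorm x)^-1.
Proof. by apply: complexI; rewrite fmorphV /= -!rnormE normfV. Qed.

Lemma rnorm_real (x : R) : rnorm (x%:C : C) = `|x|.
Proof. by rewrite /rnorm normc_def /= expr0n /= addr0 sqrtr_sqr. Qed.

Lemma rnorm_conj (x : C) : rnorm (Num.conj x) = rnorm x.
Proof. by rewrite /rnorm norm_conjC. Qed.

Lemma rnorm_sum (E : normedModType C) (I : Type) (s : seq I) (P : pred I) (F : I -> E) :
  rnorm (\sum_(i <- s | P i) F i) <= \sum_(i <- s | P i) rnorm (F i).
Proof.
elim/big_rec2: _ => [|i a b _ h]; first by rewrite rnorm0.
by apply: (le_trans (rnormD _ _)); rewrite lerD2l.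
Qed.

Lemma Re_le_rnorm (x : C) : `|complex.Re x| <= rnorm x.
Proof. by rewrite -lecR -rnormE normc_ge_Re. Qed.

Lemma Im_le_rnorm (x : C) : `|complex.Im x| <= rnorm x.
Proof.
have -> : complex.Im x = complex.Re (- (x * 'i%C)) by case: x => a b /=; ring.
apply: (le_trans (Re_le_rnorm _)); rewrite rnormN rnormM.
by rewrite /rnorm [X in _ * complex.Re X]normc_def /= expr0n expr1n add0r sqrtr1 mulr1.
Qed.

Lemma rnorm_le_ReIm (x : C) : rnorm x <= `|complex.Re x| + `|complex.Im x|.
Proof.
rewrite /rnorm normc_def /=.
rewrite -(@ger0_norm _ (`|_| + `|_|)) ?addr_ge0 // -sqrtr_sqr ler_wsqrtr //.
by rewrite sqrrD !real_normK ?num_real // addrAC lerDl mulrn_wge0 // mulr_ge0.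
Qed.

Lemma rnorm_i : rnorm ('i%C : C) = 1.
Proof. by rewrite /rnorm normc_def /= expr0n expr1n add0r sqrtr1. Qed.

Lemma rnorm_sqr (x : C) : rnorm x ^+ 2 = complex.Re x ^+ 2 + complex.Im x ^+ 2.
Proof. by rewrite /rnorm normc_def /= sqr_sqrtr // addr_ge0 // sqr_ge0. Qed.

Lemma rnorm_gt0 (E : normedModType C) (x : E) : x != 0 -> 0 < rnorm x.
Proof.
move=> x0; rewrite lt_neqAle rnorm_ge0 andbT eq_sym; apply: contra_neq x0.
exact: rnorm_eq0.
Qed.

Lemma rnorm_leB (E : normedModType C) (x y : E) : rnorm x <= rnorm (x - y) + rnorm y.
Proof. by rewrite -{1}(subrK y x) rnormD. Qed.

Definition rball (E : normedModType C) (a : E) (r : R) : set E :=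
  [set x | rnorm (x - a) < r].

Lemma rball_center (E : normedModType C) (a : E) (r : R) : 0 < r -> rball a r a.
Proof. by rewrite /rball /= subrr rnorm0. Qed.

Lemma rball_ball (E : normedModType C) (a : E) (r : R) : rball a r = ball a r%:C.
Proof.
by apply/seteqP; split => x; rewrite /rball /= -ball_normE /= rnormB -ltcR -rnormE.
Qed.

Lemma rball_open (E : normedModType C) (a : E) (r : R) : open (rball a r).
Proof.
have [r0|r0] := ltP 0 r; first by rewrite rball_ball; apply: ball_open; rewrite ltcR.
rewrite (_ : rball a r = set0); first exact: open0.
by apply/seteqP; split => x //= /(le_lt_trans (rnorm_ge0 _)); rewrite ltNge r0.
Qed.

Lemma nbhs_rballP (E : normedModType C) (a : E) (A : set E) :
  nbhs a A <-> exists2 r : R, 0 < r & rball a r `<=` A.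
Proof.
split.
  move=> /nbhs_ballP[e /= e0 h]; exists (complex.Re e).
    by move: e0; rewrite ltcE /= => /andP[].
  rewrite rball_ball RRe_real //; exact: gtr0_real.
move=> [r r0 h]; apply/nbhs_ballP; exists r%:C; rewrite /= ?ltcR //.
by rewrite -rball_ball.
Qed.

Lemma open_rballP (E : normedModType C) (A : set E) a :
  open A -> A a -> exists2 r : R, 0 < r & rball a r `<=` A.
Proof. by move=> oA Aa; apply/nbhs_rballP; exact: open_nbhs_nbhs. Qed.

Lemma rball_sub (E : normedModType C) (a b : E) (r s : R) :
  rnorm (b - a) + s <= r -> rball b s `<=` rball a r.
Proof.
move=> h x; rewrite /rball /= => xb; have := rnormD (x - b) (b - a).
by rewrite addrA subrK => h'; lra.
Qed.

Lemma rball_le (E : normedModType C) (a : E) (r s : R) : s <= r -> rball a s `<=` rball a r.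
Proof. by move=> h x /= /lt_le_trans; apply. Qed.

Lemma continuous_rballP (E F : normedModType C) (f : E -> F) x :
  {for x, continuous f} <->
  forall e : R, 0 < e -> exists2 d : R, 0 < d & forall y, rnorm (y - x) < d -> rnorm (f y - f x) < e.
Proof.
split.
  move=> cf e e0.
  have /nbhs_rballP[d d0 h] := cf _ (open_nbhs_nbhs (conj (@rball_open _ (f x) e) (rball_center _ e0))).
  by exists d => // y yx; exact: (h y).
move=> h A /nbhs_rballP[e e0 eA]; have [d d0 dh] := h e e0.
by apply/nbhs_rballP; exists d => // y /dh; apply: eA.
Qed.

(** First-order expansion with an unbundled candidate D for the differential. *)
Definition frechet (E F : normedModType C) (f : E -> F) (x : E) (D : E -> F) :=
  forall e : R, 0 < e -> exists2 d : R, 0 < d &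
    forall h, rnorm h < d -> rnorm (f (x + h) - f x - D h) <= e * rnorm h.

Lemma diff_frechet (E F : normedModType C) (f : E -> F) x :
  differentiable f x -> frechet f x ('d f x).
Proof.
move=> /diff_locally df e e0.
have e0' : 0 < e%:C :> C by rewrite ltcR.
set g := [o_ _ _ of _] in df.
have /(_ _ e0') := littleoP g.
move=> /nbhs_rballP[d d0 h]; exists d => // k kd.
have hk : `|g k| <= e%:C * `|k| by apply: (h k); rewrite /rball /= subr0.
have := congr1 (fun u => u k) df; rewrite !fctE /= /shift /=.
rewrite [k + x]addrC => ->.
rewrite -[f x + _ + _]addrA [f x + _]addrC addrK [_ + g k]addrC addrK.
by rewrite -lecR rmorphM /= -!rnormE.
Qed.

Lemma frechet_diff (E F : normedModType C) (f : E -> F) x (D : {linear E -> F}) :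
  continuous D -> frechet f x D -> differentiable f x.
Proof.
move=> cD fD; apply/diffP => /=.
apply: (@getPex _ (fun (df : {linear E -> F}) => continuous df /\
  forall y, f y = f (lim (nbhs x)) + df (y - lim (nbhs x))
                  +o_(y \near x) (y - lim (nbhs x)))).
exists D; split=> //; rewrite lim_id //.
have h : f = (fun y => f x + D (y - x)) +o_x (center x).
  apply/eqaddoP => _/posnumP[e].
  have e1 : 0 < e%:num :> C by []. have e0 : 0 < complex.Re e%:num by move: e1; rewrite ltcE => /andP[].
  have [d d0 h] := fD _ e0; apply/nbhs_rballP; exists d => // y yx /=.
  rewrite !fctE /=; have := h _ yx; rewrite subrKC -lecR rmorphM /= -!rnormE.
  by rewrite RRe_real ?gtr0_real // opprD addrA.
by move=> y; rewrite {1}h.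
Qed.

End RealNorm.

(** * Goursat theorem for closed real forms on a rectangle *)

Section Goursat.
Variable R : realType.
Implicit Types (P Q : R -> R -> R) (G g : R -> R).

(** The bound -1 leaves room to the left of 0, so that G has two-sided derivatives on the whole of
   the interval [0, x]. *)
Definition primitive_of G g := forall x : R, -1 < x -> is_derive x 1 G (g x).

Lemma primitive_exists g : continuous g -> exists G, primitive_of G g.
Proof.
move=> cg; exists (fun x => (\int[lebesgue_measure]_(t in `[(-1), x]) g t)%R) => x x1.
have [] := @continuous_FTC1_closed _ g (-1) x (x + 1) _ _ x1 (cg x).
- by rewrite ltrDl.
- apply: continuous_compact_integrable; first exact: segment_compact.
  exact: continuous_subspaceT.
- move=> d1 d2; apply: DeriveDef; [exact: d1|rewrite -derive1E; exact: d2].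
Qed.

Lemma primitive_ofB G H g h : primitive_of G g -> primitive_of H h ->
  primitive_of (fun x => G x - H x) (fun x => g x - h x).
Proof. by move=> Gg Hh x x1; apply: is_deriveB; [exact: Gg|exact: Hh]. Qed.

Lemma primitive_of_mvt G g (x y : R) : primitive_of G g -> 0 <= x <= y ->
  exists2 c, x <= c <= y & G y - G x = g c * (y - x).
Proof.
move=> Gg /andP[x0 xy]; have [||c cxy ->] := @MVT_segment _ G g x y xy.
- by move=> z; rewrite in_itv /= => /andP[z0 z1]; apply: Gg; lra.
- apply/derivable_within_continuous => z; rewrite in_itv /= => /andP[z0 z1].
  by apply: ex_derive; apply: Gg; lra.
by exists c => //; move: cxy; rewrite in_itv.
Qed.

Lemma primitive_of_near G g (x y c e : R) : primitive_of G g -> 0 <= x <= y ->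
  (forall z, x <= z <= y -> `|g z - c| <= e) ->
  `|G y - G x - c * (y - x)| <= e * (y - x).
Proof.
move=> Gg xy h; have [z zxy ->] := primitive_of_mvt Gg xy.
move/andP: xy => [_ xy]; rewrite -mulrBl normrM [`|y - x|]ger0_norm ?subr_ge0 //.
by rewrite ler_wpM2r ?subr_ge0 // h.
Qed.

(** Total differentiability of P at (s, t) with partial derivatives a and b. *)
Definition rdiff2 P (s t a b : R) := forall e : R, 0 < e -> exists2 d : R, 0 < d &
  forall s' t', `|s' - s| < d -> `|t' - t| < d ->
  `|P s' t' - P s t - a * (s' - s) - b * (t' - t)| <= e * (`|s' - s| + `|t' - t|).

Variables P Q : R -> R -> R.
(* The form P ds + Q dt is closed: dP/dt and dQ/ds are the same number b. *)
Hypothesis closed_form : forall s t, exists a b c, rdiff2 P s t a b /\ rdiff2 Q s t b c.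
Variables A B : R -> R -> R.
Hypothesis primA : forall t, primitive_of (A t) (fun s => P s t).
Hypothesis primB : forall s, primitive_of (B s) (Q s).

(* The counterclockwise integral of P ds + Q dt around a rectangle, with primitives of P in s and of Q
   in t. *)
Let J x y x' y' := (B x' y' - B x' y) - (B x y' - B x y)
  - ((A y' x' - A y' x) - (A y x' - A y x)).

(* Up to terms that are small compared with the size of the rectangle, the form has affine
   coefficients; being closed, its affine part has integral 0. *)
Let J_small (s t e : R) : 0 < e -> exists2 d : R, 0 < d & forall x y x' y' : R,
  0 <= x <= s -> s <= x' -> 0 <= y <= t -> t <= y' -> x' - x < d -> y' - y < d ->
  `|J x y x' y'| <= e * ((x' - x) + (y' - y)) ^+ 2.
Proof.
move=> e0; have [a [b [c [dP dQ]]]] := closed_form s t.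
have e2 : 0 < e / 2 by lra.
have [d1 d10 h1] := dP _ e2; have [d2 d20 h2] := dQ _ e2.
exists (Num.min d1 d2); first by rewrite lt_min d10.
move=> x y x' y' /andP[x0 xs] sx' /andP[y0 yt] ty'; rewrite !lt_min => /andP[X1 X2] /andP[Y1 Y2].
set E := e * (x' - x + (y' - y)).
have EE z w : x <= z <= x' -> y <= w <= y' ->
    e / 2 * (`|z - s| + `|w - t|) <= E / 2.
  move=> /andP[z1 z2] /andP[w1 w2]; rewrite /E mulrAC ler_pM2r ?invr_gt0 // ler_pM2l //.
  by apply: lerD; rewrite ler_norml; apply/andP; split; clear -xs sx' yt ty' z1 z2 w1 w2; lra.
have nd z d' : x <= z <= x' -> x' - x < d' -> `|z - s| < d'.
  by move=> /andP[z1 z2] zd; rewrite ltr_norml; apply/andP; split; clear -xs sx' z1 z2 zd; lra.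
have nd' z d' : y <= z <= y' -> y' - y < d' -> `|z - t| < d'.
  by move=> /andP[z1 z2] zd; rewrite ltr_norml; apply/andP; split; clear -yt ty' z1 z2 zd; lra.
have xx'0 := le_trans xs sx'; have yy'0 := le_trans yt ty'.
have yy : y <= y <= y' by rewrite lexx. have yy' : y <= y' <= y' by rewrite lexx andbT.
have xx : x <= x <= x' by rewrite lexx. have xx' : x <= x' <= x' by rewrite lexx andbT.
have hA z : x <= z <= x' -> `|(P z y' - P z y) - b * (y' - y)| <= E.
  move=> zx; have := h1 _ _ (nd z _ zx X1) (nd' y _ yy Y1).
  have := h1 _ _ (nd z _ zx X1) (nd' y' _ yy' Y1).
  have := EE _ _ zx yy; have := EE _ _ zx yy'.
  set u := e / 2 * _; set v := e / 2 * _ => uE vE; rewrite !ler_norml => /andP[p1 p2] /andP[p3 p4].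
  by apply/andP; split; clear -uE vE p1 p2 p3 p4; lra.
have hB z : y <= z <= y' -> `|(Q x' z - Q x z) - b * (x' - x)| <= E.
  move=> zx; have := h2 _ _ (nd x _ xx X2) (nd' _ _ zx Y2).
  have := h2 _ _ (nd x' _ xx' X2) (nd' _ _ zx Y2).
  have := EE _ _ xx zx; have := EE _ _ xx' zx.
  set u := e / 2 * _; set v := e / 2 * _ => uE vE; rewrite !ler_norml => /andP[p1 p2] /andP[p3 p4].
  by apply/andP; split; clear -uE vE p1 p2 p3 p4; lra.
have := primitive_of_near (primitive_ofB (primA y') (primA y)) _ hA.
have := primitive_of_near (primitive_ofB (primB x') (primB x)) _ hB.
rewrite y0 yy'0 x0 xx'0.
move=> /(_ isT); rewrite ler_norml => /andP[p1 p2] /(_ isT); rewrite ler_norml => /andP[p3 p4].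
have -> : e * (x' - x + (y' - y)) ^+ 2 = E * (x' - x) + E * (y' - y) by rewrite /E; ring.
by rewrite /J ler_norml; apply/andP; split; clear -p1 p2 p3 p4; lra.
Qed.

(** Repeated subdivision into four equal rectangles: if J is nonzero, some quarter carries at least a
   quarter of it, and the nested rectangles shrink to a point where this contradicts the quadratic
   smallness of J. *)
Lemma Goursat (X Y : R) : 0 <= X -> 0 <= Y -> J 0 0 X Y = 0.
Proof.
move=> X0 Y0; apply/eqP/negP => /negP J0.
pose e : R := `|J 0 0 X Y|; have e0 : 0 < e by rewrite normr_gt0.
pose X_ n := X / 2 ^+ n; pose Y_ n := Y / 2 ^+ n.
have Xn0 n : 0 <= X_ n by rewrite divr_ge0 // exprn_ge0.
have Yn0 n : 0 <= Y_ n by rewrite divr_ge0 // exprn_ge0.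
have XS n : X_ n = X_ n.+1 + X_ n.+1.
  by rewrite /X_ exprS; field; rewrite expf_neq0 // pnatr_eq0.
have YS n : Y_ n = Y_ n.+1 + Y_ n.+1.
  by rewrite /Y_ exprS; field; rewrite expf_neq0 // pnatr_eq0.
pose big n (p : R * R) := e / 4 ^+ n <= `|J p.1 p.2 (p.1 + X_ n) (p.2 + Y_ n)|.
pose sub n (p q : R * R) := [/\ p.1 <= q.1, q.1 + X_ n.+1 <= p.1 + X_ n, p.2 <= q.2 &
   q.2 + Y_ n.+1 <= p.2 + Y_ n].
have step n p : exists q, big n p -> big n.+1 q /\ sub n p q.
  have [hb|] := pselect (big n p); last by exists p.
  suff: exists q, big n.+1 q /\ sub n p q by case=> q hq; exists q.
  apply: contrapT => /forallNP h.
  case: p hb h => x y hb h.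
  have nb q : sub n (x, y) q -> `|J q.1 q.2 (q.1 + X_ n.+1) (q.2 + Y_ n.+1)| < e / 4 ^+ n.+1.
    by move=> sq; rewrite ltNge; apply/negP => bq; apply: (h q).
  have h1 := nb (x, y); have h2 := nb (x + X_ n.+1, y).
  have h3 := nb (x, y + Y_ n.+1); have h4 := nb (x + X_ n.+1, y + Y_ n.+1).
  move: hb h1 h2 h3 h4; rewrite /big /sub /= (XS n) (YS n) => hb h1 h2 h3 h4.
  have := Xn0 n.+1; have := Yn0 n.+1; move: (X_ n.+1) (Y_ n.+1) => a b in hb h1 h2 h3 h4 * => b0 a0.
  move: hb; have -> : e / 4 ^+ n = 4 * (e / 4 ^+ n.+1).
    by rewrite exprS; field; rewrite expf_neq0 // pnatr_eq0.
  have {}h1 := h1 ltac:(clear - a0 b0 P Q A B closed_form primA primB; by split; lra); have {}h2 := h2 ltac:(clear - a0 b0 P Q A B closed_form primA primB; by split; lra).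
  have {}h3 := h3 ltac:(clear - a0 b0 P Q A B closed_form primA primB; by split; lra); have {}h4 := h4 ltac:(clear - a0 b0 P Q A B closed_form primA primB; by split; lra).
  move: (e / _) h1 h2 h3 h4 => e' h1 h2 h3 h4; apply/negP; rewrite -ltNge.
  rewrite !addrA.
  have -> : J x y (x + a + a) (y + b + b) = J x y (x + a) (y + b) + J (x + a) y (x + a + a) (y + b)
    + J x (y + b) (x + a) (y + b + b) + J (x + a) (y + b) (x + a + a) (y + b + b).
    by rewrite /J; ring.
  move: (J x y (x + a) (y + b)) (J (x + a) y (x + a + a) (y + b)) (J x (y + b) (x + a) (y + b + b))
    (J (x + a) (y + b) (x + a + a) (y + b + b)) h1 h2 h3 h4 => j1 j2 j3 j4.
  by rewrite !ltr_norml => /andP[? ?] /andP[? ?] /andP[? ?] /andP[? ?]; apply/andP; split; lra.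
have /choice[nxt nxtP] : forall np : nat * (R * R), exists q, big np.1 np.2 ->
    big np.1.+1 q /\ sub np.1 np.2 q by move=> [n p]; exact: step.
pose u := fix u n := if n is n'.+1 then nxt (n', u n') else (0, 0).
have ub n : big n (u n).
  elim: n => [|n IH]; first by rewrite /big /X_ /Y_ /= !expr0 !divr1 !add0r.
  by have [] := nxtP (n, u n) IH.
have us n : sub n (u n) (u n.+1) by have [] := nxtP (n, u n) (ub n).
have mono k n : [/\ (u n).1 <= (u (n + k)%N).1, (u (n + k)%N).1 + X_ (n + k)%N <= (u n).1 + X_ n,
   (u n).2 <= (u (n + k)%N).2 & (u (n + k)%N).2 + Y_ (n + k)%N <= (u n).2 + Y_ n].
  elim: k => [|k [h1 h2 h3 h4]]; first by rewrite addn0.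
  by rewrite addnS; have [? ? ? ?] := us (n + k)%N; split; lra.
have cross1 n k : (u n).1 <= (u k).1 + X_ k.
  have [nk|kn] := leqP n k.
    have [H _ _ _] := mono (k - n)%N n; rewrite subnKC // in H; have := Xn0 k; lra.
  have [_ H _ _] := mono (n - k)%N k; rewrite subnKC 1?ltnW // in H; have := Xn0 n; lra.
have cross2 n k : (u n).2 <= (u k).2 + Y_ k.
  have [nk|kn] := leqP n k.
    have [_ _ H _] := mono (k - n)%N n; rewrite subnKC // in H; have := Yn0 k; lra.
  have [_ _ _ H] := mono (n - k)%N k; rewrite subnKC 1?ltnW // in H; have := Yn0 n; lra.
pose s := sup (range (fun n => (u n).1)); pose t := sup (range (fun n => (u n).2)).
have us1 n : (u n).1 <= s.
  apply: ub_le_sup; last by exists n.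
  by exists ((u 0%N).1 + X_ 0%N) => _ [k _ <-].
have us2 n : s <= (u n).1 + X_ n.
  by apply: ge_sup; [exists (u 0%N).1; exists 0%N|move=> _ [k _ <-]].
have ut1 n : (u n).2 <= t.
  apply: ub_le_sup; last by exists n.
  by exists ((u 0%N).2 + Y_ 0%N) => _ [k _ <-].
have ut2 n : t <= (u n).2 + Y_ n.
  by apply: ge_sup; [exists (u 0%N).2; exists 0%N|move=> _ [k _ <-]].
have u0 n : 0 <= (u n).1 /\ 0 <= (u n).2.
  by have [H _ H0 _] := mono n 0%N; rewrite add0n in H H0.
have XY : 0 < (X + Y + 1) ^+ 2 by rewrite exprn_gt0 //; lra.
pose e' := e / (X + Y + 1) ^+ 2 / 2.
have e'0 : 0 < e' by rewrite /e' !divr_gt0.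
have [d d0 hd] := J_small s t e'0.
have [n hn] : exists n, (X + Y + 1) / 2 ^+ n < d.
  have := @cvg_geometric R (X + Y + 1) (2^-1).
  rewrite ger0_norm ?invr_ge0 // invf_lt1 // ltr1n => /(_ isT) /cvgrPdist_lt /(_ _ d0).
  move=> [n _ /(_ n (leqnn n))] /=; rewrite sub0r normrN => hn; exists n.
  by apply: le_lt_trans hn; rewrite exprVn ler_norm.
have p2 : 0 < 2 ^+ n :> R by rewrite exprn_gt0.
have := ub n; rewrite /big; apply/negP; rewrite -ltNge.
apply: (le_lt_trans (hd _ _ _ _ _ _ _ _ _ _)) => //.
- by rewrite us1 andbT; case: (u0 n).
- by rewrite ut1 andbT; case: (u0 n).
- by rewrite addrC addKr; apply: le_lt_trans hn; rewrite ler_pM2r ?invr_gt0 //; lra.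
- by rewrite addrC addKr; apply: le_lt_trans hn; rewrite ler_pM2r ?invr_gt0 //; lra.
rewrite [_ + X_ n]addrC addrK [_ + Y_ n]addrC addrK.
apply: (@le_lt_trans _ _ (e' * ((X + Y + 1) / 2 ^+ n) ^+ 2)).
  rewrite ler_pM2l // lerXn2r ?nnegrE ?addr_ge0 ?Xn0 ?Yn0 ?divr_ge0 ?ltW //; try lra.
  by rewrite /X_ /Y_ -mulrDl ltr_pM2r ?invr_gt0 //; lra.
have -> : (4 : R) ^+ n = (2 ^+ n) ^+ 2 by rewrite -exprM mulnC exprM; congr (_ ^+ _); ring.
rewrite expr_div_n mulrA ltr_pM2r ?invr_gt0 ?exprn_gt0 //.
by rewrite /e' mulrAC divfK ?gt_eqF //; lra.
Qed.

End Goursat.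

(** * Differentiable maps from the real plane to the complex numbers *)

Section ComplexPaths.
Variable R : realType.
Local Notation C := R[i].
Implicit Types (F G : R -> R -> C) (f : C -> C) (u : R -> C).

Lemma diff_cfrechet f z : differentiable f z -> exists c, frechet f z (fun h => c * h).
Proof.
move=> /diff_frechet df; exists ('d f z 1) => e /df[d d0 h]; exists d => // k kd.
have -> : 'd f z 1 * k = 'd f z k by rewrite -[k in RHS]mulr1 linearZ /= mulrC.
exact: h.
Qed.

Lemma rnormCD (x y : C) : rnorm (x + y) <= rnorm x + rnorm y.
Proof. exact: rnormD. Qed.

Definition cdiff2 F (s t : R) (a b : C) := forall e : R, 0 < e -> exists2 d : R, 0 < d &
  forall s' t', `|s' - s| < d -> `|t' - t| < d ->
  rnorm (F s' t' - F s t - a * (s' - s)%:C - b * (t' - t)%:C) <= e * (`|s' - s| + `|t' - t|).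

Definition cdiff1 u (s : R) (a : C) := forall e : R, 0 < e -> exists2 d : R, 0 < d &
  forall s', `|s' - s| < d -> rnorm (u s' - u s - a * (s' - s)%:C) <= e * `|s' - s|.

(** Only imaginary parts are integrated, which keeps the integration theory real. *)
Lemma cdiff2_Im F s t a b : cdiff2 F s t a b ->
  rdiff2 (fun s t => complex.Im (F s t)) s t (complex.Im a) (complex.Im b).
Proof.
move=> h e /h[d d0 {}h]; exists d => // s' t' s'd t'd.
apply: le_trans (h _ _ s'd t'd); apply: le_trans (Im_le_rnorm _).
rewrite le_eqVlt; apply/orP; left; apply/eqP; congr (`|_|).
move: (F s' t') (F s t) {h s'd t'd} => x y; case: x => ? ?; case: y => ? ?.
by rewrite [a in RHS]complexE [b in RHS]complexE /=; ring.
Qed.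

Lemma cdiff2_fst u s t a : cdiff1 u s a -> cdiff2 (fun s _ => u s) s t a 0.
Proof.
move=> h e e0; have [d d0 {}h] := h e e0; exists d => // s' t' s'd _.
by rewrite mul0r subr0; apply: (le_trans (h _ s'd)); rewrite ler_pM2l // lerDl.
Qed.

Lemma cdiff2_snd u s t a : cdiff1 u t a -> cdiff2 (fun _ t => u t) s t 0 a.
Proof.
move=> h e e0; have [d d0 {}h] := h e e0; exists d => // s' t' _ t'd.
by rewrite mul0r subr0; apply: (le_trans (h _ t'd)); rewrite ler_pM2l // lerDr.
Qed.

Lemma cdiff2_lip F s t a b : cdiff2 F s t a b -> exists2 K : R, 0 < K & exists2 d : R, 0 < d &
  forall s' t', `|s' - s| < d -> `|t' - t| < d ->
  rnorm (F s' t' - F s t) <= K * (`|s' - s| + `|t' - t|).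
Proof.
move=> /(_ 1 ltr01)[d d0 h]; exists (1 + rnorm a + rnorm b).
  by have := rnorm_ge0 a; have := rnorm_ge0 b; lra.
exists d => // s' t' s'd t'd; have := h _ _ s'd t'd.
move: (F _ _ - F _ _) => D hD.
have -> : D = (D - a * (s' - s)%:C - b * (t' - t)%:C) + (a * (s' - s)%:C + b * (t' - t)%:C) by ring.
apply: (le_trans (rnormCD _ _)); move: hD; set X := rnorm (D - _ - _) => hD.
have := rnormCD (a * (s' - s)%:C) (b * (t' - t)%:C); rewrite !rnormM !rnorm_real => h2.
have := rnorm_ge0 a; have := rnorm_ge0 b; have := normr_ge0 (s' - s); have := normr_ge0 (t' - t).
move: `|s' - s| `|t' - t| (rnorm a) (rnorm b) (rnorm (_ + _)) X hD h2 => p q x y z X *.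
by nra.
Qed.

Lemma cdiff2_comp f F s t a b c : cdiff2 F s t a b -> frechet f (F s t) (fun h => c * h) ->
  cdiff2 (fun s t => f (F s t)) s t (c * a) (c * b).
Proof.
move=> dF df e e0; have [K K0 [d1 d10 h1]] := cdiff2_lip dF.
have c0 := rnorm_ge0 c; have c1 : 0 < rnorm c + 1 by lra.
have eK : 0 < e / 2 / K by rewrite !divr_gt0.
have ec : 0 < e / 2 / (rnorm c + 1) by rewrite !divr_gt0.
have [d2 d20 h2] := df _ eK; have [d3 d30 h3] := dF _ ec.
have d4 : 0 < d2 / K / 2 by rewrite !divr_gt0.
exists (Num.min d1 (Num.min d3 (d2 / K / 2))); first by rewrite !lt_min d10 d30.
move=> s' t'; rewrite !lt_min => /and3P[a1 a3 a2] /and3P[b1 b3 b2].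
have {}h1 := h1 _ _ a1 b1; have {}h3 := h3 _ _ a3 b3.
have hd : rnorm (F s' t' - F s t) < d2.
  apply: (le_lt_trans h1); move: a2 b2; rewrite -mulrA -invfM.
  have -> : d2 / (K * 2) = d2 / 2 / K by field; rewrite gt_eqF.
  by rewrite !ltr_pdivlMr // => a2 b2; rewrite mulrDr; lra.
have {}h2 := h2 _ hd; rewrite subrKC in h2.
have -> : f (F s' t') - f (F s t) - c * a * (s' - s)%:C - c * b * (t' - t)%:C =
  (f (F s' t') - f (F s t) - c * (F s' t' - F s t)) +
  c * (F s' t' - F s t - a * (s' - s)%:C - b * (t' - t)%:C) by ring.
apply: (le_trans (rnormCD _ _)); rewrite rnormM.
have -> : e * (`|s' - s| + `|t' - t|) = e / 2 / K * (K * (`|s' - s| + `|t' - t|)) +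
   (rnorm c + 1) * (e / 2 / (rnorm c + 1) * (`|s' - s| + `|t' - t|)).
  by field; rewrite !gt_eqF.
apply: lerD; first by apply: (le_trans h2); rewrite ler_pM2l.
apply: (@le_trans _ _ ((rnorm c + 1) * rnorm (F s' t' - F s t - a * (s' - s)%:C - b * (t' - t)%:C))).
  by rewrite ler_wpM2r ?rnorm_ge0 // lerDl.
by rewrite ler_pM2l.
Qed.

Lemma cdiff2D F G s t a b a' b' : cdiff2 F s t a b -> cdiff2 G s t a' b' ->
  cdiff2 (fun s t => F s t + G s t) s t (a + a') (b + b').
Proof.
move=> dF dG e e0; have e2 : 0 < e / 2 by lra.
have [d1 d10 h1] := dF _ e2; have [d2 d20 h2] := dG _ e2.
exists (Num.min d1 d2); first by rewrite lt_min d10.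
move=> s' t'; rewrite !lt_min => /andP[a1 a2] /andP[b1 b2].
have {}h1 := h1 _ _ a1 b1; have {}h2 := h2 _ _ a2 b2.
have -> : F s' t' + G s' t' - (F s t + G s t) - (a + a') * (s' - s)%:C - (b + b') * (t' - t)%:C =
  (F s' t' - F s t - a * (s' - s)%:C - b * (t' - t)%:C) +
  (G s' t' - G s t - a' * (s' - s)%:C - b' * (t' - t)%:C) by ring.
by apply: (le_trans (rnormCD _ _)); lra.
Qed.

Lemma cdiff2_sqr F s t a b : cdiff2 F s t a b ->
  cdiff2 (fun s t => F s t ^+ 2) s t (2 * F s t * a) (2 * F s t * b).
Proof.
move=> dF; apply: (@cdiff2_comp (fun x => x ^+ 2) F s t a b _ dF).
move=> e e0; exists e => // h he.
have -> : (F s t + h) ^+ 2 - F s t ^+ 2 - 2 * F s t * h = h * h by ring.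
by rewrite rnormM ler_wpM2r ?rnorm_ge0 // ltW.
Qed.

Lemma cdiff2Z c F s t a b : cdiff2 F s t a b ->
  cdiff2 (fun s t => c * F s t) s t (c * a) (c * b).
Proof.
move=> dF; apply: (@cdiff2_comp (fun x => c * x) F s t a b _ dF) => e e0; exists 1 => // h _.
by rewrite (_ : _ - _ = 0) ?rnorm0 ?mulr_ge0 ?rnorm_ge0 // ?ltW //; ring.
Qed.

Lemma cdiff2_ext F G s t a b a' b' : (forall s t, F s t = G s t) -> a = a' -> b = b' ->
  cdiff2 F s t a b -> cdiff2 G s t a' b'.
Proof.
by move=> h <- <- dF e /dF[d d0 {}dF]; exists d => // s' t' *; rewrite -!h; exact: dF.
Qed.

(** Polarization reduces the product rule to the chain rule for squares. *)
Lemma cdiff2M F G s t a b a' b' : cdiff2 F s t a b -> cdiff2 G s t a' b' ->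
  cdiff2 (fun s t => F s t * G s t) s t (a * G s t + F s t * a') (b * G s t + F s t * b').
Proof.
move=> dF dG; have hp := cdiff2_sqr (cdiff2D dF dG).
have hm := cdiff2_sqr (cdiff2D dF (cdiff2Z (-1) dG)).
by apply: cdiff2_ext (cdiff2D (cdiff2Z (4^-1) hp) (cdiff2Z (- 4^-1) hm)) => [s' t'||]; field.
Qed.

Lemma is_derive_rdiff (g : R -> R) (x a : R) : is_derive x 1 g a ->
  forall e : R, 0 < e -> exists2 d : R, 0 < d &
  forall y, `|y - x| < d -> `|g y - g x - a * (y - x)| <= e * `|y - x|.
Proof.
move=> [dg <-] e e0.
have /cvgrPdist_lt /(_ _ e0) [d /= d0 h] := dg.
exists d => // y yx; have [->|yx0] := eqVneq y x; first by rewrite !subrr mulr0 subr0 normr0 mulr0.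
have := h (y - x); rewrite /= sub0r normrN => /(_ yx); rewrite subr_eq0 => /(_ yx0).
rewrite /derive /= [_%:A]mulr1 subrK => /ltW.
rewrite -[X in _ -> X <= _](_ : `|'D_1 g x - (y - x)^-1 * (g y - g x)| * `|y - x| = _).
  by move=> /ler_wpM2r; apply.
by rewrite -normrM distrC; congr (`|_|); rewrite /derive; field; rewrite subr_eq0.
Qed.

Lemma cdiff1_real (g : R -> R) (x a : R) : is_derive x 1 g a -> cdiff1 (fun s => (g s)%:C) x a%:C.
Proof.
move=> /is_derive_rdiff h e /h[d d0 {}h]; exists d => // y /h.
by rewrite -!rmorphB /= -rmorphM -rmorphB rnorm_real.
Qed.

End ComplexPaths.

(** * A Cauchy estimate with a crude constant *)

Section MaximumPrinciple.
Variable R : realType.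
Local Notation C := R[i].

Definition circle (r x : R) : C := (r * cos x) +i* (r * sin x).

Lemma rnorm_circle r x : 0 <= r -> rnorm (circle r x) = r.
Proof.
move=> r0; have := rnorm_sqr (circle r x); rewrite /= !exprMn -mulrDr cos2Dsin2 mulr1 => h.
by apply/eqP; rewrite -(@eqrXn2 _ 2) ?rnorm_ge0 // h.
Qed.

Lemma cdiff1_circle r x : cdiff1 (circle r) x ('i%C * circle r x).
Proof.
have e s : circle r s = r%:C * ((cos s)%:C + 'i%C * (sin s)%:C).
  by rewrite /circle; simpc.
move=> eps e0.
have hc : cdiff2 (fun s t => circle r s) x 0 ('i%C * circle r x) 0.
  apply: (cdiff2_ext (fun s t => esym (e s)) _ _ (cdiff2Z r%:C
    (cdiff2D (cdiff2_fst 0 (cdiff1_real (is_derive_cos x)))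
       (cdiff2Z 'i%C (cdiff2_fst 0 (cdiff1_real (is_derive_sin x))))))); rewrite ?e.
  - rewrite rmorphN mulrCA; congr (_ * _).
    by rewrite mulrDr mulrA -expr2 sqr_i mulN1r addrC.
  - by rewrite mulr0 addr0 mulr0.
have [d d0 h] := hc _ e0; exists d => // s' s'd.
by have := h s' 0 s'd; rewrite subrr normr0 addr0 mul0r subr0; apply.
Qed.

(** The map w |-> w / (w - z) sends the circle of radius |w| > |z| into this half-plane; it is
   d arg (w - z) / dt along the circle that is bounded below here. *)
Lemma Re_circle_ratio (w z : C) : rnorm z < rnorm w -> 2^-1 <= complex.Re (w / (w - z)).
Proof.
move=> zw; have wz : w - z != 0.
  by apply: contraTneq zw => /subr0_eq ->; rewrite ltxx.
have sq : rnorm z ^+ 2 < rnorm w ^+ 2.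
  by rewrite ltrXn2r ?nnegrE ?rnorm_ge0.
have p : 0 < rnorm (w - z) ^+ 2 by rewrite exprn_gt0 // rnorm_gt0.
have -> : complex.Re (w / (w - z)) = complex.Re (w * Num.conj (w - z)) / rnorm (w - z) ^+ 2.
  rewrite rnorm_sqr; case: w z {zw wz sq p} => [a b] [x y] /=.
  by rewrite !mulrN -!mulNr !opprK; ring.
rewrite ler_pdivlMr //; move: sq; rewrite !rnorm_sqr; case: w z {zw wz p} => [a b] [x y] /= sq.
by lra.
Qed.

Variables (f : C -> C) (r M : R).
Hypothesis r0 : 0 < r.

(** The loops z + exp (- u^2) (circle r - z) contract the circle to z inside the disc, so that the
   closed form f(x) dx / (x - z), pulled back along them, has the same period for all u. At u = 0 the
   period is bounded by a multiple of M; for large u the loop is close to z and the period is at least a multiple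
   of |f z|. *)
Lemma cauchy_crude (z : C) : rnorm z < r ->
  (forall x : C, rnorm x <= r -> differentiable f x) ->
  (forall x : C, rnorm x = r -> rnorm (f x) <= M) ->
  rnorm (f z) <= 8 * r / (r - rnorm z) * M.
Proof.
move=> zr df fM.
have M0 : 0 <= M by apply: le_trans (fM (circle r 0) _); rewrite ?rnorm_ge0 // rnorm_circle ?(ltW r0).
have rz : 0 < r - rnorm z by rewrite subr_gt0.
have [fz0|fz] := eqVneq (f z) 0.
  by rewrite fz0 rnorm0 !mulr_ge0 // ?invr_ge0 ltW // mulr_gt0.
have w0 t : circle r t - z != 0.
  by apply: contraTneq zr => /subr0_eq <-; rewrite rnorm_circle ?ltxx ?(ltW r0).
(* The Gaussian factor is smooth, equals 1 at u = 0, and gets as small as desired while u stays in a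
   bounded interval [0, U]. *)
pose T (u : R) : C := (expR (- u ^+ 2))%:C.
have T01 (u : R) : 0 < expR (- u ^+ 2) <= 1 by rewrite expR_gt0 expR_le1 oppr_le0 sqr_ge0.
pose ze u t : C := z + T u * (circle r t - z).
have zer u t : rnorm (ze u t) <= r.
  have /andP[h0 h1] := T01 u.
  have -> : ze u t = (1 - expR (- u ^+ 2))%:C * z + T u * circle r t.
    by rewrite /ze /T rmorphB /=; ring.
  apply: (le_trans (rnormD _ _)); rewrite !rnormM !rnorm_real rnorm_circle ?(ltW r0) //.
  rewrite !ger0_norm ?subr_ge0 // ?(ltW h0) //.
  have : (1 - expR (- u ^+ 2)) * rnorm z <= (1 - expR (- u ^+ 2)) * r by rewrite ler_wpM2l ?subr_ge0 // ltW.
  by lra.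
pose q (w : C) : C := 'i%C * w / (w - z).
have dq t : differentiable q (circle r t).
  apply: differentiableM; first by apply: differentiableM.
  by apply: differentiableV => //; apply: differentiableB.
(* P du + Q dt is the pull-back of f(x) dx / (x - z) by (u, t) |-> ze u t, normalized by f z. *)
pose P u t : C := f (ze u t) / f z * (- 2 * u)%:C.
pose Q u t : C := f (ze u t) / f z * q (circle r t).
have dT (u : R) : is_derive u 1 (fun u : R => expR (- u ^+ 2)) (- 2 * u * expR (- u ^+ 2)).
  apply: is_derive_eq => /=; rewrite /GRing.scale /=; ring.
have dze u t : cdiff2 ze u t ((- 2 * u)%:C * T u * (circle r t - z)) (T u * ('i%C * circle r t)).
  have h1 := cdiff2_fst t (cdiff1_real (dT u)).
  have h2 := cdiff2_snd u (cdiff1_circle r t).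
  have cst c : cdiff2 (fun _ _ => c : C) u t 0 0.
    move=> e e0; exists 1 => // *; rewrite subrr !mul0r !subr0 rnorm0.
    by rewrite mulr_ge0 ?addr_ge0 // ltW.
  apply: cdiff2_ext (cdiff2D (cst z) (cdiff2M h1 (cdiff2D h2 (cst (- z))))) => //.
  - by rewrite /T !rmorphM /=; ring.
  - by rewrite /T; ring.
have closed u t : exists a b c, cdiff2 P u t a b /\ cdiff2 Q u t b c.
  have [c dfc] := diff_cfrechet (df _ (zer u t)).
  have [c' dqc] := diff_cfrechet (dq t).
  have dfz : cdiff2 (fun u t => f (ze u t) / f z) u t
     (c / f z * ((- 2 * u)%:C * T u * (circle r t - z))) (c / f z * (T u * ('i%C * circle r t))).
    by apply: cdiff2_ext (cdiff2Z ((f z)^-1) (cdiff2_comp (dze u t) dfc)) => *; ring.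
  have du : is_derive u 1 (fun u : R => - 2 * u) (- 2).
    apply: is_derive_eq => /=; rewrite /GRing.scale /=; ring.
  have dP := cdiff2M dfz (cdiff2_fst t (cdiff1_real du)).
  have dQ := cdiff2M dfz (cdiff2_comp (cdiff2_snd u (cdiff1_circle r t)) dqc).
  eexists; exists (c / f z * ('i%C * circle r t) * ((- 2 * u)%:C * T u)); eexists; split.
    by apply: cdiff2_ext dP => //; ring.
  by apply: cdiff2_ext dQ => //; rewrite /q; field; rewrite fz w0.
pose PI u t := complex.Im (P u t); pose QI u t := complex.Im (Q u t).
have closedI s t : exists a b c, rdiff2 PI s t a b /\ rdiff2 QI s t b c.
  have [a [b [c [h1 h2]]]] := closed s t.
  by exists (complex.Im a), (complex.Im b), (complex.Im c); split; exact: cdiff2_Im.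
(* Differentiability gives the continuity of P in u and of Q in t that primitives need. *)
have rdc (F : R -> R -> R) s t a b : rdiff2 F s t a b ->
    {for s, continuous (fun s => F s t)} /\ {for t, continuous (F s)}.
  move=> h.
  have [d d0 {}h] := h _ ltr01.
  have K0 : 0 < 1 + `|a| + `|b| by have := normr_ge0 a; have := normr_ge0 b; lra.
  have ineq x y : `|x - s| < d -> `|y - t| < d ->
     `|F x y - F s t| <= (1 + `|a| + `|b|) * (`|x - s| + `|y - t|).
    move=> xs yt; have := h _ _ xs yt; move: (F x y - F s t) => D hD.
    have := ler_normD (D - a * (x - s) - b * (y - t)) (a * (x - s) + b * (y - t)).
    have -> : D - a * (x - s) - b * (y - t) + (a * (x - s) + b * (y - t)) = D by ring.
    have := ler_normD (a * (x - s)) (b * (y - t)); rewrite !normrM => h1 h2.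
    have := normr_ge0 a; have := normr_ge0 b; have := normr_ge0 (x - s); have := normr_ge0 (y - t).
    by nra.
  split; apply/cvgrPdist_lt => e e0.
    exists (Num.min d (e / (1 + `|a| + `|b|))); first by rewrite /= lt_min d0 divr_gt0.
    move=> x /=; rewrite lt_min distrC => /andP[h2]; rewrite ltr_pdivlMr // mulrC => h1.
    by rewrite distrC; have := ineq x t h2; rewrite subrr normr0 addr0 => /(_ d0) /le_lt_trans; apply.
  exists (Num.min d (e / (1 + `|a| + `|b|))); first by rewrite /= lt_min d0 divr_gt0.
  move=> x /=; rewrite lt_min distrC => /andP[h2]; rewrite ltr_pdivlMr // mulrC => h1.
  by rewrite distrC; have := ineq s x; rewrite subrr normr0 add0r => /(_ d0 h2) /le_lt_trans; apply.
have /choice[A primA] : forall t, exists G, primitive_of G (fun s => PI s t).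
  move=> t; apply: primitive_exists => s; have [a [b [c [h _]]]] := closedI s t.
  by have [] := rdc _ _ _ _ _ h.
have /choice[B primB] : forall s, exists G, primitive_of G (QI s).
  move=> s; apply: primitive_exists => t; have [a [b [c [_ h]]]] := closedI s t.
  by have [] := rdc _ _ _ _ _ h.
pose K := r / (r - rnorm z).
have K0 : 0 < K by rewrite divr_gt0.
have qK t : rnorm (q (circle r t)) <= K.
  rewrite /q !rnormM rnorm_i mul1r rnormV rnorm_circle ?(ltW r0) // ler_pM2l // lef_pV2 ?posrE ?rnorm_gt0 //.
  by have := rnorm_leB (circle r t) z; rewrite rnorm_circle ?(ltW r0) //; lra.
have pi2 : 0 <= 2 * pi :> R by rewrite mulr_ge0 // pi_ge0.
have d4 : 0 < rnorm (f z) / (4 * K) by rewrite divr_gt0 ?rnorm_gt0 // mulr_gt0.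
have cf : {for z, continuous f} by apply: differentiable_continuous; apply: df; apply: ltW.
have [d d0 hd] := (continuous_rballP _ _).1 cf _ d4.
(* Large enough for the loop at U to lie where f differs from f z by at most |f z| / (4 K). *)
pose U := 1 + 2 * r / d.
have U1 : 1 <= U by rewrite /U lerDl divr_ge0 // ?mulr_ge0 // ltW.
have TU : expR (- U ^+ 2) * (2 * r) < d.
  rewrite expRN mulrC ltr_pdivrMr ?expR_gt0 // [d * _]mulrC -ltr_pdivrMr //.
  apply: lt_le_trans (expR_ge1Dx _); apply: (@lt_le_trans _ _ (1 + U)).
    by rewrite /U; lra.
  by rewrite lerD2l; apply: ler_eXnr.
have low t : 4^-1 <= QI U t.
  have hz : rnorm (ze U t - z) < d.
    rewrite /ze addrAC subrr add0r rnormM rnorm_real ger0_norm ?expR_ge0 //.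
    apply: le_lt_trans TU; rewrite ler_wpM2l ?expR_ge0 //.
    by have := rnormD (circle r t) (- z); rewrite rnormN rnorm_circle ?(ltW r0) //; lra.
  have {}hd := hd _ hz.
  have -> : QI U t = complex.Re (circle r t / (circle r t - z)) +
       complex.Im ((f (ze U t) - f z) / f z * q (circle r t)).
    rewrite /QI /Q (_ : f (ze U t) / f z = 1 + (f (ze U t) - f z) / f z); last by field.
    rewrite mulrDl mul1r raddfD /=; congr (_ + _); rewrite /q -mulrA mulrC.
    exact: ImiRe.
  have h1 : `|complex.Im ((f (ze U t) - f z) / f z * q (circle r t))| <= 4^-1.
    apply: (le_trans (Im_le_rnorm _)); rewrite rnormM [X in X * _]rnormM rnormV.
    apply: (@le_trans _ _ (rnorm (f z) / (4 * K) / rnorm (f z) * K)).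
      rewrite ler_pM ?mulr_ge0 ?invr_ge0 ?rnorm_ge0 ?qK //.
      by rewrite ler_wpM2r ?invr_ge0 ?rnorm_ge0 // ltW.
    rewrite le_eqVlt; apply/orP; left; apply/eqP.
    by move: (K) K0 (rnorm (f z)) (rnorm_gt0 fz) => k k0 x x0; field; rewrite !gt_eqF.
  have h2 : 2^-1 <= complex.Re (circle r t / (circle r t - z)).
    by apply: Re_circle_ratio; rewrite rnorm_circle ?(ltW r0).
  by move: h1; rewrite ler_norml => /andP[? ?]; lra.
have := Goursat closedI primA primB (_ : 0 <= U) pi2; rewrite (le_trans _ U1) // => /(_ isT).
(* The sides t = 0 and t = 2 pi cancel because the loops close up. *)
have -> : (A (2 * pi) U - A (2 * pi) 0) - (A 0 U - A 0 0) = 0.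
  have := primitive_of_near (x := 0) (y := U) (c := 0) (e := 0) (primitive_ofB (primA (2 * pi)) (primA 0)).
  rewrite lexx (le_trans _ U1) // => /(_ isT); rewrite !mul0r !subr0 => h.
  have e : (A (2 * pi) U - A (2 * pi) 0) - (A 0 U - A 0 0) = A (2 * pi) U - A 0 U - (A (2 * pi) 0 - A 0 0).
    by ring.
  apply/eqP; rewrite e -normr_le0; apply: h => x _; rewrite subr0 normr_le0 subr_eq0 /PI /P /ze.
  have -> // : circle r (2 * pi) = circle r 0.
  by rewrite /circle mulr_natl cos2pi sin2pi cos0 sin0.
rewrite subr0 => /eqP; rewrite subr_eq0 => /eqP eB.
have pi02 : ((0 : R) <= 0) && ((0 : R) <= 2 * pi) by rewrite lexx pi2.
(* Both periods are values of the integrand times 2 pi, so two values of the integrand agree. *)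
have [c1 _ e1] := primitive_of_mvt (primB U) pi02.
have [c2 _ e2] := primitive_of_mvt (primB 0) pi02.
have pi2' : 2 * pi != 0 :> R by rewrite mulf_neq0 // gt_eqF // pi_gt0.
have e12 : QI U c1 = QI 0 c2.
  by apply: (@mulIf _ (2 * pi - 0)); rewrite ?subr0 // -[2 * pi]subr0 -e1 -e2.
have := low c1; rewrite e12 => h.
have h2 : QI 0 c2 <= M / rnorm (f z) * K.
  apply: le_trans (ler_norm _) _; apply: (le_trans (Im_le_rnorm _)).
  rewrite rnormM [X in X * _]rnormM rnormV ler_pM ?mulr_ge0 ?invr_ge0 ?rnorm_ge0 ?qK // ler_wpM2r ?invr_ge0 ?rnorm_ge0 //.
  by apply: fM; rewrite /ze /T expr0n oppr0 expR0 mul1r subrKC rnorm_circle ?(ltW r0).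
have {}h : 4^-1 * rnorm (f z) <= M * K.
  by have := le_trans h h2; rewrite mulrAC ler_pdivlMr ?rnorm_gt0.
have -> : 8 * r / (r - rnorm z) * M = 8 * (M * K) by rewrite /K; field; rewrite gt_eqF.
have : 0 <= M * K by rewrite mulr_ge0 // ltW.
by lra.
Qed.

End MaximumPrinciple.

(** * Maximum principle and functions with many zeros *)

Section ZerosInDisc.
Variable R : realType.
Local Notation C := R[i].

Lemma le_of_pow (a K x y : R) : 0 < a -> 0 <= x -> 0 <= y ->
  (forall N, a * x ^+ N <= K * y ^+ N) -> x <= y.
Proof.
move=> a0 x0 y0 h; rewrite leNgt; apply/negP => yx.
have xp : 0 < x by apply: le_lt_trans yx.
have := @cvg_geometric R (`|K| + 1) (y / x).
rewrite ger0_norm ?divr_ge0 // ltr_pdivrMr // mul1r => /(_ yx) /cvgrPdist_lt /(_ _ a0).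
move=> [n _ /(_ n (leqnn n))] /=; rewrite sub0r normrN; apply/negP; rewrite -leNgt.
have := h n; rewrite -ler_pdivlMr ?exprn_gt0 // => /le_trans; apply.
rewrite ger0_norm ?mulr_ge0 ?exprn_ge0 ?divr_ge0 ?addr_ge0 // expr_div_n mulrA.
rewrite ler_pM2r ?invr_gt0 ?exprn_gt0 // ler_wpM2r ?exprn_ge0 //.
by apply: le_trans (ler_norm _) _; rewrite lerDl.
Qed.

Lemma differentiable_pow (E : normedModType C) (f : E -> C) n x :
  differentiable f x -> differentiable (fun y => f y ^+ n) x.
Proof.
move=> df; elim: n => [|n IH].
  rewrite (_ : (fun _ => _) = cst 1); first exact: differentiable_cst.
  by apply/funext => y; rewrite expr0.
rewrite (_ : (fun _ => _) = (fun y => f y * f y ^+ n)); first exact: differentiableM.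
by apply/funext => y; rewrite exprS.
Qed.

(** Applied to f ^ N the crude bound loses a constant that does not depend on N, and the N-th root of
   that constant tends to 1. *)
Lemma maximum_principle (f : C -> C) (r M : R) (z : C) : 0 < r -> rnorm z < r ->
  (forall x : C, rnorm x <= r -> differentiable f x) ->
  (forall x : C, rnorm x = r -> rnorm (f x) <= M) -> rnorm (f z) <= M.
Proof.
move=> r0 zr df fM.
have M0 : 0 <= M by apply: le_trans (fM (circle r 0) _); rewrite ?rnorm_ge0 // rnorm_circle ?(ltW r0).
apply: (@le_of_pow 1 (8 * r / (r - rnorm z))); rewrite ?rnorm_ge0 // => N.
rewrite mul1r -rnormX; apply: (@cauchy_crude _ (fun x => f x ^+ N)) => // x xr.
  by apply: differentiable_pow; exact: df.
by rewrite rnormX lerXn2r ?nnegrE ?rnorm_ge0 // fM.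
Qed.

Lemma differentiable_prodB (S : seq C) (x : C) :
  differentiable (fun x => \prod_(s <- S) (x - s)) x.
Proof.
elim: S => [|s S IH].
  rewrite (_ : (fun _ => _) = cst 1); first exact: differentiable_cst.
  by apply/funext => y; rewrite big_nil.
rewrite (_ : (fun _ => _) = (fun x => (x - s) * \prod_(s <- S) (x - s))).
  by apply: differentiableM => //; apply: differentiableB.
by apply/funext => y; rewrite big_cons.
Qed.

Lemma rnorm_prod (S : seq C) (F : C -> C) :
  rnorm (\prod_(s <- S) F s) = \prod_(s <- S) rnorm (F s).
Proof. by elim/big_rec2: _ => [|s a b _ <-]; rewrite ?rnorm1 ?rnormM. Qed.

(** Used at a zero of the denominator, where a quotient that is not known to be differentiable is
   multiplied by a factor with a double zero. *)
Lemma differentiable_quadratic (f : C -> C) (x : C) (K d : R) : 0 < d -> f x = 0 ->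
  (forall h, rnorm h < d -> rnorm (f (x + h)) <= K * rnorm h ^+ 2) -> differentiable f x.
Proof.
move=> d0 fx h; apply: (@frechet_diff _ _ _ _ _ (\0 : {linear C -> C})).
  exact: cst_continuous.
move=> e e0; have K0 : 0 < `|K| + 1 by rewrite ltr_wpDl.
exists (Num.min d (e / (`|K| + 1))); first by rewrite lt_min d0 divr_gt0.
move=> k; rewrite lt_min => /andP[kd]; rewrite ltr_pdivlMr // => ke.
rewrite fx !subr0; apply: (le_trans (h _ kd)); rewrite expr2 mulrA ler_wpM2r ?rnorm_ge0 //.
apply: le_trans (ltW ke); rewrite mulrC ler_wpM2l ?rnorm_ge0 //.
by apply: le_trans (ler_norm _) _; rewrite lerDl.
Qed.

(** A Schwarz lemma. With p the product of the x - s, the functions (f / p)^N p^2 are holomorphic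
   without any theorem on removable singularities: f / p is bounded near each zero, and the factor p^2
   vanishes there to the second order. The factor p^2 again disappears as N grows. *)
Lemma zeros_in_disc (f : C -> C) (r M : R) (S : seq C) (z : C) : 0 < r -> rnorm z < r ->
  (forall x : C, rnorm x <= r -> differentiable f x) ->
  (forall x : C, rnorm x = r -> rnorm (f x) <= M) ->
  uniq S -> (forall s, s \in S -> rnorm s < r /\ f s = 0) ->
  rnorm (f z) * \prod_(s <- S) (r - rnorm s) <= M * \prod_(s <- S) rnorm (z - s).
Proof.
move=> r0 zr df fM uS fS.
have M0 : 0 <= M by apply: le_trans (fM (circle r 0) _); rewrite ?rnorm_ge0 // rnorm_circle ?(ltW r0).
have [zS|zS] := boolP (z \in S).
  rewrite (fS _ zS).2 rnorm0 mul0r mulr_ge0 //.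
  by apply: prodr_ge0 => s _; exact: rnorm_ge0.
pose p (x : C) := \prod_(s <- S) (x - s).
have p0 x : x \notin S -> p x != 0.
  by move=> xS; rewrite prodf_seq_neq0; apply/allP => s sS /=; rewrite subr_eq0; apply: contraNneq xS => ->.
pose m := \prod_(s <- S) (r - rnorm s).
have m0 : 0 < m.
  rewrite /m big_seq; apply: prodr_gt0 => s /fS[sr _]; by rewrite subr_gt0.
have pm x : rnorm x = r -> m <= rnorm (p x).
  move=> xr; rewrite /m /p rnorm_prod big_seq [leRHS]big_seq; apply: ler_prod => s /fS[sr _].
  rewrite subr_ge0 (ltW sr) /=.
  by have := rnorm_leB x s; rewrite xr; lra.
pose P := \prod_(s <- S) (r + rnorm s).
have pP x : rnorm x = r -> rnorm (p x) <= P.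
  move=> xr; rewrite /P /p rnorm_prod; apply: ler_prod => s _.
  rewrite rnorm_ge0 /=; apply: (le_trans (rnormD _ _)).
  by rewrite rnormN xr.
pose h x := f x / p x.
have dG N x : rnorm x <= r -> differentiable (fun x => h x ^+ N * p x ^+ 2) x.
  move=> xr; have [xS|xS] := boolP (x \in S); last first.
    apply: differentiableM; apply: differentiable_pow; last exact: differentiable_prodB.
    apply: differentiableM; first exact: df.
    by apply: differentiableV; [exact: differentiable_prodB|exact: p0].
  pose p' (y : C) := \prod_(s <- rem x S) (y - s).
  have pE y : p y = (y - x) * p' y by rewrite /p (big_rem x).
  have p'x : p' x != 0.
    rewrite prodf_seq_neq0; apply/allP => s sS /=; rewrite subr_eq0.
    by apply: contraTneq sS => ->; rewrite mem_rem_uniq // inE eqxx.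
  have cp' : {for x, continuous p'}.
    by apply: differentiable_continuous; exact: differentiable_prodB.
  have q0 : 0 < rnorm (p' x) / 2 by rewrite divr_gt0 // rnorm_gt0.
  have [d1 d10 h1] := (continuous_rballP _ _).1 cp' _ q0.
  have [c fc] := diff_cfrechet (df x xr).
  have [d2 d20 h2] := fc _ ltr01.
  pose q := rnorm (p' x); have q1 : 0 < q by exact: rnorm_gt0.
  (* Near x one has |f| <= (1 + |c|) |k| and q / 2 <= |p'| <= 2 q. *)
  pose K := ((1 + rnorm c) / (q / 2)) ^+ N * (2 * q) ^+ 2.
  apply: (@differentiable_quadratic _ _ K (Num.min d1 d2)); first by rewrite lt_min d10.
    by rewrite pE subrr mul0r expr0n mulr0.
  move=> k; rewrite lt_min => /andP[k1 k2].
  have {}h1 : rnorm (p' (x + k) - p' x) < q / 2 by apply: h1; rewrite addrC addKr.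
  have {}h2 := h2 _ k2; rewrite (fS _ xS).2 subr0 mul1r in h2.
  have lo : q / 2 <= rnorm (p' (x + k)).
    by have := rnorm_leB (p' x) (p' (x + k)); rewrite rnormB -/q; lra.
  have hi : rnorm (p' (x + k)) <= 2 * q.
    by have := rnorm_leB (p' (x + k)) (p' x); rewrite -/q; lra.
  have lo0 : 0 < rnorm (p' (x + k)) by lra.
  have hf : rnorm (f (x + k)) <= (1 + rnorm c) * rnorm k.
    by have := rnorm_leB (f (x + k)) (c * k); rewrite rnormM; lra.
  have -> : rnorm (h (x + k) ^+ N * p (x + k) ^+ 2) =
     rnorm (h (x + k)) ^+ N * rnorm (p' (x + k)) ^+ 2 * rnorm k ^+ 2.
    by rewrite rnormM !rnormX pE (addrC x) addrK rnormM exprMn mulrCA mulrC.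
  have c0 := rnorm_ge0 c.
  rewrite /K ler_wpM2r ?exprn_ge0 ?rnorm_ge0 // ler_pM ?exprn_ge0 ?rnorm_ge0 //; last first.
    by rewrite lerXn2r ?nnegrE ?rnorm_ge0 ?mulr_ge0 ?rnorm_ge0.
  rewrite lerXn2r ?nnegrE ?rnorm_ge0 ?divr_ge0 ?addr_ge0 ?rnorm_ge0 //.
  rewrite /h rnormM rnormV pE (addrC x) addrK rnormM.
  have [->|k0] := eqVneq k 0; first by rewrite rnorm0 mul0r invr0 mulr0 mulr_ge0 ?invr_ge0 ?divr_ge0 ?addr_ge0 ?rnorm_ge0.
  have kp := rnorm_gt0 k0.
  rewrite ler_pdivrMr ?mulr_gt0 //; last by rewrite addrC.
  apply: (@le_trans _ _ ((1 + rnorm c) / (q / 2) * (rnorm k * (q / 2)))).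
    rewrite [k + x]addrC; apply: (le_trans hf); rewrite le_eqVlt; apply/orP; left; apply/eqP.
    by field; rewrite gt_eqF.
  rewrite ler_wpM2l ?mulr_ge0 ?invr_ge0 ?divr_ge0 ?addr_ge0 ?rnorm_ge0 // ler_pM2l //.
  by rewrite [k + x]addrC.
have key : rnorm (h z) <= M / m.
  apply: (@le_of_pow (rnorm (p z) ^+ 2) (P ^+ 2)); rewrite ?rnorm_ge0 ?divr_ge0 ?(ltW m0) //.
    by rewrite exprn_gt0 // rnorm_gt0 // p0.
  move=> N; rewrite mulrC [P ^+ 2 * _]mulrC -!rnormX -rnormM.
  apply: (@maximum_principle (fun x => h x ^+ N * p x ^+ 2) r _ z r0 zr (dG N)).
  move=> x xr; rewrite rnormM !rnormX ler_pM ?exprn_ge0 ?rnorm_ge0 //; last first.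
    by rewrite lerXn2r ?nnegrE ?rnorm_ge0 ?pP // (le_trans (rnorm_ge0 (p x))) ?pP.
  rewrite lerXn2r ?nnegrE ?rnorm_ge0 ?divr_ge0 ?(ltW m0) //.
  rewrite /h rnormM rnormV ler_pM ?invr_ge0 ?rnorm_ge0 ?fM //.
  by rewrite lef_pV2 ?posrE ?pm // (lt_le_trans m0) ?pm.
move: key; rewrite /h rnormM rnormV ler_pdivrMr ?rnorm_gt0 ?p0 // mulrAC ler_pdivlMr //.
by rewrite /p rnorm_prod.
Qed.

End ZerosInDisc.

(** * Bounded holomorphic functions *)

Section BoundedHolomorphic.
Variable R : realType.
Local Notation C := R[i].

Lemma real_complex_neq0 (s : R) : s != 0 -> s%:C != 0 :> C.
Proof. by rewrite eq_complex /= eqxx andbT. Qed.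

Definition cvgc (u : nat -> C) (l : C) := forall e : R, 0 < e -> exists N, forall n, (N <= n)%N -> rnorm (u n - l) <= e.

Lemma rnorm_le_eps (E : normedModType C) (x : E) : (forall e : R, 0 < e -> rnorm x <= e) -> x = 0.
Proof.
move=> h; apply: rnorm_eq0; apply/eqP; rewrite eq_le rnorm_ge0 andbT.
by apply/ler_addgt0Pr => e e0; rewrite add0r h.
Qed.

Lemma real_cauchy (u : nat -> R) :
  (forall e : R, 0 < e -> exists N, forall m n, (N <= m)%N -> (N <= n)%N -> `|u m - u n| <= e) ->
  exists l : R, forall e : R, 0 < e -> exists N, forall n, (N <= n)%N -> `|u n - l| <= e.
Proof.
move=> h.
have /cvg_ex[l /cvgrPdist_le hl] : cvgn u.
  apply/cauchy_cvgP/cauchy_ballP => e e0.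
  have e2 : 0 < e / 2 by rewrite divr_gt0.
  have [N hN] := h _ e2.
  pose S := [set x | exists2 n, (N <= n)%N & x = u n].
  exists (S, S); first by split; exists N => // n nN; exists n.
  move=> [_ _] [[m mN ->] [n nN ->]]; rewrite -ball_normE /=.
  by apply: (le_lt_trans (hN _ _ mN nN)); rewrite gtr_pMr // invf_lt1 // ltr1n.
exists l => e /hl[N _ hN]; exists N => n nN; rewrite distrC; exact: hN.
Qed.

Lemma complex_cauchy (u : nat -> C) :
  (forall e : R, 0 < e -> exists N, forall m n, (N <= m)%N -> (N <= n)%N -> rnorm (u m - u n) <= e) ->
  exists l, cvgc u l.
Proof.
move=> h.
have [a ha] : exists l : R, forall e : R, 0 < e -> exists N, forall n, (N <= n)%N -> `|complex.Re (u n) - l| <= e.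
  apply: real_cauchy => e /h[N hN]; exists N => m n mN nN.
  apply: le_trans (hN _ _ mN nN); rewrite -raddfB; exact: Re_le_rnorm.
have [b hb] : exists l : R, forall e : R, 0 < e -> exists N, forall n, (N <= n)%N -> `|complex.Im (u n) - l| <= e.
  apply: real_cauchy => e /h[N hN]; exists N => m n mN nN.
  apply: le_trans (hN _ _ mN nN); rewrite -raddfB; exact: Im_le_rnorm.
exists (a +i* b) => e e0; have e2 : 0 < e / 2 by rewrite divr_gt0.
have [N1 h1] := ha _ e2; have [N2 h2] := hb _ e2; exists (maxn N1 N2) => n.
rewrite geq_max => /andP[n1 n2]; apply: (le_trans (rnorm_le_ReIm _)).
by rewrite !raddfB /=; have := h1 _ n1; have := h2 _ n2; lra.
Qed.

Lemma diff_scale (E : normedModType C) (f : E -> C) x (c : C) h :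
  'd f x (c *: h) = c * 'd f x h.
Proof. by rewrite linearZ. Qed.

(** Bounds travel with holomorphy because every estimate below is in terms of them. *)
Definition bhol (E : normedModType C) (f : E -> C) (a : E) (rho M : R) :=
  forall x, rball a rho x -> differentiable f x /\ rnorm (f x) <= M.

Section Estimates.
Variables (E : normedModType C) (a : E) (rho : R).
Hypothesis rho0 : 0 < rho.

Lemma bhol_ge0 f M : bhol f a rho M -> 0 <= M.
Proof. by move=> /(_ a (rball_center _ rho0))[_]; apply: le_trans; exact: rnorm_ge0. Qed.

Lemma rball_addr (x v : E) (r s : R) : rball a r x -> rnorm v <= s -> rball a (r + s) (x + v).
Proof.
by rewrite /rball /= => xr vs; have := rnormD (x - a) v; rewrite addrAC; lra.
Qed.

Lemma differentiable_line (f : E -> C) (x v : E) (t : C) :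
  differentiable f (x + t *: v) -> differentiable (fun t : C => f (x + t *: v)) t.
Proof.
move=> df; apply: (@differentiable_comp _ _ _ _ (fun t : C => x + t *: v) f) => //.
Qed.

(** The Schwarz lemma on the complex line t |-> x + t v, for the function f (x + t v) - f x with its
   zero at t = 0. *)
Lemma bhol_lipschitz f M x v : bhol f a rho M -> rball a (rho / 2) x -> rnorm v < rho / 2 ->
  rnorm (f (x + v) - f x) <= 4 * M / rho * rnorm v.
Proof.
move=> hf xa v2; have M0 := bhol_ge0 hf.
have [->|v0] := eqVneq v 0; first by rewrite addr0 subrr !rnorm0 mulr0.
have v1 := rnorm_gt0 v0; pose r := rho / 2 / rnorm v.
have r1 : 1 < r by rewrite /r ltr_pdivlMr // mul1r.
have inb (t : C) : rnorm t <= r -> rball a rho (x + t *: v).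
  move=> tr; rewrite [rho](splitr); apply: rball_addr => //; rewrite rnormZ.
  by move: tr; rewrite /r ler_pdivlMr.
have r0 : 0 < r by lra.
have := @zeros_in_disc R (fun t : C => f (x + t *: v) - f x) r (2 * M) [:: 0] 1 r0.
rewrite !big_cons !big_nil rnorm0 !subr0 !mulr1 rnorm1 scale1r => h.
have {h} : rnorm (f (x + v) - f x) * r <= 2 * M.
  rewrite -[2 * M]mulr1; apply: h; [exact: r1| | |by []|].
  - move=> t tr; apply: differentiableB; last exact: differentiable_cst.
    by apply: differentiable_line; case: (hf _ (inb _ tr)).
  - move=> t tr; apply: (le_trans (rnormD _ _)); rewrite rnormN.
    have [_ h1] : differentiable f (x + t *: v) /\ rnorm (f (x + t *: v)) <= M by apply/hf/inb; rewrite tr.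
    have [_ h2] : differentiable f x /\ rnorm (f x) <= M.
      by apply: hf; apply: rball_le xa; lra.
    by lra.
  - by move=> s; rewrite inE => /eqP ->; rewrite rnorm0 scale0r addr0 subrr.
rewrite -ler_pdivlMr // => /le_trans; apply; rewrite /r le_eqVlt; apply/orP; left; apply/eqP.
by field; rewrite !gt_eqF.
Qed.

(** Allows the Lipschitz bound to be iterated. *)
Lemma bhol_shiftB f M h : bhol f a rho M -> rnorm h < rho / 2 ->
  bhol (fun x => f (x + h) - f x) a (rho / 2) (4 * M / rho * rnorm h).
Proof.
move=> hf h2 x xa; split; last exact: bhol_lipschitz.
have rp := rho0; have xa' : rball a rho x by apply: rball_le xa; lra.
have xh : rball a rho (x + h) by rewrite [rho]splitr; apply: rball_addr => //; exact: ltW.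
apply: differentiableB; last by case: (hf _ xa').
apply: (@differentiable_comp _ _ _ _ (fun x => x + h) f); last by case: (hf _ xh).
by apply: differentiableD => //; exact: differentiable_cst.
Qed.

End Estimates.

Section Taylor.
Variables (E : normedModType C) (a : E) (rho : R).
Hypothesis rho0 : 0 < rho.
Variables (f : E -> C) (M : R).
Hypothesis hf : bhol f a rho M.

Lemma bhol_second_difference x h k : rball a (rho / 4) x -> rnorm h < rho / 2 -> rnorm k < rho / 4 ->
  rnorm (f (x + k + h) - f (x + k) - (f (x + h) - f x)) <= 32 * M / rho ^+ 2 * rnorm h * rnorm k.
Proof.
move=> xa h2 k4; have r2 : 0 < rho / 2 by rewrite divr_gt0.
have e4 : rho / 2 / 2 = rho / 4 by field.
have := bhol_lipschitz r2 (bhol_shiftB rho0 hf h2) (v := k) (x := x); rewrite e4 => /(_ xa k4).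
move=> /le_trans; apply; rewrite le_eqVlt; apply/orP; left; apply/eqP.
by field; rewrite gt_eqF.
Qed.

(** Telescoping over N equal steps compares f (x + h) - f x with N (f (x + h / N) - f x). *)
Lemma bhol_taylor x h : rball a (rho / 4) x -> rnorm h < rho / 4 ->
  rnorm (f (x + h) - f x - 'd f x h) <= 32 * M / rho ^+ 2 * rnorm h ^+ 2.
Proof.
move=> xa h4; have rp := rho0; have M0 := bhol_ge0 rho0 hf.
set K := 32 * M / rho ^+ 2.
have K0 : 0 <= K by rewrite /K !mulr_ge0 // invr_ge0 exprn_ge0 // ltW.
have xr : rball a rho x by apply: rball_le xa; lra.
have [df _] := hf xr; have cf := diff_frechet df.
apply/ler_addgt0Pr => e e0.
have [h0|h0] := eqVneq h 0; first by rewrite h0 addr0 subrr linear0 subr0 !rnorm0 expr0n mulr0 add0r ltW.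
have hp := rnorm_gt0 h0; have eh : 0 < e / rnorm h by rewrite divr_gt0.
have [d d0 hd] := cf _ eh.
have [N hN] : exists N, rnorm h / N.+1%:R < d.
  exists (Num.trunc (rnorm h / d)); rewrite ltr_pdivrMr // mulrC -ltr_pdivrMr //.
  exact: truncnS_gt.
pose n : C := N.+1%:R; have n0 : n != 0 by rewrite pnatr_eq0.
have rn : rnorm n = N.+1%:R by rewrite /n -(rmorph_nat (real_complex R)) rnorm_real ger0_norm.
have n0' : 0 < N.+1%:R :> R by [].
pose k := n^-1 *: h; have rk : rnorm k = rnorm h / N.+1%:R by rewrite rnormZ rnormV rn mulrC.
have tel : f (x + h) - f x - n * (f (x + k) - f x) =
   \sum_(j < N.+1) (f (x + j%:R *: k + k) - f (x + j%:R *: k) - (f (x + k) - f x)).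
  rewrite big_split /= sumr_const card_ord -mulr_natl mulrN; congr (_ + _).
  rewrite -(big_mkord xpredT (fun j => f (x + j%:R *: k + k) - f (x + j%:R *: k))).
  rewrite (eq_bigr (fun j => f (x + j.+1%:R *: k) - f (x + j%:R *: k))); last first.
    by move=> j _; rewrite -natr1 scalerDl scale1r addrA.
  by rewrite telescope_sumr // scale0r addr0 scalerA divff // scale1r.
have -> : f (x + h) - f x - 'd f x h = (f (x + h) - f x - n * (f (x + k) - f x)) +
    n * (f (x + k) - f x - 'd f x k).
  have -> : 'd f x k = n^-1 * 'd f x h by exact: diff_scale.
  by field.
apply: (le_trans (rnormCD _ _)); apply: lerD.
  rewrite tel; apply: (le_trans (rnorm_sum _ _ _)).
  apply: (@le_trans _ _ (\sum_(j < N.+1) (K * rnorm k * rnorm h))).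
    apply: ler_sum => j _.
    have jk : rnorm (j%:R *: k) <= rnorm h.
      rewrite rnormZ rk -(rmorph_nat (real_complex R)) rnorm_real ger0_norm // mulrCA ler_piMr ?rnorm_ge0 //.
      by rewrite ler_pdivrMr // mul1r ler_nat ltnW.
    have kh : rnorm k <= rnorm h by rewrite rk ler_pdivrMr // ler_peMr ?rnorm_ge0 // ler1n.
    apply: le_trans (bhol_second_difference xa _ _) _; [by lra|by lra|].
    by rewrite -/K ler_wpM2l // mulr_ge0 // rnorm_ge0.
  rewrite sumr_const card_ord rk -mulr_natr le_eqVlt; apply/orP; left; apply/eqP.
  by field; rewrite ?gt_eqF // ?natr1.
rewrite rnormM rn; have := hd k; rewrite rk => /(_ hN) hk.
apply: (@le_trans _ _ (N.+1%:R * (e / rnorm h * (rnorm h / N.+1%:R)))).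
  by rewrite ler_pM2l.
rewrite le_eqVlt; apply/orP; left; apply/eqP.
by field; rewrite ?gt_eqF // ?natr1.
Qed.

End Taylor.

(** The quadratic Taylor remainders are uniform in n, so the differentials at a point form a
   Cauchy sequence, whose limit is the differential of the limit. *)
Lemma bhol_limit (E : normedModType C) (a : E) (rho M : R) (F : nat -> E -> C) f : 0 < rho ->
  (forall n, bhol (F n) a rho M) -> (forall x, rball a rho x -> cvgc (fun n => F n x) (f x)) ->
  bhol f a (rho / 4) M.
Proof.
move=> rho0 hF hcv x xa; have xr : rball a rho x by apply: rball_le xa; lra.
split; last first.
  apply/ler_addgt0Pr => e /(hcv _ xr)[N hN].
  have := rnorm_leB (f x) (F N x); rewrite rnormB => h.
  by have := hN _ (leqnn N); have [_] := hF N _ xr; lra.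
have M0 := bhol_ge0 rho0 (hF 0%N).
set K := 32 * M / rho ^+ 2.
have K0 : 0 <= K by rewrite /K !mulr_ge0 // invr_ge0 exprn_ge0 // ltW.
have [dF [tay dFZ dFD]] : exists dF : nat -> E -> C,
    [/\ forall n h, rnorm h < rho / 4 -> rnorm (F n (x + h) - F n x - dF n h) <= K * rnorm h ^+ 2,
       forall n c h, dF n (c *: h) = c * dF n h & forall n u v, dF n (u + v) = dF n u + dF n v].
  exists (fun n h => 'd (F n) x h); split => [n h h4|n c h|n u v].
  - exact: (bhol_taylor rho0 (hF n) xa h4).
  - exact: diff_scale.
  - exact: linearD.
have cau h : exists l, cvgc (fun n => dF n h) l.
  apply: complex_cauchy => e e0.
  have h0 := rnorm_ge0 h.
  pose B := K * rnorm h ^+ 2 + 1; have B0 : 0 < B by rewrite ltr_wpDl // mulr_ge0 // exprn_ge0.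
  have [s s0 [sh KB]] : exists2 s : R, 0 < s & rnorm (s%:C *: h) < rho / 4 /\
      K * rnorm (s%:C *: h) ^+ 2 <= s * e / 4.
    pose s := Num.min (e / (4 * B)) (rho / (8 * (rnorm h + 1))).
    have s0 : 0 < s by rewrite lt_min !divr_gt0 // mulr_gt0 // ltr_wpDl.
    have sh : rnorm (s%:C *: h) < rho / 4.
      rewrite rnormZ rnorm_real ger0_norm ?(ltW s0) //.
      have : s <= rho / (8 * (rnorm h + 1)) by rewrite /s ge_min lexx orbT.
      rewrite ler_pdivlMr ?mulr_gt0 ?ltr_wpDl // => hs.
      have : 0 <= s * rnorm h by rewrite mulr_ge0 // (ltW s0).
      by lra.
    have KB : K * rnorm (s%:C *: h) ^+ 2 <= s * e / 4.
      rewrite rnormZ rnorm_real ger0_norm ?(ltW s0) // exprMn.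
      apply: (@le_trans _ _ (s * (s * B))).
        by rewrite mulrCA expr2 -mulrA ler_pM2l // ler_pM2l // /B lerDl.
      rewrite -mulrA ler_pM2l //.
      have : s <= e / (4 * B) by rewrite /s ge_min lexx.
      rewrite ler_pdivlMr ?mulr_gt0 // => hs; by lra.
    by exists s.
  have se : 0 < s * e / 8 by rewrite !divr_gt0 // mulr_gt0.
  have xh : rball a rho (x + s%:C *: h).
    by apply: rball_le (rball_addr xa (ltW sh)); lra.
  have [N1 h1] := hcv _ xr _ se; have [N2 h2] := hcv _ xh _ se.
  exists (maxn N1 N2) => m n; rewrite !geq_max => /andP[m1 m2] /andP[n1 n2].
  have tm := tay m _ sh; have tn := tay n _ sh.
  have {}m1 := h1 _ m1; have {}m2 := h2 _ m2; have {}n1 := h1 _ n1; have {}n2 := h2 _ n2.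
  have sC : s%:C != 0 :> C by apply/real_complex_neq0/lt0r_neq0.
  have -> : dF m h - dF n h = s%:C^-1 * (dF m (s%:C *: h) - dF n (s%:C *: h)).
    by rewrite !dFZ -mulrBr mulKf.
  rewrite rnormM rnormV rnorm_real ger0_norm ?(ltW s0) // mulrC ler_pdivrMr //.
  have -> : dF m (s%:C *: h) - dF n (s%:C *: h) =
    - (F m (x + s%:C *: h) - F m x - dF m (s%:C *: h)) +
    (F n (x + s%:C *: h) - F n x - dF n (s%:C *: h)) +
    ((F m (x + s%:C *: h) - f (x + s%:C *: h)) - (F n (x + s%:C *: h) - f (x + s%:C *: h))) +
    (- (F m x - f x) + (F n x - f x)) by ring.
  apply: (le_trans (rnormCD _ _)); apply: (le_trans (lerD (rnormCD _ _) (rnormCD _ _))).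
  apply: (le_trans (lerD (lerD (rnormCD _ _) (rnormD _ _)) (lexx _))).
  rewrite !rnormN; move: tm tn m1 m2 n1 n2 KB.
  move: (rnorm _) (rnorm _) (rnorm _) (rnorm _) (rnorm _) (rnorm _) => *; lra.
have /choice[D hD] := cau.
have Dlin : linear D.
  move=> c u v; apply/subr0_eq/rnorm_le_eps => e e0.
  have ec : 0 < e / 3 / (rnorm c + 1) by rewrite !divr_gt0 // ltr_wpDl // rnorm_ge0.
  have e3 : 0 < e / 3 by rewrite divr_gt0.
  have [N1 h1] := hD (c *: u + v) _ e3; have [N2 h2] := hD u _ ec; have [N3 h3] := hD v _ e3.
  pose n := maxn N1 (maxn N2 N3).
  have {}h1 := h1 n (leq_maxl _ _).
  have {}h2 := h2 n (leq_trans (leq_maxl _ _) (leq_maxr _ _)).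
  have {}h3 := h3 n (leq_trans (leq_maxr _ _) (leq_maxr _ _)).
  have -> : D (c *: u + v) - (c *: D u + D v) = - (dF n (c *: u + v) - D (c *: u + v)) +
      c * (dF n u - D u) + (dF n v - D v).
    by rewrite dFD dFZ /GRing.scale /=; ring.
  apply: (le_trans (rnormCD _ _)); apply: (le_trans (lerD (rnormCD _ _) (lexx _))).
  rewrite rnormN rnormM.
  have : rnorm c * rnorm (dF n u - D u) <= e / 3.
    apply: (@le_trans _ _ ((rnorm c + 1) * (e / 3 / (rnorm c + 1)))).
      by rewrite ler_pM ?rnorm_ge0 // lerDl.
    by rewrite mulrC divfK // gt_eqF // ltr_wpDl // rnorm_ge0.
  by lra.
have tayD h : rnorm h < rho / 4 -> rnorm (f (x + h) - f x - D h) <= K * rnorm h ^+ 2.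
  move=> h4; apply/ler_addgt0Pr => e e0; have e3 : 0 < e / 3 by rewrite divr_gt0.
  have xh : rball a rho (x + h) by apply: rball_le (rball_addr xa (ltW h4)); lra.
  have [N1 h1] := hcv _ xr _ e3; have [N2 h2] := hcv _ xh _ e3; have [N3 h3] := hD h _ e3.
  pose n := maxn N1 (maxn N2 N3).
  have {}h1 := h1 n (leq_maxl _ _).
  have {}h2 := h2 n (leq_trans (leq_maxl _ _) (leq_maxr _ _)).
  have {}h3 := h3 n (leq_trans (leq_maxr _ _) (leq_maxr _ _)).
  have -> : f (x + h) - f x - D h = (F n (x + h) - F n x - dF n h) +
     - (F n (x + h) - f (x + h)) + ((F n x - f x) + (dF n h - D h)) by ring.
  apply: (le_trans (rnormCD _ _)); apply: (le_trans (lerD (rnormCD _ _) (rnormCD _ _))).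
  by rewrite rnormN; have := tay n _ h4; lra.
pose DL : {linear E -> C} := HB.pack D (GRing.isLinear.Build _ _ _ _ D Dlin).
apply: (@frechet_diff _ _ _ _ _ DL).
  move=> y; apply/continuous_rballP => e e0.
  pose r := rho / 8; have r0 : 0 < r by rewrite divr_gt0.
  pose B := (K * r ^+ 2 + 2 * M) / r.
  have rM : 0 <= K * r ^+ 2 + 2 * M.
    by apply: addr_ge0; apply: mulr_ge0 => //; exact: exprn_ge0 (ltW r0).
  have B0 : 0 <= B by rewrite /B divr_ge0 // ltW.
  have fM z : rball a rho z -> rnorm (f z) <= M.
    move=> zr; apply/ler_addgt0Pr => e' /(hcv _ zr)[N hN].
    have := rnorm_leB (f z) (F N z); rewrite rnormB => h.
    by have := hN _ (leqnn N); have [_] := hF N _ zr; lra.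
  have DZ (c : C) h : D (c *: h) = c * D h by exact: (@linearZ_LR _ _ _ _ DL).
  have DB h : rnorm (D h) <= B * rnorm h.
    have [->|h0] := eqVneq h 0.
      by rewrite -[0]/(0 : E) -(scale0r (0 : E)) DZ mul0r scale0r !rnorm0 mulr0.
    have hp := rnorm_gt0 h0.
    pose c : C := (r / rnorm h)%:C; have c0 : 0 < r / rnorm h by rewrite divr_gt0.
    have cn : c != 0 by apply/real_complex_neq0/lt0r_neq0.
    have rc : rnorm (c *: h) = r by rewrite rnormZ rnorm_real ger0_norm ?(ltW c0) // divfK // gt_eqF.
    have ch : rnorm (c *: h) < rho / 4 by rewrite rc /r; lra.
    have xh : rball a rho (x + c *: h) by apply: rball_le (rball_addr xa (ltW ch)); lra.
    have h1 : rnorm (D (c *: h)) <= K * r ^+ 2 + 2 * M.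
      have -> : D (c *: h) = - (f (x + c *: h) - f x - D (c *: h)) + (f (x + c *: h) - f x) by ring.
      apply: (le_trans (rnormCD _ _)); rewrite rnormN.
      have := tayD _ ch; rewrite rc; have := rnormCD (f (x + c *: h)) (- f x); rewrite rnormN.
      by have := fM _ xr; have := fM _ xh; lra.
    have : rnorm (D (c *: h)) = r / rnorm h * rnorm (D h).
      by rewrite DZ rnormM rnorm_real ger0_norm // ltW.
    move=> e'; move: h1; rewrite e' mulrAC ler_pdivrMr // => h1.
    by rewrite /B mulrAC ler_pdivlMr // mulrC.
  exists (e / (B + 1)); first by rewrite divr_gt0 // ltr_wpDl.
  move=> z; rewrite ltr_pdivlMr ?ltr_wpDl // => hz.
  have -> : DL z - DL y = D (z - y) by exact: (esym (raddfB DL z y)).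
  apply: le_lt_trans (DB _) _.
  apply: le_lt_trans hz; rewrite mulrC ler_wpM2l ?rnorm_ge0 // lerDl.
  exact: ler01.
move=> e e0; have K1 : 0 < K + 1 by rewrite ltr_wpDl.
exists (Num.min (rho / 4) (e / (K + 1))); first by rewrite lt_min !divr_gt0.
move=> h; rewrite lt_min => /andP[h4]; rewrite ltr_pdivlMr // => he.
apply: (le_trans (tayD _ h4)); rewrite expr2 mulrA ler_wpM2r ?rnorm_ge0 //.
by apply: le_trans (ltW he); rewrite mulrC ler_wpM2l ?rnorm_ge0 // lerDl.
Qed.

End BoundedHolomorphic.

(** * Complex exponential and principal logarithm *)

Section ComplexExpLog.
Variable R : realType.
Local Notation C := R[i].

Lemma cfrechet_diff (f : C -> C) z c : frechet f z (fun h => c * h) -> differentiable f z.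
Proof.
move=> h; apply: (@frechet_diff _ _ _ _ _ ( *:%R c : {linear C -> C})) => //.
exact: scaler_continuous.
Qed.

Definition cexp (z : C) : C :=
  (expR (complex.Re z))%:C * ((cos (complex.Im z))%:C + 'i%C * (sin (complex.Im z))%:C).

Lemma cexpD z w : cexp (z + w) = cexp z * cexp w.
Proof.
case: z w => [a b] [c d]; rewrite /cexp /= expRD cosD sinD.
by rewrite rmorphM rmorphB rmorphD !rmorphM /=; apply/eqP; rewrite eq_complex /=; apply/andP; split; apply/eqP; ring.
Qed.

Lemma cexp_real (x : R) : cexp x%:C = (expR x)%:C.
Proof. by rewrite /cexp /= cos0 sin0 rmorph1 rmorph0 mulr0 addr0 mulr1. Qed.

Lemma cexp0 : cexp 0 = 1.
Proof. by rewrite (cexp_real 0) expR0. Qed.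

Lemma cexp_conj z : cexp (Num.conj z) = Num.conj (cexp z).
Proof.
case: z => [a b]; rewrite /cexp /= cosN sinN.
by apply/eqP; rewrite eq_complex /=; apply/andP; split; apply/eqP; ring.
Qed.

Lemma frechet_cexp0 : frechet cexp 0 (fun h => h).
Proof.
have h : cdiff2 (fun s t : R => (expR s)%:C * ((cos t)%:C + 'i%C * (sin t)%:C)) 0 0 1 'i%C.
  apply: (cdiff2_ext (fun s t => erefl) _ _ (cdiff2M (cdiff2_fst 0 (cdiff1_real (is_derive_expR 0)))
    (cdiff2D (cdiff2_snd 0 (cdiff1_real (is_derive_cos 0)))
       (cdiff2Z 'i%C (cdiff2_snd 0 (cdiff1_real (is_derive_sin 0))))))).
  - by rewrite expR0 cos0 sin0 rmorph1 rmorph0; ring.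
  - by rewrite expR0 cos0 sin0 oppr0 rmorph1 rmorph0; ring.
move=> e e0; have e2 : 0 < e / 2 by rewrite divr_gt0.
have [d d0 {}h] := h _ e2; exists d => // z zd.
have rz := Re_le_rnorm z; have iz := Im_le_rnorm z.
have := h (complex.Re z) (complex.Im z); rewrite !subr0 => /(_ (le_lt_trans rz zd) (le_lt_trans iz zd)).
rewrite expR0 cos0 sin0 rmorph1 rmorph0 mulr0 addr0 mulr1 mul1r add0r cexp0.
have -> : cexp z - 1 - z = cexp z - 1 - (complex.Re z)%:C - 'i%C * (complex.Im z)%:C.
  by rewrite {2}[z]complexE opprD addrA.
move=> /le_trans; apply.
apply: (@le_trans _ _ (e / 2 * (rnorm z + rnorm z))); last by lra.
by rewrite ler_pM2l // lerD.
Qed.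

Lemma differentiable_cexp z : differentiable cexp z.
Proof.
apply: (@cfrechet_diff _ _ (cexp z)) => e e0.
have K0 : 0 < rnorm (cexp z) + 1 by rewrite ltr_wpDl // rnorm_ge0.
have [d d0 h] := frechet_cexp0 (divr_gt0 e0 K0); exists d => // k kd.
have := h k kd; rewrite add0r cexp0 => {}h.
have -> : cexp (z + k) - cexp z - cexp z * k = cexp z * (cexp k - 1 - k) by rewrite cexpD; ring.
rewrite rnormM; apply: (@le_trans _ _ ((rnorm (cexp z) + 1) * (e / (rnorm (cexp z) + 1) * rnorm k))).
  by rewrite ler_pM ?rnorm_ge0 // lerDl.
by rewrite mulrA [_ * (e / _)]mulrC divfK // gt_eqF.
Qed.

(** The principal branch on the right half-plane, the only region where it is used. *)
Definition clog (z : C) : C := ln (rnorm z) +i* atan (complex.Im z / complex.Re z).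

Lemma clog_real (x : R) : 0 < x -> clog x%:C = (ln x)%:C.
Proof. by move=> x0; rewrite /clog rnorm_real ger0_norm ?(ltW x0) //= mul0r atan0. Qed.

Lemma clog_conj z : clog (Num.conj z) = Num.conj (clog z).
Proof.
by rewrite /clog rnorm_conj; case: z => [a b] /=; rewrite mulNr atanN.
Qed.

Lemma cexp_clog z : 0 < complex.Re z -> cexp (clog z) = z.
Proof.
move=> z0; have z1 : z != 0 by apply: contraTneq z0 => ->; rewrite ltxx.
rewrite /cexp /= lnK ?posrE ?rnorm_gt0 //.
have rz := rnorm_gt0 z1.
have e : Num.sqrt (1 + (complex.Im z / complex.Re z) ^+ 2) = rnorm z / complex.Re z.
  have -> : 1 + (complex.Im z / complex.Re z) ^+ 2 = (rnorm z / complex.Re z) ^+ 2.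
    by rewrite [RHS]expr_div_n rnorm_sqr; field; rewrite gt_eqF.
  by rewrite sqrtr_sqr ger0_norm // divr_ge0 ?rnorm_ge0 // ltW.
have c : cos (atan (complex.Im z / complex.Re z)) = complex.Re z / rnorm z.
  by rewrite cos_atan e invf_div.
have s : sin (atan (complex.Im z / complex.Re z)) = complex.Im z / rnorm z.
  have := atanK (complex.Im z / complex.Re z); rewrite /tan c => h.
  have c0 : complex.Re z / rnorm z != 0 by rewrite mulf_neq0 ?invr_eq0 ?gt_eqF.
  by rewrite -[LHS](divfK c0) h; field; rewrite !gt_eqF.
rewrite c s [RHS]complexE; apply/eqP; rewrite eq_complex /=.
by apply/andP; split; apply/eqP; field; rewrite gt_eqF.
Qed.

Lemma continuous_realP (E : normedModType C) (g : E -> R) z : {for z, continuous g} <->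
  forall e : R, 0 < e -> exists2 d : R, 0 < d & forall w, rnorm (w - z) < d -> `|g w - g z| < e.
Proof.
split=> [cg e e0|h].
  have /cvgrPdist_lt /(_ _ e0) /nbhs_rballP[d d0 hd] := cg.
  by exists d => // w /hd /=; rewrite distrC.
apply/cvgrPdist_lt => e /h[d d0 hd]; apply/nbhs_rballP; exists d => // w /hd.
by rewrite distrC.
Qed.

Lemma continuous_real_lip (E : normedModType C) (g : E -> R) z :
  (forall w, `|g w - g z| <= rnorm (w - z)) -> {for z, continuous g}.
Proof.
by move=> h; apply/continuous_realP => e e0; exists e => // w; exact: le_lt_trans.
Qed.

Lemma continuous_clog z : 0 < complex.Re z -> {for z, continuous clog}.
Proof.
move=> z0; have z1 : z != 0 by apply: contraTneq z0 => ->; rewrite ltxx.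
have cn : {for z, continuous (@rnorm R C)}.
  apply: continuous_real_lip => w; rewrite ler_norml; apply/andP.
  by have := rnorm_leB w z; have := rnorm_leB z w; rewrite (rnormB z w); split; lra.
have cR : {for z, continuous (@complex.Re R)}.
  by apply: continuous_real_lip => w; rewrite -raddfB Re_le_rnorm.
have cI : {for z, continuous (@complex.Im R)}.
  by apply: continuous_real_lip => w; rewrite -raddfB Im_le_rnorm.
have cl : {for z, continuous (fun w : C => ln (rnorm w))}.
  by apply: continuous_comp cn _; apply: continuous_ln; exact: rnorm_gt0.
have ca : {for z, continuous (fun w : C => atan (complex.Im w / complex.Re w))}.
  apply: (@continuous_comp _ _ _ (fun w : C => complex.Im w / complex.Re w)); last exact: continuous_atan.
  by apply: continuousM => //; apply: continuousV => //; rewrite gt_eqF.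
apply/continuous_rballP => e e0; have e2 : 0 < e / 2 by rewrite divr_gt0.
have [d1 d10 h1] := (continuous_realP _ _).1 cl _ e2.
have [d2 d20 h2] := (continuous_realP _ _).1 ca _ e2.
exists (Num.min d1 d2); first by rewrite lt_min d10.
move=> w; rewrite lt_min => /andP[w1 w2].
apply: (le_lt_trans (rnorm_le_ReIm _)); rewrite !raddfB /=.
by have := h1 _ w1; have := h2 _ w2 => /=; lra.
Qed.

(** The inverse function argument: with k the increment of the logarithm, h / z = exp k - 1, which is k
   up to a small multiple of k. *)
Lemma differentiable_clog z : 0 < complex.Re z -> differentiable clog z.
Proof.
move=> z0; have z1 : z != 0 by apply: contraTneq z0 => ->; rewrite ltxx.
have rz := rnorm_gt0 z1.
apply: (@cfrechet_diff _ _ (z^-1)) => e e0.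
pose e' := Num.min (2^-1) (e * rnorm z / 2).
have e'0 : 0 < e' by rewrite lt_min invr_gt0 ltr0n !divr_gt0 // mulr_gt0.
have [d d0 hd] := frechet_cexp0 e'0.
have [d1 d10 h1] := (continuous_rballP _ _).1 (continuous_clog z0) _ d0.
exists (Num.min d1 (complex.Re z)); first by rewrite lt_min d10.
move=> h; rewrite lt_min => /andP[hd1 hz].
have zh : 0 < complex.Re (z + h).
  rewrite raddfD /=; have := le_lt_trans (Re_le_rnorm h) hz.
  by rewrite ltr_norml => /andP[? ?]; lra.
pose k := clog (z + h) - clog z.
have kd : rnorm k < d by apply: h1; rewrite addrC addKr.
have eh : h / z = cexp k - 1.
  have : cexp (clog z + k) = z + h by rewrite /k subrKC cexp_clog.
  by rewrite cexpD cexp_clog // => e1; apply: (mulfI z1); rewrite mulrBr e1; field.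
have := hd k kd; rewrite add0r cexp0 -eh -/k => hk.
have -> : k - z^-1 * h = - (h / z - k) by ring.
rewrite rnormN; apply: (le_trans hk).
have k2 : rnorm k <= 2 * rnorm h / rnorm z.
  have e2 : e' <= 2^-1 by rewrite /e' ge_min lexx.
  have : rnorm k <= rnorm (h / z - k) + rnorm (h / z).
    by rewrite (rnormB (h / z) k); exact: rnorm_leB.
  rewrite rnormM rnormV => h3.
  have h4 : e' * rnorm k <= 2^-1 * rnorm k by rewrite ler_wpM2r ?rnorm_ge0.
  by rewrite -mulrA; lra.
have e3 : e' <= e * rnorm z / 2 by rewrite /e' ge_min lexx orbT.
apply: (@le_trans _ _ (e * rnorm z / 2 * (2 * rnorm h / rnorm z))).
  by rewrite ler_pM ?rnorm_ge0 ?(ltW e'0).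
rewrite le_eqVlt; apply/orP; left; apply/eqP; field; by rewrite gt_eqF.
Qed.

End ComplexExpLog.

(** * Functions holomorphic in one variable and antiholomorphic in the other *)

Section Sesquiholomorphic.
Variables (R : realType) (m : nat).
Local Notation C := R[i].
Local Notation V := 'rV[C]_m.
Implicit Types (F : V -> V -> C) (a z w h k : V) (rho M : R).

Lemma conjB (x y : C) : Num.conj (x - y) = Num.conj x - Num.conj y.
Proof. exact: rmorphB. Qed.

Lemma conj_prod (x y : C) : Num.conj (x * y) = Num.conj x * Num.conj y.
Proof. exact: rmorphM. Qed.

Lemma conj_sum (I : Type) (r : seq I) (P : pred I) (F : I -> C) :
  Num.conj (\sum_(i <- r | P i) F i) = \sum_(i <- r | P i) Num.conj (F i).
Proof. exact: rmorph_sum. Qed.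

Lemma rnorm_coord h i : rnorm (h 0 i) <= rnorm h.
Proof.
rewrite -lecR -!rnormE [leRHS]mx_normE.
exact: (@le_bigmax _ _ _ _ (fun i : 'I_1 * 'I_m => `|h i.1 i.2|%:nng) (0, i)).
Qed.

(** Antiholomorphy in w is expressed by conjugating the value, so that no conjugate ball is needed;
   the bound M is part of the notion as for [bhol]. *)
Definition sesq F a rho M := forall z w, rball a rho z -> rball a rho w ->
  [/\ differentiable (fun z => F z w) z, differentiable (fun w => Num.conj (F z w)) w
    & rnorm (F z w) <= M].

Definition star F z w : C := Num.conj (F w z).

Lemma sesq_star F a rho M : sesq F a rho M -> sesq (star F) a rho M.
Proof.
move=> hF z w za wa; have [h1 h2 h3] := hF w z wa za; split; [exact: h2| |by rewrite /star rnorm_conj].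
have -> : (fun w => Num.conj (star F z w)) = (fun w => F w z); last exact: h1.
by apply/funext => y; rewrite /star conjCK.
Qed.

Lemma sesq_sub F a rho M b r : sesq F a rho M -> rball b r `<=` rball a rho -> sesq F b r M.
Proof. by move=> hF sub z w /sub za /sub wa; exact: hF. Qed.

Lemma sesq_diffl F a rho M z w : sesq F a rho M -> rball a rho z -> rball a rho w ->
  differentiable (fun z => F z w) z.
Proof. by move=> hF za wa; case: (hF z w za wa) => h _ _; exact: h. Qed.

Lemma sesq_diffr F a rho M z w : sesq F a rho M -> rball a rho z -> rball a rho w ->
  differentiable (fun w => Num.conj (F z w)) w.
Proof. by move=> hF za wa; case: (hF z w za wa) => _ h _; exact: h. Qed.

Lemma sesq_bound F a rho M z w : sesq F a rho M -> rball a rho z -> rball a rho w ->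
  rnorm (F z w) <= M.
Proof. by move=> hF za wa; case: (hF z w za wa) => _ _ h; exact: h. Qed.

Lemma sesq_bhol F a rho M w : sesq F a rho M -> rball a rho w -> bhol (fun z => F z w) a rho M.
Proof. move=> hF wa z za; split; [exact: (sesq_diffl hF za wa)|exact: (sesq_bound hF za wa)]. Qed.

Lemma sesq_bhol_conj F a rho M z : sesq F a rho M -> rball a rho z ->
  bhol (fun w => Num.conj (F z w)) a rho M.
Proof.
move=> hF za w wa; split; first exact: (sesq_diffr hF za wa).
by rewrite rnorm_conj; exact: (sesq_bound hF za wa).
Qed.

(** Holomorphic derivative in the first variable; [dw] is the derivative with respect to the
   conjugate of the second one. *)
Definition dz (i : 'I_m) F z w : C := 'd (fun z => F z w) z (delta_mx 0 i).
Definition dw (j : 'I_m) F := star (dz j (star F)).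

Lemma diff_sum_coord (f : V -> C) z h : 'd f z h = \sum_i h 0 i * 'd f z (delta_mx 0 i).
Proof.
rewrite {1}[h]row_sum_delta linear_sum; apply: eq_bigr => i _; exact: diff_scale.
Qed.

(** The difference in z is antiholomorphic in w with a bound proportional to |h|, so its difference in
   w gains a factor |k|. *)
Lemma sesq_mixed F a rho M z w h k : 0 < rho -> sesq F a rho M ->
  rball a (rho / 2) z -> rball a (rho / 2) w -> rnorm h < rho / 2 -> rnorm k < rho / 2 ->
  rnorm (F (z + h) (w + k) - F (z + h) w - (F z (w + k) - F z w)) <=
  16 * M / rho ^+ 2 * rnorm h * rnorm k.
Proof.
move=> r0 hF za wa h2 k2.
have za' : rball a rho z by apply: rball_le za; lra.
have zh : rball a rho (z + h) by apply: rball_le (rball_addr za (ltW h2)); lra.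
have hu : bhol (fun y => Num.conj (F (z + h) y - F z y)) a rho (4 * M / rho * rnorm h).
  move=> y ya; split.
    rewrite (_ : (fun _ => _) = (fun y => Num.conj (F (z + h) y) - Num.conj (F z y))).
      exact: differentiableB (sesq_diffr hF zh ya) (sesq_diffr hF za' ya).
    by apply/funext => y'; rewrite conjB.
  rewrite rnorm_conj; exact: (bhol_lipschitz r0 (sesq_bhol hF ya)).
have := bhol_lipschitz r0 hu wa k2; rewrite -conjB rnorm_conj.
have -> : F (z + h) (w + k) - F z (w + k) - (F (z + h) w - F z w) =
  F (z + h) (w + k) - F (z + h) w - (F z (w + k) - F z w) by ring.
move=> /le_trans; apply; rewrite le_eqVlt; apply/orP; left; apply/eqP.
by field; rewrite gt_eqF.
Qed.

(** Separate holomorphy suffices for a joint expansion: the mixed difference, bounded by |h| |k|, is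
   of second order. *)
Lemma sesq_joint_taylor F a rho M : 0 < rho -> sesq F a rho M ->
  exists2 K : R, 0 <= K & forall z w h k,
  rball a (rho / 4) z -> rball a (rho / 4) w -> rnorm h < rho / 4 -> rnorm k < rho / 4 ->
  rnorm (F (z + h) (w + k) - F z w - ('d (fun z => F z w) z h +
     Num.conj ('d (fun w => Num.conj (F z w)) w k))) <= K * (rnorm h + rnorm k) ^+ 2.
Proof.
move=> r0 hF; have M0 := bhol_ge0 r0 (sesq_bhol hF (rball_center _ r0)).
have r2 : 0 < rho ^+ 2 by rewrite exprn_gt0.
exists (32 * M / rho ^+ 2); first by rewrite divr_ge0 ?mulr_ge0 // ltW.
move=> z w h k za wa h4 k4.
have za2 : rball a (rho / 2) z by apply: rball_le za; lra.
have wa2 : rball a (rho / 2) w by apply: rball_le wa; lra.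
have za1 : rball a rho z by apply: rball_le za; lra.
have wa1 : rball a rho w by apply: rball_le wa; lra.
have h1 := bhol_taylor r0 (sesq_bhol hF wa1) za h4.
have h2 := bhol_taylor r0 (sesq_bhol_conj hF za1) wa k4.
have h3 : rnorm (F (z + h) (w + k) - F (z + h) w - (F z (w + k) - F z w)) <=
  16 * M / rho ^+ 2 * rnorm h * rnorm k.
  have h2' : rnorm h < rho / 2 by lra.
  have k2' : rnorm k < rho / 2 by lra.
  exact: (sesq_mixed r0 hF za2 wa2 h2' k2').
suff alg (A B : C) : rnorm (F (z + h) w - F z w - A) <= 32 * M / rho ^+ 2 * rnorm h ^+ 2 ->
    rnorm (Num.conj (F z (w + k)) - Num.conj (F z w) - B) <= 32 * M / rho ^+ 2 * rnorm k ^+ 2 ->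
    rnorm (F (z + h) (w + k) - F z w - (A + Num.conj B)) <=
    32 * M / rho ^+ 2 * (rnorm h + rnorm k) ^+ 2 by exact: (alg _ _ h1 h2).
move=> {}h1 {}h2.
have {}h2 : rnorm (F z (w + k) - F z w - Num.conj B) <= 32 * M / rho ^+ 2 * rnorm k ^+ 2.
  by move: h2; rewrite -conjB -[X in rnorm (_ - X)]conjCK -conjB rnorm_conj.
have -> : F (z + h) (w + k) - F z w - (A + Num.conj B) =
  (F (z + h) (w + k) - F (z + h) w - (F z (w + k) - F z w)) +
  ((F (z + h) w - F z w - A) + (F z (w + k) - F z w - Num.conj B)) by ring.
apply: (le_trans (rnormCD _ _)); apply: (le_trans (lerD h3 (le_trans (rnormCD _ _) (lerD h1 h2)))).
have -> : 16 * M / rho ^+ 2 = 32 * M / rho ^+ 2 / 2 by field; rewrite gt_eqF.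
have : 0 <= 32 * M / rho ^+ 2 by rewrite divr_ge0 ?mulr_ge0 // ltW.
move: (32 * M / rho ^+ 2) (rnorm h) (rnorm k) (rnorm_ge0 h) (rnorm_ge0 k) => K x y x0 y0 K0.
have : 0 <= K * x * y by rewrite !mulr_ge0.
have -> : K * (x + y) ^+ 2 = K * x ^+ 2 + K * y ^+ 2 + 2 * (K * x * y) by ring.
by lra.
Qed.

(** Difference quotients in z are holomorphic in z and antiholomorphic in w, and so is their
   limit. *)
Lemma sesq_dz F a rho M i : 0 < rho -> sesq F a rho M ->
  sesq (dz i F) a (rho / 8) (4 * M / rho * rnorm (delta_mx 0 i : V)).
Proof.
move=> r0 hF; set e := delta_mx 0 i : V; set M' := 4 * M / rho * rnorm e.
have r2 : 0 < rho / 2 by rewrite divr_gt0.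
have [N hN] : exists N, rnorm e / N.+1%:R < rho / 2.
  exists (Num.trunc (rnorm e / (rho / 2))); rewrite ltr_pdivrMr // mulrC -ltr_pdivrMr //.
  exact: truncnS_gt.
pose c n : C := (n + N).+1%:R.
have c0 n : c n != 0 by rewrite pnatr_eq0.
have rc n : rnorm (c n) = (n + N).+1%:R.
  by rewrite /c -(rmorph_nat (real_complex R)) rnorm_real ger0_norm.
have rcn n : rnorm (c n) != 0 by rewrite rc pnatr_eq0.
have ce n : rnorm ((c n)^-1 *: e) < rho / 2.
  rewrite rnormZ rnormV rc mulrC; apply: le_lt_trans hN.
  by rewrite ler_wpM2l ?rnorm_ge0 // lef_pV2 ?posrE // ler_nat ltnS leq_addl.
pose q n z w := c n * (F (z + (c n)^-1 *: e) w - F z w).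
have hq n : sesq (q n) a (rho / 2) M'.
  move=> z w za wa.
  have za1 : rball a rho z by apply: rball_le za; lra.
  have wa1 : rball a rho w by apply: rball_le wa; lra.
  have zh : rball a rho (z + (c n)^-1 *: e).
    by apply: rball_le (rball_addr za (ltW (ce n))); lra.
  have [h1 h2] := bhol_shiftB r0 (sesq_bhol hF wa1) (ce n) za.
  split.
  - exact: differentiableM (differentiable_cst _ _) h1.
  - rewrite (_ : (fun _ => _) = (fun w => Num.conj (c n) *
       (Num.conj (F (z + (c n)^-1 *: e) w) - Num.conj (F z w)))).
      apply: differentiableM; first exact: differentiable_cst.
      exact: differentiableB (sesq_diffr hF zh wa1) (sesq_diffr hF za1 wa1).
    by apply/funext => y; rewrite /q conj_prod conjB.
  - rewrite /q rnormM; apply: (@le_trans _ _ (rnorm (c n) * (4 * M / rho * rnorm ((c n)^-1 *: e)))).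
      by rewrite ler_wpM2l ?rnorm_ge0.
    rewrite rnormZ rnormV /M' le_eqVlt; apply/orP; left; apply/eqP.
    by field; rewrite ?rcn ?gt_eqF.
have lim z w : rball a (rho / 2) z -> rball a (rho / 2) w -> cvgc (fun n => q n z w) (dz i F z w).
  move=> za wa.
  have za1 : rball a rho z by apply: rball_le za; lra.
  have wa1 : rball a rho w by apply: rball_le wa; lra.
  have hf := diff_frechet (sesq_diffl hF za1 wa1).
  move=> eps eps0; have e1 : 0 < rnorm e + 1 by rewrite ltr_wpDl // rnorm_ge0.
  have [d d0 hd] := hf _ (divr_gt0 eps0 e1).
  pose N1 := Num.trunc ((rnorm e + 1) / d); exists N1 => n nN.
  have cd : rnorm ((c n)^-1 *: e) < d.
    rewrite rnormZ rnormV rc mulrC ltr_pdivrMr // mulrC -ltr_pdivrMr //.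
    apply: (@lt_le_trans _ _ (N1.+1%:R)); last by rewrite ler_nat ltnS; apply: leq_trans nN (leq_addr _ _).
    by apply: le_lt_trans (truncnS_gt _); rewrite ler_pM2r ?invr_gt0 // lerDl.
  have {hd} := hd _ cd; rewrite diff_scale -/(dz i F z w) => hd.
  have -> : q n z w - dz i F z w =
     c n * (F (z + (c n)^-1 *: e) w - F z w - (c n)^-1 * dz i F z w) by rewrite /q; field.
  rewrite rnormM; apply: (@le_trans _ _ (rnorm (c n) * (eps / (rnorm e + 1) * rnorm ((c n)^-1 *: e)))).
    by rewrite ler_wpM2l ?rnorm_ge0.
  rewrite rnormZ rnormV.
  have -> : rnorm (c n) * (eps / (rnorm e + 1) * ((rnorm (c n))^-1 * rnorm e)) = eps * (rnorm e / (rnorm e + 1)).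
    by field; rewrite ?rcn ?gt_eqF.
  by rewrite ler_piMr ?(ltW eps0) // ler_pdivrMr // mul1r lerDl.
have e8 : rho / 8 = rho / 2 / 4 by field.
move=> z w za wa.
have za2 : rball a (rho / 2) z by apply: rball_le za; lra.
have wa2 : rball a (rho / 2) w by apply: rball_le wa; lra.
rewrite e8 in za wa.
have b1 : bhol (fun z => dz i F z w) a (rho / 2 / 4) M'.
  apply: (@bhol_limit _ _ _ _ _ (fun n z => q n z w)); [exact: r2| |].
    by move=> n; exact: sesq_bhol (hq n) wa2.
  by move=> y ya; exact: lim.
have b2 : bhol (fun w => Num.conj (dz i F z w)) a (rho / 2 / 4) M'.
  apply: (@bhol_limit _ _ _ _ _ (fun n w => Num.conj (q n z w))); [exact: r2| |].
    by move=> n; exact: sesq_bhol_conj (hq n) za2.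
  move=> y ya eps eps0; have [N2 hN2] := lim z y za2 ya eps eps0.
  by exists N2 => n /hN2; rewrite -conjB rnorm_conj.
have [h1 h2] := b1 z za; have [h3 _] := b2 w wa.
split; [exact: h1|exact: h3|exact: h2].
Qed.

Lemma sesq_dw F a rho M j : 0 < rho -> sesq F a rho M ->
  sesq (dw j F) a (rho / 8) (4 * M / rho * rnorm (delta_mx 0 j : V)).
Proof. by move=> r0 hF; apply/sesq_star/sesq_dz => //; exact: sesq_star. Qed.

Definition second_difference F z h w k :=
  F (z + h) (w + k) - F (z + h) w - F z (w + k) + F z w.

Let sum_split (F1 F2 F3 F4 : C) (x y A B : 'I_m -> C) (D : 'I_m -> 'I_m -> C) :
  F1 - F2 - F3 + F4 - \sum_i \sum_j x i * y j * D i j =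
  F1 - F2 - \sum_j y j * A j - (F3 - F4 - \sum_j y j * B j) +
  \sum_j y j * (A j - B j - \sum_i x i * D i j).
Proof.
have -> : \sum_j y j * (A j - B j - \sum_i x i * D i j) =
    \sum_j y j * A j - \sum_j y j * B j - \sum_i \sum_j x i * y j * D i j.
  rewrite exchange_big /= -!sumrB; apply: eq_bigr => j _; rewrite !mulrBr; congr (_ - _).
  by rewrite mulr_sumr; apply: eq_bigr => i _; ring.
ring.
Qed.

(** An error of third order survives division by the square of the step and summation over the N^2
   cells of a grid of step 1 / N. It is obtained by expanding in w first: the remainder r of this
   expansion is holomorphic in z with a bound of order |k|^2, so that its increment along h gains the
   factor |h|. *)
Lemma second_difference_hessian F a rho M : 0 < rho -> sesq F a rho M ->
  exists2 K : R, 0 <= K & forall z w h k,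
  rball a (rho / 32) z -> rball a (rho / 32) w -> rnorm h < rho / 32 -> rnorm k < rho / 32 ->
  rnorm (second_difference F z h w k -
    \sum_i \sum_j h 0 i * Num.conj (k 0 j) * dz i (dw j F) z w) <=
  K * rnorm h * rnorm k * (rnorm h + rnorm k).
Proof.
move=> r0 hF; have M0 := bhol_ge0 r0 (sesq_bhol hF (rball_center _ r0)).
have r8 : 0 < rho / 8 by rewrite divr_gt0.
pose C1 := 32 * M / rho ^+ 2.
have C10 : 0 <= C1 by apply: divr_ge0; [exact: mulr_ge0|exact: exprn_ge0 (ltW r0)].
pose Mj (j : 'I_m) := 4 * M / rho * rnorm (delta_mx 0 j : V).
pose C2 j := 32 * Mj j / (rho / 8) ^+ 2.
have C20 j : 0 <= C2 j.
  apply: divr_ge0; last exact: exprn_ge0 (ltW r8).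
  apply: mulr_ge0 => //; apply: mulr_ge0 (rnorm_ge0 _).
  by apply: divr_ge0; [exact: mulr_ge0|exact: ltW].
pose K1 := 4 * C1 / (rho / 8); have K10 : 0 <= K1.
  by apply: divr_ge0; [exact: mulr_ge0|exact: ltW].
have K20 : 0 <= \sum_j C2 j by apply: sumr_ge0.
exists (K1 + \sum_j C2 j); first exact: addr_ge0.
move=> z w h k za wa h32 k32.
pose r y := F y (w + k) - F y w - \sum_j Num.conj (k 0 j) * dw j F y w.
have wa4 : rball a (rho / 4) w by apply: rball_le wa; lra.
have wa1 : rball a rho w by apply: rball_le wa; lra.
have wa8 : rball a (rho / 8) w by apply: rball_le wa; lra.
have wk1 : rball a rho (w + k) by apply: rball_le (rball_addr wa (ltW k32)); lra.
have hr : bhol r a (rho / 8) (C1 * rnorm k ^+ 2).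
  move=> y ya; have ya1 : rball a rho y by apply: rball_le ya; lra.
  split.
    apply: differentiableB.
      exact: differentiableB (sesq_diffl hF ya1 wk1) (sesq_diffl hF ya1 wa1).
    rewrite (_ : (fun _ => _) = \sum_j (fun y => Num.conj (k 0 j) * dw j F y w)).
      apply: differentiable_sum => j; apply: differentiableM; first exact: differentiable_cst.
      exact: (sesq_diffl (sesq_dw j r0 hF) ya wa8).
    by apply/funext => x; rewrite fct_sumE.
  have k4 : rnorm k < rho / 4 by lra.
  have := bhol_taylor r0 (sesq_bhol_conj hF ya1) wa4 k4.
  rewrite -/C1 diff_sum_coord => /(le_trans _); apply.
  rewrite -[leRHS]rnorm_conj !conjB !conjCK conj_sum le_eqVlt; apply/orP; left; apply/eqP.
  congr rnorm; rewrite /r; congr (_ - _); apply: eq_bigr => j _.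
  by rewrite conj_prod.
have e2 : rho / 8 / 2 = rho / 16 by field.
have za16 : rball a (rho / 8 / 2) z by apply: rball_le za; lra.
have h16 : rnorm h < rho / 8 / 2 by lra.
have hr' := bhol_lipschitz r8 hr za16 h16.
have za32 : rball a (rho / 8 / 4) z by apply: rball_le za; lra.
have h32' : rnorm h < rho / 8 / 4 by lra.
have tj j : rnorm (dw j F (z + h) w - dw j F z w - \sum_i h 0 i * dz i (dw j F) z w) <= C2 j * rnorm h ^+ 2.
  rewrite -diff_sum_coord.
  exact: (bhol_taylor r8 (sesq_bhol (sesq_dw j r0 hF) wa8) za32 h32').
have -> : second_difference F z h w k - \sum_i \sum_j h 0 i * Num.conj (k 0 j) * dz i (dw j F) z w =
  (r (z + h) - r z) + \sum_j Num.conj (k 0 j) *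
     (dw j F (z + h) w - dw j F z w - \sum_i h 0 i * dz i (dw j F) z w).
  exact: (sum_split (F (z + h) (w + k)) (F (z + h) w) (F z (w + k)) (F z w)).
apply: (le_trans (rnormCD _ _)).
have x0 := rnorm_ge0 h; have y0 := rnorm_ge0 k.
have s1 : rnorm (r (z + h) - r z) <= K1 * rnorm h * rnorm k * rnorm k.
  apply: (le_trans hr'); rewrite le_eqVlt; apply/orP; left; apply/eqP.
  by rewrite /K1; field; rewrite gt_eqF.
have s2 : rnorm (\sum_j Num.conj (k 0 j) *
    (dw j F (z + h) w - dw j F z w - \sum_i h 0 i * dz i (dw j F) z w)) <=
    (\sum_j C2 j) * rnorm h * rnorm k * rnorm h.
  apply: (le_trans (rnorm_sum _ _ _)).
  rewrite !mulr_suml; apply: ler_sum => j _; rewrite rnormM rnorm_conj.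
  apply: (@le_trans _ _ (rnorm k * (C2 j * rnorm h ^+ 2))).
    by rewrite ler_pM ?rnorm_ge0 // rnorm_coord.
  by rewrite le_eqVlt; apply/orP; left; apply/eqP; ring.
apply: (le_trans (lerD s1 s2)).
move: (K1) K10 (\sum_j C2 j) K20 (rnorm h) x0 (rnorm k) y0 => p p0 q q0 x x0 y y0.
have : 0 <= p * x * y * x by rewrite !mulr_ge0.
have : 0 <= q * x * y * y by rewrite !mulr_ge0.
by rewrite mulrDr; lra.
Qed.

End Sesquiholomorphic.

(** * Restriction to the diagonal: Wirtinger derivatives and uniqueness of polarizations *)

Section DiagonalRestriction.
Variables (R : realType) (m : nat).
Local Notation C := R[i].
Local Notation V := 'rV[C]_m.
Implicit Types (F : V -> V -> C) (a z w h k v : V) (rho M : R).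

Lemma derive1_quadratic (g : R -> R) (c K d : R) : 0 < d ->
  (forall t, `|t| < d -> `|g t - g 0 - t * c| <= K * t ^+ 2) -> derive1 g 0 = c.
Proof.
move=> d0 h; apply: cvg_lim => //; apply/cvgrPdist_le => e e0.
have K0 : 0 < `|K| + 1 by rewrite ltr_wpDl.
exists (Num.min d (e / (`|K| + 1))) => /=; first by rewrite lt_min d0 divr_gt0.
move=> t; rewrite /= sub0r normrN lt_min => /andP[td]; rewrite ltr_pdivlMr // => te t0.
rewrite addr0 /GRing.scale /=.
have -> : c - t^-1 * (g t - g 0) = - (t^-1 * (g t - g 0 - t * c)) by field.
have tp : 0 < `|t| by rewrite normr_gt0.
rewrite normrN normrM normfV mulrC ler_pdivrMr //.
apply: (le_trans (h _ td)); rewrite -real_normK ?num_real // expr2 mulrA ler_wpM2r //.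
apply: le_trans (ltW te); rewrite mulrC ler_wpM2l //.
by apply: le_trans (ler_norm _) _; rewrite lerDl.
Qed.

(** The chain rule along the diagonal w |-> (w, w). *)
Lemma real_dderive_diagonal F a rho M (f : V -> C) w v : 0 < rho -> sesq F a rho M ->
  (forall x, rball a rho x -> f x = F x x) -> rball a (rho / 4) w ->
  real_dderive f v w =
  'd (fun z => F z w) w v + Num.conj ('d (fun y => Num.conj (F w y)) w v).
Proof.
move=> r0 hF fF wa; have [K K0 hK] := sesq_joint_taylor r0 hF.
have hv (t : C) : 'd (fun z => F z w) w (t *: v) = t * 'd (fun z => F z w) w v := diff_scale _ _ _ _.
have hv' (t : C) : 'd (fun y => Num.conj (F w y)) w (t *: v) = t * 'd (fun y => Num.conj (F w y)) w v
  := diff_scale _ _ _ _.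
have wa1 : rball a rho w by apply: rball_le wa; lra.
(* Of the differentials only homogeneity in the direction matters. *)
suff alg (A B : V -> C) : (forall t : C, A (t *: v) = t * A v) -> (forall t : C, B (t *: v) = t * B v) ->
    (forall h k, rnorm h < rho / 4 -> rnorm k < rho / 4 ->
       rnorm (F (w + h) (w + k) - F w w - (A h + Num.conj (B k))) <= K * (rnorm h + rnorm k) ^+ 2) ->
    real_dderive f v w = A v + Num.conj (B v).
  apply: (alg (fun v => 'd (fun z => F z w) w v) (fun v => 'd (fun y => Num.conj (F w y)) w v)).
  - exact: hv.
  - exact: hv'.
  - by move=> h k h4 k4; exact: hK.
move=> Av Bv {hv hv'} {}hK; set c := A v + Num.conj (B v).
have v1 : 0 < rnorm v + 1 by rewrite ltr_wpDl // rnorm_ge0.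
pose d := rho / 4 / (rnorm v + 1); have d0 : 0 < d by rewrite !divr_gt0.
have est (t : R) : `|t| < d ->
    rnorm (f (w + t%:C *: v) - f (w + 0%:C *: v) - t%:C * c) <= 4 * K * rnorm v ^+ 2 * t ^+ 2.
  move=> td; have tv : rnorm (t%:C *: v) < rho / 4.
    rewrite rnormZ rnorm_real; move: td; rewrite /d ltr_pdivlMr // => td.
    by apply: le_lt_trans td; rewrite ler_wpM2l // lerDl.
  have wt : rball a rho (w + t%:C *: v) by apply: rball_le (rball_addr wa (ltW tv)); lra.
  have := hK _ _ tv tv; rewrite Av Bv conj_prod scale0r addr0 !fF //.
  have -> : Num.conj t%:C = t%:C :> C by exact: conjc_real.
  rewrite -mulrDr -/c rnormZ rnorm_real => /le_trans; apply.
  rewrite -[in leRHS](@real_normK _ t) ?num_real // le_eqVlt; apply/orP; left; apply/eqP; ring.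
have ReC (t : R) (x : C) : complex.Re (t%:C * x) = t * complex.Re x.
  by case: x => ? ? /=; ring.
have ImC (t : R) (x : C) : complex.Im (t%:C * x) = t * complex.Im x.
  by case: x => ? ? /=; ring.
rewrite /real_dderive; apply/eqP; rewrite eq_complex /=; apply/andP; split; apply/eqP;
  apply: (@derive1_quadratic _ _ (4 * K * rnorm v ^+ 2) d) => // t /est; apply: le_trans.
  by apply: le_trans (Re_le_rnorm _); rewrite [complex.Re (_ - _ - _)]raddfB raddfB /= ReC.
by apply: le_trans (Im_le_rnorm _); rewrite [complex.Im (_ - _ - _)]raddfB raddfB /= ImC.
Qed.

Let half (x y : C) : (x + y - 'i%C * ('i%C * x - 'i%C * y)) / 2 = x.
Proof.
rewrite mulrBr !mulrA -expr2 sqr_i; have -> : x + y - (-1 * x - -1 * y) = x * 2 by ring.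
by rewrite mulfK // pnatr_eq0.
Qed.

Let half' (x y : C) : (x + y + 'i%C * ('i%C * x - 'i%C * y)) / 2 = y.
Proof.
rewrite mulrBr !mulrA -expr2 sqr_i; have -> : x + y + (-1 * x - -1 * y) = y * 2 by ring.
by rewrite mulfK // pnatr_eq0.
Qed.

Let conj_i (x : C) : Num.conj ('i%C * x) = - ('i%C * Num.conj x).
Proof.
by case: x => x1 x2; apply/eqP; rewrite eq_complex /=; apply/andP; split; apply/eqP; ring.
Qed.

Lemma real_dderive_diagonal_i F a rho M (f : V -> C) w v : 0 < rho -> sesq F a rho M ->
  (forall x, rball a rho x -> f x = F x x) -> rball a (rho / 4) w ->
  real_dderive f ('i%C *: v) w =
  'i%C * 'd (fun z => F z w) w v - 'i%C * Num.conj ('d (fun y => Num.conj (F w y)) w v).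
Proof.
move=> r0 hF fF wa; rewrite (real_dderive_diagonal _ r0 hF fF wa).
have comb (x y x' y' : C) : x' = 'i%C * x -> y' = 'i%C * y ->
    x' + Num.conj y' = 'i%C * x - 'i%C * Num.conj y by move=> -> ->; rewrite conj_i.
exact: (comb _ _ _ _ (diff_scale (fun z => F z w) w 'i%C v)
  (diff_scale (fun y => Num.conj (F w y)) w 'i%C v)).
Qed.

Lemma wirtinger_diagonal F a rho M (f : V -> C) w i : 0 < rho -> sesq F a rho M ->
  (forall x, rball a rho x -> f x = F x x) -> rball a (rho / 4) w ->
  wirtinger i f w = dz i F w w.
Proof.
move=> r0 hF fF wa; rewrite /wirtinger (real_dderive_diagonal _ r0 hF fF wa).
rewrite (real_dderive_diagonal_i _ r0 hF fF wa); exact: half.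
Qed.

Lemma wirtinger_bar_diagonal F a rho M (f : V -> C) w i : 0 < rho -> sesq F a rho M ->
  (forall x, rball a rho x -> f x = F x x) -> rball a (rho / 4) w ->
  wirtinger_bar i f w = dw i F w w.
Proof.
move=> r0 hF fF wa; rewrite /wirtinger_bar (real_dderive_diagonal _ r0 hF fF wa).
rewrite (real_dderive_diagonal_i _ r0 hF fF wa); exact: half'.
Qed.

Lemma wirtinger_hessian F a rho M (f : V -> C) w i j : 0 < rho -> sesq F a rho M ->
  (forall x, rball a rho x -> f x = F x x) -> rball a (rho / 32) w ->
  wirtinger i (wirtinger_bar j f) w = dz i (dw j F) w w.
Proof.
move=> r0 hF fF wa; have r8 : 0 < rho / 8 by rewrite divr_gt0.
apply: (wirtinger_diagonal _ r8 (sesq_dw j r0 hF)).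
  move=> x xa; apply: (wirtinger_bar_diagonal _ r0 hF fF).
  by apply: rball_le xa; lra.
by apply: rball_le wa; lra.
Qed.

Let pow_iota (x : R) N : x ^+ N = \prod_(j <- iota 0 N) x.
Proof. by rewrite big_const_seq count_predT size_iota; elim: N => //= N <-; rewrite exprS. Qed.

(** On the complex line t |-> (a + x + t y, a + x + conj t y) the function is holomorphic and vanishes
   for real t, and the point (z, w) is reached at t = i. Arbitrarily many real zeros of modulus at most
   1/4 force the value at i to vanish. *)
Lemma sesq_uniqueness F a rho M z w : 0 < rho -> sesq F a rho M ->
  (forall x, rball a rho x -> F x x = 0) ->
  rball a (rho / 16) z -> rball a (rho / 16) w -> F z w = 0.
Proof.
move=> r0 hF F0 za wa; have [K K0 hK] := sesq_joint_taylor r0 hF.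
have M0 := bhol_ge0 r0 (sesq_bhol hF (rball_center _ r0)).
have [x [y [xn yn zE wE]]] : exists x y : V, [/\ rnorm x < rho / 16, rnorm y < rho / 16,
    a + x + 'i%C *: y = z & a + x - 'i%C *: y = w].
  pose x := (2^-1 : C) *: (z - a + (w - a)).
  pose y := (- 'i%C / 2 : C) *: (z - w).
  have r2 : rnorm (2^-1 : C) = 2^-1.
    by rewrite rnormV -(rmorph_nat (real_complex R)) rnorm_real ger0_norm.
  have xn : rnorm x < rho / 16.
    rewrite rnormZ r2; have := rnormD (z - a) (w - a); move: za wa; rewrite /rball /=; lra.
  have yn : rnorm y < rho / 16.
    rewrite rnormZ rnormM rnormN rnorm_i r2.
    have := rnormD (z - a) (a - w); rewrite (rnormB a w) addrA subrK.
    by move: za wa; rewrite /rball /=; lra.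
  have i2 : 'i%C * (- 'i%C / 2) = 2^-1 :> C by rewrite mulrA mulrN -expr2 sqr_i opprK mul1r.
  exists x, y; split => //; rewrite /x /y scalerA i2; apply/rowP => k; rewrite !mxE; by field.
pose Z (t : C) := a + x + t *: y.
have Zin (t : C) : rnorm t <= 2 -> rball a (rho / 4) (Z t).
  move=> t2; suff : rnorm (Z t - a) < rho / 4 by [].
  rewrite /Z -[a + x + _]addrA [a + _]addrC addrK.
  apply: (le_lt_trans (rnormD _ _)); rewrite rnormZ.
  have ty : rnorm t * rnorm y <= 2 * rnorm y by rewrite ler_wpM2r ?rnorm_ge0.
  apply: (le_lt_trans (lerD (ltW xn) (le_trans ty (ler_wpM2l _ (ltW yn))))) => //.
  by lra.
have Zin1 (t : C) : rnorm t <= 2 -> rball a rho (Z t).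
  by move=> /Zin; apply: rball_le; lra.
pose f (t : C) := F (Z t) (Z (Num.conj t)).
have df (t : C) : rnorm t <= 2 -> differentiable f t.
  move=> t2; have t2' : rnorm (Num.conj t) <= 2 by rewrite rnorm_conj.
  have {}hK := hK _ _ _ _ (Zin _ t2) (Zin _ t2').
  have hA (s : C) := diff_scale (fun z => F z (Z (Num.conj t))) (Z t) s y.
  have hB (s : C) := diff_scale (fun w => Num.conj (F (Z t) w)) (Z (Num.conj t)) s y.
  suff alg (A B : V -> C) : (forall t : C, A (t *: y) = t * A y) ->
      (forall t : C, B (t *: y) = t * B y) ->
      (forall h k, rnorm h < rho / 4 -> rnorm k < rho / 4 ->
       rnorm (F (Z t + h) (Z (Num.conj t) + k) - F (Z t) (Z (Num.conj t)) - (A h + Num.conj (B k)))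
         <= K * (rnorm h + rnorm k) ^+ 2) -> differentiable f t.
    apply: (alg _ _ hA hB) => h k h4 k4; exact: hK.
  move=> {}hA {}hB {}hK; apply: (@cfrechet_diff _ _ _ (A y + Num.conj (B y))) => e e0.
  have y1 : 0 < rnorm y + 1 by rewrite ltr_wpDl // rnorm_ge0.
  have K1 : 0 < 4 * K * rnorm y ^+ 2 + 1.
    by rewrite ltr_wpDl // mulr_ge0 ?exprn_ge0 ?rnorm_ge0 // mulr_ge0.
  exists (Num.min (rho / 4 / (rnorm y + 1)) (e / (4 * K * rnorm y ^+ 2 + 1))).
    by rewrite lt_min !divr_gt0.
  move=> s; rewrite lt_min => /andP[]; rewrite ltr_pdivlMr // => s1; rewrite ltr_pdivlMr // => s2.
  have sy : rnorm (s *: y) < rho / 4.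
    by rewrite rnormZ; apply: le_lt_trans s1; rewrite ler_wpM2l ?rnorm_ge0 // lerDl.
  have sy' : rnorm (Num.conj s *: y) < rho / 4 by move: sy; rewrite !rnormZ rnorm_conj.
  have := hK _ _ sy sy'; rewrite hA hB conj_prod conjCK -mulrDr !rnormZ rnorm_conj.
  have Zs (u v : C) : Z u + v *: y = Z (u + v) by rewrite /Z scalerDl addrA.
  have -> : Z (Num.conj t) + Num.conj s *: y = Z (Num.conj (t + s)).
    by rewrite Zs; congr Z; rewrite rmorphD.
  rewrite Zs -/(f t) -/(f (t + s)) [s * _]mulrC => /le_trans; apply.
  have -> : K * (rnorm s * rnorm y + rnorm s * rnorm y) ^+ 2 = 4 * K * rnorm y ^+ 2 * rnorm s * rnorm s by ring.
  rewrite ler_wpM2r ?rnorm_ge0 //; apply: le_trans (ltW s2); rewrite mulrC ler_wpM2l ?rnorm_ge0 //.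
  by rewrite lerDl.
have fM (t : C) : rnorm t = 2 -> rnorm (f t) <= M.
  by move=> t2; apply: (sesq_bound hF); apply: Zin1; rewrite ?rnorm_conj t2.
have fz : f 'i%C = F z w.
  have ci : Num.conj 'i%C = - 'i%C :> C.
    by apply/eqP; rewrite eq_complex /= oppr0 !eqxx.
  by rewrite /f ci /Z scaleNr zE wE.
rewrite -fz; apply/eqP/negPn/negP => fn0.
have f1 := rnorm_gt0 fn0.
have ri : rnorm ('i%C : C) < 2 by rewrite rnorm_i ltr1n.
(* In the disc of radius 2, each zero s contributes a factor 2 - |s| >= 7/4 on one side of the
   Schwarz lemma and |i - s| <= 5/4 on the other. *)
suff : (7 / 4 : R) <= 5 / 4 by lra.
apply: (@le_of_pow _ (rnorm (f 'i%C)) M); [exact: f1|by lra|by lra|] => N.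
pose s (k : nat) : C := ((4 * k.+1%:R)^-1 : R)%:C.
have sn (k : nat) : rnorm (s k) <= 4^-1.
  rewrite /s rnorm_real ger0_norm ?invr_ge0 ?mulr_ge0 // lef_pV2 ?posrE ?mulr_gt0 //.
  by rewrite ler_peMr // ler1n.
have S_uniq : uniq [seq s j | j <- iota 0 N].
  rewrite map_inj_uniq ?iota_uniq // => k l /complexI /invr_inj /mulfI.
  by rewrite pnatr_eq0 => /(_ isT) /eqP; rewrite eqr_nat => /eqP[].
have := @zeros_in_disc R f 2 M _ 'i%C (ltr0Sn _ 1) ri df fM S_uniq.
rewrite !big_map => h.
have {h} : rnorm (f 'i%C) * \prod_(j <- iota 0 N) (2 - rnorm (s j)) <=
    M * \prod_(j <- iota 0 N) rnorm ('i%C - s j).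
  apply: h => _ /mapP[k _ ->]; split; first by have := sn k; lra.
  have sc : Num.conj (s k) = s k by exact: conjc_real.
  by rewrite /f sc; apply/F0/Zin1; have := sn k; lra.
move=> h; apply: (@le_trans _ _ (rnorm (f 'i%C) * \prod_(j <- iota 0 N) (2 - rnorm (s j)))).
  rewrite ler_pM2l // pow_iota; apply: ler_prod => k _.
  by have := sn k; have := rnorm_ge0 (s k); lra.
apply: (le_trans h); rewrite ler_wpM2l // pow_iota; apply: ler_prod => k _.
rewrite rnorm_ge0 /=; have := rnormD ('i%C : C) (- s k); rewrite rnormN rnorm_i.
by have := sn k; lra.
Qed.

End DiagonalRestriction.

(** * Separate continuity and local boundedness *)

Section LocalBoundedness.
Variables (R : realType) (m : nat).
Local Notation C := R[i].
Local Notation V := 'rV[C]_m.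

Lemma rnorm_row_le (x : V) (c : R) : 0 <= c -> (forall i, rnorm (x 0 i) <= c) -> rnorm x <= c.
Proof.
move=> c0 h; have [x0|x0] := eqVneq (`|x|) 0.
  by rewrite /rnorm x0.
have [[i j] /= e] := mx_norm_neq0 x0.
by rewrite /rnorm [`|x|]e ord1; exact: h.
Qed.

Lemma row_cauchy (u : nat -> V) : (forall e : R, 0 < e -> exists N, forall k l, (N <= k)%N -> (N <= l)%N ->
    rnorm (u k - u l) <= e) ->
  exists z : V, forall n (c : R), 0 <= c -> (forall k, (n <= k)%N -> rnorm (u k - u n) <= c) ->
    rnorm (z - u n) <= c.
Proof.
move=> h.
have cau i : exists l : C, cvgc (fun k => u k 0 i) l.
  apply: complex_cauchy => e /h[N hN]; exists N => k l kN lN.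
  apply: le_trans (hN _ _ kN lN); have := rnorm_coord (u k - u l) i.
  by rewrite !mxE.
have /choice[z0 hz] := cau; exists (\row_i z0 i) => n c c0 hc.
apply: rnorm_row_le => // i; apply/ler_addgt0Pr => e /(hz i)[N hN].
rewrite !mxE; have nk := leq_maxl n N; have Nk := leq_maxr n N.
have h1 := hN _ Nk; have h2 := le_trans (rnorm_coord _ i) (hc _ nk); rewrite !mxE in h2.
apply: (le_trans (rnorm_leB _ (u (maxn n N) 0 i - u n 0 i))); rewrite [c + e]addrC.
by apply: lerD; [rewrite opprB addrA subrK rnormB; exact: h1|exact: h2].
Qed.

(** A Baire category argument: if no ball worked, nested balls would close in on a point z that has
   points w_n -> z with |F z w_n| > n, against the continuity of F z. Continuity in the first variable
   is what lets a large value at one point persist on a ball. *)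
Lemma separately_continuous_bounded (F : V -> V -> C) (a : V) (rho : R) : 0 < rho ->
  (forall z w, rball a rho z -> rball a rho w -> {for z, continuous (fun z => F z w)}) ->
  (forall z w, rball a rho z -> rball a rho w -> {for w, continuous (F z)}) ->
  exists b s M, [/\ 0 < s, rball b s `<=` rball a rho &
    forall z w, rball b s z -> rball b s w -> rnorm (F z w) <= M].
Proof.
move=> r0 cl cr; apply: contrapT => hno.
pose bad n z := exists2 w, rball a rho w /\ rnorm (w - z) < n.+1%:R^-1 & n%:R < rnorm (F z w).
(* The balls of radius 2 q.2 are nested, so that the limit of the centres, which lies only in the
   closure of the balls of radius q.2, stays inside. *)
have step n (p : V * R) : exists q : V * R,
    0 < p.2 -> rball p.1 p.2 `<=` rball a rho -> [/\ 0 < q.2, q.2 <= p.2 / 2,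
      rball q.1 (2 * q.2) `<=` rball p.1 p.2 & forall z, rball q.1 (2 * q.2) z -> bad n z].
  case: p => b s /=; have [s0|] := pselect (0 < s); last by exists (0, 0).
  have [sub|] := pselect (rball b s `<=` rball a rho); last by exists (0, 0).
  have [i i0 iE] : exists2 i : R, 0 < i & n.+1%:R^-1 = i.
    by exists (n.+1%:R^-1); rewrite // invr_gt0.
  rewrite /bad iE; have n1 : 0 < i / 2 by rewrite divr_gt0.
  have [z [w [zb wb big]]] : exists z w, [/\ rball b (Num.min s (i / 2)) z,
      rball b (Num.min s (i / 2)) w & n%:R < rnorm (F z w)].
    apply: contrapT => h; apply: hno; exists b, (Num.min s (i / 2)), n%:R; split.
    - by rewrite lt_min s0.
    - by move=> x; rewrite /rball /= lt_min => /andP[xs _]; exact: sub.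
    - move=> z w zb wb; rewrite leNgt; apply/negP => big; apply: h.
      by exists z, w.
  move: zb wb; rewrite /rball /= !lt_min => /andP[zs zn] /andP[ws wn].
  have zw : rnorm (w - z) < i.
    have := rnormD (w - b) (b - z); rewrite addrA subrK (rnormB b z) => /le_lt_trans; apply.
    by rewrite [ltRHS]splitr; exact: ltrD.
  have gap : 0 < rnorm (F z w) - n%:R by rewrite subr_gt0.
  have [d d0 hd] := (continuous_rballP _ _).1 (cl z w (sub _ zs) (sub _ ws)) _ gap.
  have [t t0 [t1 t2 t3 t4]] : exists2 t : R, 0 < t & [/\ t <= s / 2, t <= d / 2,
      t <= (s - rnorm (z - b)) / 2 & t <= (i - rnorm (w - z)) / 2].
    pose t := Num.min (s / 2) (Num.min (d / 2) (Num.min ((s - rnorm (z - b)) / 2) ((i - rnorm (w - z)) / 2))).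
    exists t; first by rewrite !lt_min; apply/and4P; split; rewrite divr_gt0 ?subr_gt0.
    by split; rewrite /t !ge_min lexx ?orbT.
  exists (z, t) => _ _; split => //=.
    by apply: rball_sub; clear -t3; lra.
  move=> x; rewrite /rball /= => xz; exists w; first split.
  - by apply: sub.
  - have := rnormD (w - z) (z - x); rewrite addrA subrK (rnormB z x); clear -t4 xz; lra.
  - have xd : rnorm (x - z) < d by clear -xz t2; lra.
    have := hd _ xd; have := rnorm_leB (F z w) (F x w); rewrite (rnormB (F z w)); clear; lra.
have /choice[nxt nxtP] : forall np : nat * (V * R), exists q : V * R,
    0 < np.2.2 -> rball np.2.1 np.2.2 `<=` rball a rho -> [/\ 0 < q.2, q.2 <= np.2.2 / 2,
      rball q.1 (2 * q.2) `<=` rball np.2.1 np.2.2 & forall z, rball q.1 (2 * q.2) z -> bad np.1 z].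
  by move=> [n p]; exact: step.
pose u := fix u n := if n is n'.+1 then nxt (n', u n') else (a, rho).
have inv n : 0 < (u n).2 /\ rball (u n).1 (u n).2 `<=` rball a rho.
  elim: n => [|n [h0 h1]]; first by split.
  have [q0 _ qs _] := nxtP (n, u n) h0 h1; split => // x xq; apply/h1/qs.
  by apply: rball_le xq; rewrite mulr2n mulrDl mul1r lerDl ltW.
have st n : [/\ (u n.+1).2 <= (u n).2 / 2, rball (u n.+1).1 (2 * (u n.+1).2) `<=` rball (u n).1 (u n).2 &
    forall z, rball (u n.+1).1 (2 * (u n.+1).2) z -> bad n z].
  by have [h0 h1] := inv n; have [? ? ? ?] := nxtP (n, u n) h0 h1.
have small n : (u n).2 <= rho / 2 ^+ n.
  elim: n => [|n IH]; first by rewrite expr0 divr1.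
  have [h _ _] := st n; apply: (le_trans h); rewrite exprS invfM mulrCA.
  by rewrite [_ / 2]mulrC ler_pM2l // invr_gt0.
have nest n k : rball (u (n + k)%N).1 (u (n + k)%N).2 `<=` rball (u n).1 (u n).2.
  elim: k => [|k IH]; first by rewrite addn0.
  rewrite addnS => x xq; apply: IH; have [_ h _] := st (n + k)%N; apply: h.
  by apply: rball_le xq; have [] := inv (n + k).+1; lra.
have near n k : (n <= k)%N -> rnorm ((u k).1 - (u n).1) < (u n).2.
  by move=> /subnKC <-; apply: nest; apply: rball_center; case: (inv (n + (k - n))%N).
have [z hz] : exists z : V, forall n (c : R), 0 <= c ->
    (forall k, (n <= k)%N -> rnorm ((u k).1 - (u n).1) <= c) -> rnorm (z - (u n).1) <= c.
  apply: row_cauchy => e e0; have e2 : 0 < e / 2 by rewrite divr_gt0.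
  have [N hN] : exists N, rho / 2 ^+ N < e / 2.
    have := @cvg_geometric R rho (2^-1).
    rewrite ger0_norm ?invr_ge0 // invf_lt1 // ltr1n => /(_ isT) /cvgrPdist_lt /(_ _ e2).
    move=> [N _ /(_ N (leqnn N))] /=; rewrite sub0r normrN => hN; exists N.
    by apply: le_lt_trans hN; rewrite exprVn ler_norm.
  exists N => k l kN lN; have := near _ _ kN; have := near _ _ lN; have := small N.
  have := rnormD ((u k).1 - (u N).1) ((u N).1 - (u l).1); rewrite addrA subrK (rnormB (u N).1).
  by lra.
have zu n : rnorm (z - (u n).1) <= (u n).2.
  by apply: hz; [case: (inv n) => /ltW|move=> k /near /ltW].
have zbad n : bad n z.
  have [_ _ h] := st n; apply: h; rewrite /rball /=; apply: (le_lt_trans (zu n.+1)).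
  by have [] := inv n.+1; lra.
have za : rball a rho z.
  have [_ h _] := st 0%N; apply: h; rewrite /rball /=; apply: (le_lt_trans (zu 1%N)).
  by have [] := inv 1%N; lra.
have [d d0 hd] := (continuous_rballP _ _).1 (cr z z za za) _ ltr01.
pose N := maxn (Num.trunc (d^-1)) (Num.trunc (rnorm (F z z) + 1)).+1.
have [w [wa wz] big] := zbad N.
have wd : rnorm (w - z) < d.
  apply: (lt_le_trans wz); rewrite -[d]invrK lef_pV2 ?posrE ?invr_gt0 //.
  apply/ltW; apply: (lt_le_trans (truncnS_gt _)); rewrite ler_nat ltnS leq_maxl //.
have := hd _ wd; have := rnorm_leB (F z w) (F z z).
have : rnorm (F z z) + 1 < N%:R.
  by apply: (lt_le_trans (truncnS_gt _)); rewrite ler_nat leq_maxr.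
by lra.
Qed.

Lemma rball_connected (a : V) (rho : R) : 0 < rho -> connected (rball a rho).
Proof.
move=> r0; have seg x : rball a rho x ->
    connected ((fun t : R => a + t%:C *: (x - a)) @` `[0, 1]).
  move=> xa; apply: connected_continuous_connected; first exact: segment_connected.
  apply: continuous_subspaceT => t A /nbhs_rballP[e e0 eA].
  have d1 : 0 < rnorm (x - a) + 1 by rewrite ltr_wpDl // rnorm_ge0.
  apply/nbhs_ballP; exists (e / (rnorm (x - a) + 1)); first by rewrite /= divr_gt0.
  move=> s; rewrite -ball_normE /= ltr_pdivlMr // => ts; apply: eA; rewrite /rball /=.
  have -> : a + s%:C *: (x - a) - (a + t%:C *: (x - a)) = (s - t)%:C *: (x - a).
    by rewrite opprD addrACA subrr add0r -scalerBl rmorphB.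
  rewrite rnormZ rnorm_real distrC; apply: le_lt_trans ts.
  by rewrite ler_wpM2l // lerDl.
have -> : rball a rho = \bigcup_(x in rball a rho) ((fun t : R => a + t%:C *: (x - a)) @` `[0, 1]).
  apply/seteqP; split => [x xa|x [y ya [t]]].
    exists x => //; exists 1; first by rewrite /= in_itv /= ler01 lexx.
    by rewrite rmorph1 scale1r addrC subrK.
  rewrite /= in_itv /= => /andP[t0 t1] <-; rewrite /rball /= addrAC subrr add0r rnormZ rnorm_real ger0_norm //.
  by apply: le_lt_trans ya; rewrite ler_piMl // rnorm_ge0.
apply: bigcup_connected; last by move=> x /seg.
exists a => x xa; exists 0; first by rewrite /= in_itv /= ler01 lexx.
by rewrite rmorph0 scale0r addr0.
Qed.

Lemma rball_domain (a : V) (rho : R) : 0 < rho -> domain (rball a rho).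
Proof.
move=> r0; split; [exact: rball_open|exact: rball_connected|].
by exists a; exact: rball_center.
Qed.

End LocalBoundedness.

(** * Positive definite kernels on arbitrary sets *)

Section PositiveKernels.
Variable R : realType.
Local Notation C := R[i].

(** No regularity, and any index type T: with T = V * 'I_m this covers matrix-valued kernels, whose
   rows are moved into the argument. *)
Definition pdk (T : Type) (U : set T) (k : T -> T -> C) := forall (I : finType) (u : I -> T) (x : I -> C),
  (forall p, U (u p)) -> 0 <= \sum_p \sum_q k (u p) (u q) * x q * Num.conj (x p).

Section Limits.
Implicit Types (u v : nat -> C) (l : C).

Lemma cvgc_cst l : cvgc (fun _ => l) l.
Proof. by move=> e e0; exists 0%N => n _; rewrite subrr rnorm0 ltW. Qed.

Lemma cvgcD u v l l' : cvgc u l -> cvgc v l' -> cvgc (fun n => u n + v n) (l + l').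
Proof.
move=> hu hv e e0; have e2 : 0 < e / 2 by rewrite divr_gt0.
have [N1 h1] := hu _ e2; have [N2 h2] := hv _ e2; exists (maxn N1 N2) => n.
rewrite geq_max => /andP[/h1 {}h1 /h2 {}h2]; rewrite opprD addrACA [e]splitr.
by apply: (le_trans (rnormCD _ _)); exact: lerD.
Qed.

Lemma cvgcM c u l : cvgc u l -> cvgc (fun n => u n * c) (l * c).
Proof.
move=> hu e e0; have c0 : 0 < rnorm c + 1 by rewrite ltr_wpDl // rnorm_ge0.
have [N h] := hu _ (divr_gt0 e0 c0); exists N => n /h hn; rewrite -mulrBl rnormM.
apply: (@le_trans _ _ (e / (rnorm c + 1) * (rnorm c + 1))).
  by rewrite ler_pM ?rnorm_ge0 // lerDl.
by rewrite divfK // gt_eqF.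
Qed.

Lemma cvgc_eq u v l l' : (forall n, u n = v n) -> l = l' -> cvgc u l -> cvgc v l'.
Proof. by move=> uv <- h e /h[N hN]; exists N => n /hN; rewrite uv. Qed.

Lemma cvgc_sum (I : finType) (u : I -> nat -> C) (l : I -> C) :
  (forall i, cvgc (u i) (l i)) -> cvgc (fun n => \sum_i u i n) (\sum_i l i).
Proof.
move=> h; elim: (index_enum I) => [|i r IH].
  by apply: cvgc_eq (cvgc_cst 0) => [n|]; rewrite big_nil.
by apply: cvgc_eq (cvgcD (h i) IH) => [n|]; rewrite big_cons.
Qed.

Lemma cvgc_ge0 u l : (forall n, 0 <= u n) -> cvgc u l -> 0 <= l.
Proof.
move=> u0 h; have Im0 : complex.Im l = 0.
  apply/eqP; rewrite -normr_le0; apply/ler_addgt0Pr => e /h[N /(_ _ (leqnn _))] hN.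
  rewrite add0r; apply: le_trans hN; rewrite rnormB; apply: le_trans (Im_le_rnorm _).
  by rewrite raddfB /= [complex.Im (u N)]ger0_Im // subr0.
have Re0 : 0 <= complex.Re l.
  apply/ler_addgt0Pr => e /h[N /(_ _ (leqnn _))] hN.
  have : 0 <= complex.Re (u N) by have := u0 N; rewrite lecE => /andP[].
  have := le_trans (Re_le_rnorm _) hN; rewrite raddfB /= ler_norml => /andP[? ?].
  by lra.
by rewrite lecE /= Im0 eqxx.
Qed.

End Limits.

Section Basic.
Variables (T : Type) (U : set T).
Implicit Types k : T -> T -> C.

(** The 2 by 2 Gram inequality at z and w. *)
Lemma pdk_rect k z w (c : C) : pdk U k -> U z -> U w ->
  0 <= k z z + k w w * (c * Num.conj c) + k z w * c + k w z * Num.conj c.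
Proof.
move=> hk Uz Uw.
have := hk bool (fun b => if b then z else w) (fun b => if b then 1 else c).
rewrite !big_bool /= => h; apply: le_trans (h _) _; first by case.
by rewrite rmorph1 le_eqVlt; apply/orP; left; apply/eqP; ring.
Qed.

Lemma pdk_diag_ge0 k z : pdk U k -> U z -> 0 <= k z z.
Proof.
move=> hk Uz; have := hk unit (fun _ => z) (fun _ => 1) (fun _ => Uz).
by rewrite !big_const !card_unit /= !addr0 mulr1 rmorph1 mulr1.
Qed.

Lemma pdk_herm k z w : pdk U k -> U z -> U w -> k w z = Num.conj (k z w).
Proof.
move=> hk Uz Uw; have h1 := pdk_rect 1 hk Uz Uw; have h2 := pdk_rect 'i%C hk Uz Uw.
have hz := pdk_diag_ge0 hk Uz; have hw := pdk_diag_ge0 hk Uw.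
move: (k z z) (k w w) (k z w) (k w z) hz hw h1 h2 => [a a'] [b b'] [x x'] [y y'].
rewrite !lecE /= => /andP[/eqP -> _] /andP[/eqP -> _] /andP[/eqP e1 _] /andP[/eqP e2 _].
by apply/eqP; rewrite eq_complex /=; apply/andP; split; apply/eqP; lra.
Qed.

(** Values on the diagonal bound the kernel everywhere: this is how bounds for polarizations are
   obtained. *)
Lemma pdk_bound k z w : pdk U k -> U z -> U w ->
  rnorm (k z w) <= complex.Re (k z z) + complex.Re (k w w).
Proof.
move=> hk Uz Uw; apply: (le_trans (rnorm_le_ReIm _)).
have h1 := pdk_rect 1 hk Uz Uw; have h2 := pdk_rect 'i%C hk Uz Uw.
have h3 := pdk_rect (-1) hk Uz Uw; have h4 := pdk_rect (- 'i%C) hk Uz Uw.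
have hz := pdk_diag_ge0 hk Uz; have hw := pdk_diag_ge0 hk Uw.
move: (pdk_herm hk Uz Uw) h1 h2 h3 h4 hz hw => ->.
move: (k z z) (k w w) (k z w) => [a a'] [b b'] [x x'] /=.
rewrite !lecE /= => /andP[_ h1] /andP[_ h2] /andP[_ h3] /andP[_ h4] /andP[/eqP e1 ha] /andP[/eqP e2 hb].
have : `|x| <= (a + b) / 2 by rewrite ler_norml; apply/andP; split; lra.
have : `|x'| <= (a + b) / 2 by rewrite ler_norml; apply/andP; split; lra.
by lra.
Qed.

Lemma pdk_eq k k' : (forall z w, U z -> U w -> k z w = k' z w) -> pdk U k -> pdk U k'.
Proof.
move=> e hk I u x Uu; apply: le_trans (hk I u x Uu) _.
rewrite le_eqVlt; apply/orP; left; apply/eqP.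
by apply: eq_bigr => p _; apply: eq_bigr => q _; rewrite e.
Qed.

Lemma pdk_twist k (f : T -> C) : pdk U k -> pdk U (fun z w => f z * Num.conj (f w) * k z w).
Proof.
move=> hk I u x Uu.
apply: le_trans (hk I u (fun p => Num.conj (f (u p)) * x p) Uu) _.
rewrite le_eqVlt; apply/orP; left; apply/eqP.
apply: eq_bigr => p _; apply: eq_bigr => q _.
by rewrite conj_prod conjCK; ring.
Qed.

Lemma pdk1 : pdk U (fun _ _ => 1).
Proof.
move=> I u x _; have -> : \sum_p \sum_q 1 * x q * Num.conj (x p) = (\sum_p x p) * Num.conj (\sum_p x p).
  rewrite conj_sum mulr_sumr; apply: eq_bigr => p _; rewrite mulr_suml.
  by apply: eq_bigr => q _; rewrite mul1r.
exact: mul_conjC_ge0.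
Qed.

Lemma pdkD k k' : pdk U k -> pdk U k' -> pdk U (fun z w => k z w + k' z w).
Proof.
move=> hk hk' I u x Uu; apply: le_trans (addr_ge0 (hk I u x Uu) (hk' I u x Uu)) _.
rewrite le_eqVlt; apply/orP; left; apply/eqP; rewrite -big_split; apply: eq_bigr => p _.
by rewrite -big_split; apply: eq_bigr => q _ /=; rewrite !mulrDl.
Qed.

Lemma pdkZ k (t : R) : 0 <= t -> pdk U k -> pdk U (fun z w => t%:C * k z w).
Proof.
move=> t0 hk I u x Uu; have t0' : 0 <= t%:C :> C by rewrite lecR.
apply: le_trans (mulr_ge0 t0' (hk I u x Uu)) _.
rewrite le_eqVlt; apply/orP; left; apply/eqP; rewrite mulr_sumr; apply: eq_bigr => p _.
by rewrite mulr_sumr; apply: eq_bigr => q _; rewrite !mulrA.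
Qed.

Lemma pdk_lim (k_ : nat -> T -> T -> C) k : (forall n, pdk U (k_ n)) ->
  (forall z w, U z -> U w -> cvgc (fun n => k_ n z w) (k z w)) -> pdk U k.
Proof.
move=> hk hl I u x Uu; apply: cvgc_ge0 (fun n => hk n I u x Uu) _.
by apply: cvgc_sum => p; apply: cvgc_sum => q; do 2!apply: cvgcM; exact: hl.
Qed.

Local Open Scope sesquilinear_scope.

(** Schur: the spectral theorem writes the first Gram matrix as a sum of rank-one matrices with
   nonnegative weights, and a rank-one factor is absorbed into the vector x. *)
Lemma pdkM k k' : pdk U k -> pdk U k' -> pdk U (fun z w => k z w * k' z w).
Proof.
move=> hk hk' I u x Uu.
pose l := #|I|; pose v (i : 'I_l) := u (enum_val i).
have Uv i : U (v i) by exact: Uu.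
pose A : 'M[C]_l := \matrix_(p, q) k (v p) (v q).
have Aherm : A ^t* = A.
  by apply/matrixP => p q; rewrite !mxE; apply/esym/pdk_herm.
have /orthomx_spectralP eA : A \is normalmx by apply/normalmxP; rewrite Aherm.
rewrite (invmx_unitary (spectral_unitarymx A)) in eA.
have Pu := spectral_unitarymx A; move: eA Pu.
move: (spectralmx A) (spectral_diag A) => P d eA /unitarymxP Pu.
have Apq p q : k (v p) (v q) = \sum_j d 0 j * (Num.conj (P j p) * P j q).
  have := congr1 (fun B : 'M[C]_l => B p q) eA; rewrite mxE => ->; rewrite mxE; apply: eq_bigr => j _.
  by rewrite mul_mx_diag !mxE; ring.
have d0 j : 0 <= d 0 j.
  have := hk 'I_l v (fun q => Num.conj (P j q)) Uv.
  have -> : \sum_p \sum_q k (v p) (v q) * Num.conj (P j q) * Num.conj (Num.conj (P j p)) =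
     (P *m A *m P ^t*) j j.
    rewrite mxE exchange_big; apply: eq_bigr => q _ /=; rewrite !mxE mulr_suml.
    by apply: eq_bigr => p _; rewrite !mxE conjCK; ring.
  have -> : P *m A *m P^t* = diag_mx d.
    by rewrite eA !mulmxA Pu mul1mx -mulmxA Pu mulmx1.
  by rewrite mxE eqxx mulr1n.
rewrite (reindex (@enum_val I I)) /=; last by apply: onW_bij; exact: enum_val_bij.
have -> : \sum_(j < l) \sum_q k (u (enum_val j)) (u q) * k' (u (enum_val j)) (u q) * x q * Num.conj (x (enum_val j))
  = \sum_(j < l) d 0 j * \sum_(p < l) \sum_(q < l) k' (v p) (v q) * (P j q * x (enum_val q)) *
        Num.conj (P j p * x (enum_val p)).
  transitivity (\sum_(p < l) \sum_(q < l) \sum_(j < l) d 0 j * (k' (v p) (v q) * (P j q * x (enum_val q)) *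
        Num.conj (P j p * x (enum_val p)))).
    apply: eq_bigr => p _; rewrite (reindex (@enum_val I I)) /=; last by apply: onW_bij; exact: enum_val_bij.
    apply: eq_bigr => q _; rewrite -/(v p) -/(v q) Apq !mulr_suml; apply: eq_bigr => j _.
    by rewrite conj_prod; ring.
  under eq_bigr => p _ do rewrite exchange_big /=.
  rewrite exchange_big /=; apply: eq_bigr => j _; rewrite mulr_sumr.
  by apply: eq_bigr => p _; rewrite mulr_sumr.
apply: sumr_ge0 => j _; apply: mulr_ge0 => //; exact: hk'.
Qed.

Lemma pdkX k n : pdk U k -> pdk U (fun z w => k z w ^+ n).
Proof.
move=> hk; elim: n => [|n IH]; first exact: pdk1.
by apply: pdk_eq (pdkM hk IH) => z w _ _; rewrite exprS.
Qed.

End Basic.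

Lemma rnorm_cexp (z : C) : rnorm (cexp z) = expR (complex.Re z).
Proof.
rewrite /cexp rnormM rnorm_real ger0_norm ?expR_ge0 //.
have -> : rnorm ((cos (complex.Im z))%:C + 'i%C * (sin (complex.Im z))%:C : C) = 1.
  apply/eqP; rewrite -(@eqrXn2 _ 2) ?rnorm_ge0 // rnorm_sqr /=.
  by apply/eqP; rewrite expr1n -[RHS](cos2Dsin2 (complex.Im z)); ring.
by rewrite mulr1.
Qed.

Lemma cexpX (z : C) n : cexp (n%:R * z) = cexp z ^+ n.
Proof.
elim: n => [|n IH]; first by rewrite mul0r cexp0.
by rewrite -natr1 mulrDl mul1r cexpD IH exprSr.
Qed.

Lemma cexp_limit (u : C) : cvgc (fun n => (1 + (n.+1%:R^-1 : R)%:C * u) ^+ n.+1) (cexp u).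
Proof.
move=> e e0; pose K := expR (rnorm u) * (rnorm u + 1).
have K0 : 0 < K by rewrite mulr_gt0 ?expR_gt0 // ltr_wpDl // rnorm_ge0.
have u1 : 0 < rnorm u + 1 by rewrite ltr_wpDl // rnorm_ge0.
have [d d0 hd] := frechet_cexp0 (divr_gt0 e0 K0).
exists (Num.trunc ((rnorm u + 1) / d)) => n nN.
have n0 : 0 < n.+1%:R :> R by [].
set x : C := (n.+1%:R^-1 : R)%:C * u.
have rx : rnorm x = rnorm u / n.+1%:R.
  by rewrite /x rnormM rnorm_real ger0_norm ?invr_ge0 // mulrC.
have xd : rnorm x < d.
  rewrite rx ltr_pdivrMr // mulrC -ltr_pdivrMr //.
  apply: (@lt_le_trans _ _ ((Num.trunc ((rnorm u + 1) / d)).+1%:R)); last by rewrite ler_nat ltnS.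
  by apply: le_lt_trans (truncnS_gt _); rewrite ler_pM2r ?invr_gt0 // lerDl.
have {hd} := hd _ xd; rewrite add0r cexp0 => hd.
have -> : cexp u = cexp x ^+ n.+1.
  rewrite -cexpX; congr cexp; rewrite /x mulrA -(rmorph_nat (real_complex R)) -rmorphM.
  by rewrite divff ?rmorph1 ?mul1r // gt_eqF.
have a1 : rnorm (1 + x) <= expR (rnorm x).
  by apply: (le_trans (rnormCD _ _)); rewrite rnorm1 expR_ge1Dx.
have b1 : rnorm (cexp x) <= expR (rnorm x).
  by rewrite rnorm_cexp ler_expR; apply: le_trans (ler_norm _) (Re_le_rnorm _).
rewrite rnormB subrXX rnormM.
apply: (@le_trans _ _ (e / K * rnorm x * (n.+1%:R * expR (rnorm x) ^+ n))).
  rewrite ler_pM ?rnorm_ge0 //; first by rewrite opprD addrA.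
  apply: (le_trans (rnorm_sum _ _ _)).
  apply: (@le_trans _ _ (\sum_(i < n.+1) expR (rnorm x) ^+ n)); last first.
    by rewrite sumr_const card_ord -[leLHS]mulr_natl.
  apply: ler_sum => i _; rewrite rnormM !rnormX.
  have -> : expR (rnorm x) ^+ n = expR (rnorm x) ^+ (n - i) * expR (rnorm x) ^+ i.
    by rewrite -exprD subnK // -ltnS.
  rewrite ler_pM ?exprn_ge0 ?rnorm_ge0 //.
    by rewrite lerXn2r ?nnegrE ?rnorm_ge0 ?expR_ge0.
  by rewrite lerXn2r ?nnegrE ?rnorm_ge0 ?expR_ge0.
rewrite rx -expRM_natl.
apply: (@le_trans _ _ (e / K * rnorm u * expR (rnorm u))).
  have -> : e / K * (rnorm u / n.+1%:R) * (n.+1%:R * expR (n%:R * (rnorm u / n.+1%:R))) =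
     e / K * rnorm u * expR (n%:R * (rnorm u / n.+1%:R)) by field; rewrite ?gt_eqF.
  rewrite ler_wpM2l ?mulr_ge0 ?rnorm_ge0 ?invr_ge0 ?(ltW e0) ?(ltW K0) // ler_expR mulrCA.
  by rewrite ler_piMr ?rnorm_ge0 // ler_pdivrMr // mul1r ler_nat.
have -> : e / K * rnorm u * expR (rnorm u) = e * (rnorm u / (rnorm u + 1)).
  by rewrite /K; field; rewrite !gt_eqF ?expR_gt0.
by rewrite ler_piMr ?(ltW e0) // ler_pdivrMr // mul1r lerDl.
Qed.

(** As a limit of (1 + k / n)^n, the exponential needs no series. *)
Lemma pdk_cexp (T : Type) (U : set T) (k : T -> T -> C) : pdk U k -> pdk U (fun z w => cexp (k z w)).
Proof.
move=> hk; apply: (@pdk_lim _ _ (fun n z w => (1 + (n.+1%:R^-1 : R)%:C * k z w) ^+ n.+1)).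
  move=> n; apply: pdkX; apply: pdkD; first exact: pdk1.
  by apply: pdkZ => //; rewrite invr_ge0.
by move=> z w _ _; exact: cexp_limit.
Qed.

End PositiveKernels.

(** * Logarithms of kernels and their mixed Hessians *)

Section LogarithmicHessian.
Variables (R : realType) (m : nat).
Local Notation C := R[i].
Local Notation V := 'rV[C]_m.

(** Linear combinations of point evaluations: the kernel is evaluated on the measures with masses
   c z j at the points f z j. *)
Lemma pdk_pullback (S T : Type) (W : set S) (U : set T) (k : T -> T -> C) (J : finType)
    (f : S -> J -> T) (c : S -> J -> C) : pdk U k -> (forall z j, W z -> U (f z j)) ->
  pdk W (fun z w => \sum_i \sum_j c z i * Num.conj (c w j) * k (f z i) (f w j)).
Proof.
move=> hk hf I u x Wu.
have := hk (I * J)%type (fun p => f (u p.1) p.2) (fun p => Num.conj (c (u p.1) p.2) * x p.1).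
move=> /(_ (fun p => hf _ _ (Wu _))) /le_trans; apply.
rewrite le_eqVlt; apply/orP; left; apply/eqP.
rewrite -(pair_bigA _ (fun p i => \sum_(q : I * J) k (f (u p) i) (f (u q.1) q.2) *
  (Num.conj (c (u q.1) q.2) * x q.1) * Num.conj (Num.conj (c (u p) i) * x p))) /=.
apply: eq_bigr => p _.
transitivity (\sum_i \sum_q \sum_j c (u p) i * Num.conj (c (u q) j) * k (f (u p) i) (f (u q) j) *
    x q * Num.conj (x p)).
  apply: eq_bigr => i _; rewrite pair_bigA /=; apply: eq_bigr => q _.
  by rewrite conj_prod conjCK; ring.
rewrite exchange_big /=; apply: eq_bigr => q _; rewrite !mulr_suml.
by apply: eq_bigr => i _; rewrite !mulr_suml.
Qed.

Lemma pdk_map (S T : Type) (W : set S) (U : set T) (k : T -> T -> C) (f : S -> T) :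
  pdk U k -> (forall z, W z -> U (f z)) -> pdk W (fun z w => k (f z) (f w)).
Proof. by move=> hk hf I u x Wu; exact: (hk I (fun p => f (u p)) x (fun p => hf _ (Wu p))). Qed.

Lemma pdk_second_difference (U : set V) (k : V -> V -> C) : pdk U k ->
  pdk [set p : V * V | U p.1 /\ U (p.1 + p.2)]
    (fun p q => second_difference k p.1 p.2 q.1 q.2).
Proof.
move=> hk.
pose f (p : V * V) (b : bool) := if b then p.1 + p.2 else p.1.
pose c (_ : V * V) (b : bool) : C := if b then 1 else -1.
apply: pdk_eq (@pdk_pullback _ _ [set p : V * V | U p.1 /\ U (p.1 + p.2)] _ _ bool f c hk _) => [z w _ _|z [] []//].
by rewrite !big_bool /= /second_difference rmorph1 rmorphN1; ring.
Qed.

Lemma cvgc_inv (K : R) (u : nat -> C) l : 0 <= K -> (forall n, rnorm (u n - l) <= K / n.+1%:R) -> cvgc u l.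
Proof.
move=> K0 h e e0; exists (Num.trunc (K / e)) => n nN.
apply: (le_trans (h n)); rewrite ler_pdivrMr // mulrC -ler_pdivrMr //.
by apply/ltW/(lt_le_trans (truncnS_gt _)); rewrite ler_nat ltnS.
Qed.

Lemma cexp_derivative0 (x : C) : cvgc (fun n => (n.+1%:R : R)%:C * (cexp ((n.+1%:R^-1 : R)%:C * x) - 1)) x.
Proof.
move=> e e0; have x1 : 0 < rnorm x + 1 by rewrite ltr_wpDl // rnorm_ge0.
have [d d0 hd] := frechet_cexp0 (divr_gt0 e0 x1).
exists (Num.trunc ((rnorm x + 1) / d)) => n nN.
have n0 : 0 < n.+1%:R :> R by [].
have nn : (n.+1%:R : R)%:C * (n.+1%:R^-1 : R)%:C = 1 :> C.
  by rewrite -rmorphM divff ?rmorph1 // gt_eqF.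
set y : C := (n.+1%:R^-1 : R)%:C * x.
have ry : rnorm y = rnorm x / n.+1%:R.
  by rewrite /y rnormM rnorm_real ger0_norm ?invr_ge0 // mulrC.
have yd : rnorm y < d.
  rewrite ry ltr_pdivrMr // mulrC -ltr_pdivrMr //.
  apply: (@lt_le_trans _ _ ((Num.trunc ((rnorm x + 1) / d)).+1%:R)); last by rewrite ler_nat ltnS.
  by apply: le_lt_trans (truncnS_gt _); rewrite ler_pM2r ?invr_gt0 // lerDl.
have {hd} := hd _ yd; rewrite add0r cexp0 => hd.
have -> : (n.+1%:R : R)%:C * (cexp y - 1) - x = (n.+1%:R : R)%:C * (cexp y - 1 - y).
  by rewrite [RHS]mulrBr /y mulrA nn mul1r.
rewrite rnormM rnorm_real ger0_norm //.
apply: (@le_trans _ _ (n.+1%:R * (e / (rnorm x + 1) * rnorm y))); first by rewrite ler_pM2l.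
rewrite ry; have -> : n.+1%:R * (e / (rnorm x + 1) * (rnorm x / n.+1%:R)) = e * (rnorm x / (rnorm x + 1)).
  by field; rewrite !gt_eqF.
by rewrite ler_piMr ?(ltW e0) // ler_pdivrMr // mul1r lerDl.
Qed.

(** Telescoping in both directions. *)
Lemma second_difference_grid (l : V -> V -> C) (p q : nat -> V) (x y : V) N :
  (forall s, p s + x = p s.+1) -> (forall t, q t + y = q t.+1) ->
  \sum_(s < N) \sum_(t < N) second_difference l (p s) x (q t) y =
  l (p N) (q N) - l (p N) (q 0%N) - l (p 0%N) (q N) + l (p 0%N) (q 0%N).
Proof.
move=> px qy; pose d s t := l (p s) (q t).
have alg (A1 A2 A3 A4 : C) : A1 - A2 - A3 + A4 = (A1 - A3) - (A2 - A4) by ring.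
have inner s : \sum_(t < N) second_difference l (p s) x (q t) y =
    (d s.+1 N - d s.+1 0%N) - (d s N - d s 0%N).
  rewrite (eq_bigr (fun t : 'I_N => (d s.+1 t.+1 - d s t.+1) - (d s.+1 t - d s t))) => [|t _]; last first.
    by rewrite /second_difference px qy alg.
  rewrite -(big_mkord xpredT (fun t => (d s.+1 t.+1 - d s t.+1) - (d s.+1 t - d s t))).
  by rewrite (telescope_sumr (fun t => d s.+1 t - d s t)) // -alg; ring.
rewrite (eq_bigr (fun s : 'I_N => (d s.+1 N - d s.+1 0%N) - (d s N - d s 0%N))) => [|s _]; last exact: inner.
rewrite -(big_mkord xpredT (fun s => (d s.+1 N - d s.+1 0%N) - (d s N - d s 0%N))).
by rewrite (telescope_sumr (fun s => d s N - d s 0%N)) // /d; ring.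
Qed.

(** The constant 1 drops out of second differences, so that the kernels (cexp (t l) - 1) / t
   transfer their positivity to l as t tends to 0. *)
Lemma pdk_second_difference_log (U : set V) (l : V -> V -> C) :
  (forall t : R, 0 < t -> pdk U (fun z w => cexp (t%:C * l z w))) ->
  pdk [set p : V * V | U p.1 /\ U (p.1 + p.2)]
    (fun p q => second_difference l p.1 p.2 q.1 q.2).
Proof.
move=> h; pose k n z w := cexp ((n.+1%:R^-1 : R)%:C * l z w).
apply: (@pdk_lim _ _ _ (fun n p q => (n.+1%:R : R)%:C * second_difference (k n) p.1 p.2 q.1 q.2)).
  by move=> n; apply: pdkZ => //; apply: pdk_second_difference; apply: h; rewrite invr_gt0.
move=> [z h1] [w h2] _ _ /=.
have c x y := cexp_derivative0 (l x y).
have := cvgcD (cvgcD (c (z + h1) (w + h2)) (cvgcM (-1) (c (z + h1) w)))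
   (cvgcD (cvgcM (-1) (c z (w + h2))) (c z w)).
by apply: cvgc_eq => [n|]; rewrite /second_difference /k; ring.
Qed.

Section Expansion.
Variables (b : V) (rho M : R) (l : V -> V -> C).
Hypotheses (rho0 : 0 < rho) (hl : sesq l b rho M).

Definition hessian_form (p q : V * V) : C :=
  \sum_i \sum_j p.2 0 i * Num.conj (q.2 0 j) * dz i (dw j l) p.1 q.1.

(** Second differences with steps h / n, multiplied by n^2, converge to the Hessian form; basis
   vectors as steps then isolate the entries of the Hessian. *)
Lemma log_kernels_hessian (r : R) : 0 < r -> r <= rho / 64 ->
  (forall t : R, 0 < t -> pdk (rball b (2 * r)) (fun z w => cexp (t%:C * l z w))) ->
  pdk [set p : V * 'I_m | rball b r p.1] (fun p q => dz p.2 (dw q.2 l) p.1 q.1).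
Proof.
move=> r0 rr h; have h2 := pdk_second_difference_log h.
have rp := rho0.
have [K K0 hK] := second_difference_hessian rho0 hl.
have r0' := ltW r0.
have e0 n : 0 < n.+1%:R^-1 :> R by rewrite invr_gt0.
have e1 n : n.+1%:R^-1 <= 1 :> R by rewrite invf_le1 ?ler1n.
have small n (x : V) : rnorm x < r -> rnorm ((n.+1%:R^-1 : R)%:C *: x) < r.
  move=> xr; rewrite rnormZ rnorm_real ger0_norm ?(ltW (e0 n)) //.
  by apply: le_lt_trans xr; rewrite ler_piMl ?rnorm_ge0.
have form : pdk [set p : V * V | rball b r p.1 /\ rnorm p.2 < r] hessian_form.
  apply: (@pdk_lim _ _ _ (fun n p q => (n.+1%:R ^+ 2 : R)%:C *
      second_difference l p.1 ((n.+1%:R^-1 : R)%:C *: p.2) q.1 ((n.+1%:R^-1 : R)%:C *: q.2))).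
    move=> n; apply: pdkZ; first by rewrite exprn_ge0.
    apply: (@pdk_map _ _ _ _ _ (fun p : V * V => (p.1, (n.+1%:R^-1 : R)%:C *: p.2)) h2) => -[z x] /= [zr xr].
    split; first by apply: rball_le zr; lra.
    by apply: rball_le (rball_addr zr (ltW (small n x xr))); lra.
  move=> [z x] [w y] /= [zr xr] [wr yr].
  have x0 := rnorm_ge0 x; have y0 := rnorm_ge0 y.
  apply: (@cvgc_inv (K * rnorm x * rnorm y * (rnorm x + rnorm y))).
    by rewrite !mulr_ge0 // addr_ge0.
  move=> n; set e : R := n.+1%:R^-1; have n0 : 0 < n.+1%:R :> R by [].
  have en : n.+1%:R * e = 1 by rewrite /e divff // gt_eqF.
  have zr' : rball b (rho / 32) z by apply: rball_le zr; lra.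
  have wr' : rball b (rho / 32) w by apply: rball_le wr; lra.
  have xs : rnorm (e%:C *: x) < rho / 32 by apply: lt_le_trans (small n x xr) _; lra.
  have ys : rnorm (e%:C *: y) < rho / 32 by apply: lt_le_trans (small n y yr) _; lra.
  have hh := hK _ _ _ _ zr' wr' xs ys.
  have ee : \sum_i \sum_j (e%:C *: x) 0 i * Num.conj ((e%:C *: y) 0 j) * dz i (dw j l) z w =
      (e ^+ 2)%:C * hessian_form (z, x) (w, y).
    rewrite /hessian_form mulr_sumr; apply: eq_bigr => i _; rewrite mulr_sumr; apply: eq_bigr => j _.
    rewrite !mxE conj_prod /=; have -> : Num.conj e%:C = e%:C :> C by exact: conjc_real.
    by rewrite rmorphXn /=; ring.
  rewrite ee in hh.
  have nC : (n.+1%:R ^+ 2 : R)%:C * (e ^+ 2)%:C = 1 :> C by rewrite -rmorphM -exprMn en expr1n.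
  move: hh; move: (second_difference l z _ w _) (hessian_form _ _) => A B hh.
  have -> : (n.+1%:R ^+ 2 : R)%:C * A - B = (n.+1%:R ^+ 2 : R)%:C * (A - (e ^+ 2)%:C * B).
    by rewrite mulrBr mulrA nC mul1r.
  rewrite rnormM rnorm_real ger0_norm ?exprn_ge0 //.
  apply: (le_trans (ler_wpM2l _ hh)); first by rewrite exprn_ge0.
  rewrite !rnormZ rnorm_real ger0_norm ?(ltW (e0 n)) // le_eqVlt; apply/orP; left; apply/eqP.
  by rewrite /e; field; rewrite gt_eqF.
have d1 i : 0 < rnorm (delta_mx 0 i : V) + 1 by rewrite ltr_wpDl // rnorm_ge0.
(* The basis vectors are shortened to fit into the ball; the factors c i are removed by a twist. *)
pose c i : R := r / (rnorm (delta_mx 0 i : V) + 1) / 2.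
have c0 i : 0 < c i by rewrite /c !divr_gt0.
have cn i : (c i)%:C != 0 :> C by apply/real_complex_neq0/lt0r_neq0.
have hf : pdk [set p : V * 'I_m | rball b r p.1]
    (fun p q => hessian_form (p.1, (c p.2)%:C *: delta_mx 0 p.2) (q.1, (c q.2)%:C *: delta_mx 0 q.2)).
  apply: (@pdk_map _ _ _ _ _ (fun p : V * 'I_m => (p.1, (c p.2)%:C *: delta_mx 0 p.2)) form) => -[z i] /= zr.
  split => //; rewrite rnormZ rnorm_real ger0_norm ?(ltW (c0 i)) //.
  apply: (@le_lt_trans _ _ (r / 2)); last by lra.
  rewrite /c mulrAC ler_pM2r ?invr_gt0 // mulrAC ler_pdivrMr // ler_pM2l // lerDl.
  exact: ler01.
have := pdk_twist (fun p : V * 'I_m => ((c p.2)%:C)^-1) hf; apply: pdk_eq => -[z i] [w j] _ _ /=.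
rewrite /hessian_form /= (bigD1 i) //= (bigD1 j) //= !big1 ?addr0 => [|i' /negPf i'i|j' /negPf j'j].
- rewrite !mxE !eqxx !mulr1.
  have -> : Num.conj ((c j)%:C^-1) = (c j)%:C^-1 :> C by rewrite -fmorphV; exact: conjc_real.
  have -> : Num.conj (c j)%:C = (c j)%:C :> C by exact: conjc_real.
  by field; rewrite !cn.
- rewrite big1 // => j' _; rewrite !mxE i'i andbF mulr0n mulr0 !mul0r.
  by [].
- by rewrite !mxE j'j andbF mulr0n mulr0 rmorph0 mulr0 mul0r.
Qed.

(** Subdividing the segments from b to z and to w into N steps, the double difference of l is a
   sum of N^2 second differences, each within O(N^-3) of the Hessian form: a Riemann sum for a double
   integral of a positive definite kernel. *)
Lemma hessian_log_kernel (r : R) : 0 < r -> r <= rho / 64 ->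
  pdk [set p : V * 'I_m | rball b r p.1] (fun p q => dz p.2 (dw q.2 l) p.1 q.1) ->
  pdk (rball b r) (fun z w => second_difference l b (z - b) b (w - b)).
Proof.
move=> r0 rr hH; have rp := rho0; have [K K0 hK] := second_difference_hessian rho0 hl.
pose pt (z : V) N (s : nat) : V := b + (s%:R / N.+1%:R : R)%:C *: (z - b).
pose st (z : V) N : V := (N.+1%:R^-1 : R)%:C *: (z - b).
have n0 N : 0 < N.+1%:R :> R by [].
have pt_in z N s : (s <= N.+1)%N -> rball b r z -> rball b r (pt z N s).
  move=> sN zr; rewrite /rball /= /pt addrAC subrr add0r rnormZ rnorm_real ger0_norm ?divr_ge0 //.
  by apply: le_lt_trans zr; rewrite ler_piMl ?rnorm_ge0 // ler_pdivrMr // mul1r ler_nat.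
have ptS z N s : pt z N s + st z N = pt z N s.+1.
  by rewrite /pt /st -addrA -scalerDl -rmorphD -[in RHS]natr1 mulrDl mul1r.
have pt0 z N : pt z N 0 = b by rewrite /pt mul0r scale0r addr0.
have ptN z N : pt z N N.+1 = z by rewrite /pt divff ?gt_eqF // scale1r addrC subrK.
have st_small z N : rball b r z -> rnorm (st z N) < r.
  move=> zr; rewrite rnormZ rnorm_real ger0_norm ?invr_ge0 //.
  by apply: le_lt_trans zr; rewrite ler_piMl ?rnorm_ge0 // invf_le1 ?ler1n.
pose S N z w := \sum_(s < N.+1) \sum_(t < N.+1) hessian_form (pt z N s, st z N) (pt w N t, st w N).
have tel z w N : second_difference l b (z - b) b (w - b) =
    \sum_(s < N.+1) \sum_(t < N.+1) second_difference l (pt z N s) (st z N) (pt w N t) (st w N).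
  rewrite (second_difference_grid l N.+1 (ptS z N) (ptS w N)) ptN ptN pt0 pt0.
  by rewrite /second_difference !subrKC.
apply: (@pdk_lim _ _ _ S).
  move=> N.
  pose f (z : V) (p : 'I_N.+1 * 'I_m) := (pt z N p.1, p.2).
  pose c (z : V) (p : 'I_N.+1 * 'I_m) := st z N 0 p.2.
  apply: pdk_eq (@pdk_pullback _ _ (rball b r) _ _ ('I_N.+1 * 'I_m)%type f c hH _) => [z w _ _|z [s i] zr]; last first.
    by apply: pt_in zr; exact: ltnW.
  rewrite /S /f /c /=.
  rewrite -(pair_bigA _ (fun (s : 'I_N.+1) (i : 'I_m) => \sum_(q : 'I_N.+1 * 'I_m) st z N 0 i * Num.conj (st w N 0 q.2) *
     dz i (dw q.2 l) (pt z N s) (pt w N q.1))) /=.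
  apply: eq_bigr => s _; rewrite /hessian_form /= [RHS]exchange_big /=; apply: eq_bigr => i _.
  by rewrite pair_bigA.
move=> z w zr wr; have x0 := rnorm_ge0 (z - b); have y0 := rnorm_ge0 (w - b).
apply: (@cvgc_inv (K * rnorm (z - b) * rnorm (w - b) * (rnorm (z - b) + rnorm (w - b)))).
  by rewrite !mulr_ge0 // addr_ge0.
move=> N; rewrite (tel z w N) /S -sumrB.
pose B := K * rnorm (st z N) * rnorm (st w N) * (rnorm (st z N) + rnorm (st w N)).
have cell (s t : 'I_N.+1) : rnorm (hessian_form (pt z N s, st z N) (pt w N t, st w N) -
    second_difference l (pt z N s) (st z N) (pt w N t) (st w N)) <= B.
  have h1 : rball b (rho / 32) (pt z N s) by apply: rball_le (pt_in _ _ _ (ltnW (ltn_ord s)) zr); lra.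
  have h2 : rball b (rho / 32) (pt w N t) by apply: rball_le (pt_in _ _ _ (ltnW (ltn_ord t)) wr); lra.
  have h3 : rnorm (st z N) < rho / 32 by apply: lt_le_trans (st_small _ _ zr) _; lra.
  have h4 : rnorm (st w N) < rho / 32 by apply: lt_le_trans (st_small _ _ wr) _; lra.
  by rewrite rnormB; exact: hK.
apply: (le_trans (rnorm_sum _ _ _)).
apply: (@le_trans _ _ (\sum_(s < N.+1) \sum_(t < N.+1) B)).
  apply: ler_sum => s _; rewrite -sumrB; apply: (le_trans (rnorm_sum _ _ _)).
  by apply: ler_sum => t _; exact: cell.
have stn x : rnorm (st x N) = rnorm (x - b) / N.+1%:R.
  by rewrite rnormZ rnorm_real ger0_norm ?invr_ge0 // mulrC.
rewrite !sumr_const !card_ord -[leLHS]mulr_natr -[B *+ _]mulr_natr /B !stn.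
rewrite le_eqVlt; apply/orP; left; apply/eqP; field; by rewrite gt_eqF // n0.
Qed.

(** The difference between l and its second difference based at b is g(z) + conj (g(w)) with
   g z = l z b - l b b / 2, where l b b is real; exponentiating gives the twist. *)
Lemma pdk_exp_of_normalized (U : set V) (t : R) : 0 < t -> U b ->
  (forall z w, U z -> U w -> l w z = Num.conj (l z w)) ->
  pdk U (fun z w => second_difference l b (z - b) b (w - b)) ->
  pdk U (fun z w => cexp (t%:C * l z w)).
Proof.
move=> t0 Ub herm hp; have := pdk_cexp (pdkZ (ltW t0) hp).
move=> /(pdk_twist (fun z => cexp (t%:C * (l z b - l b b / 2)))); apply: pdk_eq => z w Uz Uw.
rewrite -cexp_conj -!cexpD; congr cexp.
have -> : Num.conj (t%:C * (l w b - l b b / 2)) = t%:C * (l b w - l b b / 2).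
  rewrite conj_prod conjB conj_prod -(herm _ _ Uw Ub) -(herm _ _ Ub Ub).
  have -> : Num.conj t%:C = t%:C :> C by exact: conjc_real.
  by rewrite fmorphV rmorph_nat.
by rewrite /second_difference !subrKC; field.
Qed.

End Expansion.
End LogarithmicHessian.

(** * Matrix-valued and scalar positive definite kernels *)

Section Bridge.
Variables (R : realType) (m : nat).
Local Notation C := R[i].
Local Notation V := 'rV[C]_m.

Definition entries n (L : V -> V -> 'M[C]_n) (p q : V * 'I_n) : C := L p.1 q.1 p.2 q.2.

Lemma cdot_mulmx n (A : 'M[C]_n) (x y : 'cV[C]_n) :
  cdot (A *m x) y = \sum_i \sum_j A i j * x j 0 * Num.conj (y i 0).
Proof. by apply: eq_bigr => i _; rewrite mxE mulr_suml. Qed.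

Lemma pdk_entries n U (L : V -> V -> 'M[C]_n) : positive_definite_kernel U L ->
  pdk [set p | U p.1] (entries L).
Proof.
move=> [_ h] I u x Uu.
pose v (i : 'I_#|I|) := (u (enum_val i)).1.
pose xi (i : 'I_#|I|) : 'cV[C]_n := x (enum_val i) *: delta_mx (u (enum_val i)).2 0.
apply: le_trans (h _ v xi (fun i => Uu _)) _; rewrite le_eqVlt; apply/orP; left; apply/eqP.
rewrite [RHS](reindex (@enum_val I I)) /=; last by apply: onW_bij; exact: enum_val_bij.
apply: eq_bigr => p _; rewrite [RHS](reindex (@enum_val I I)) /=; last by apply: onW_bij; exact: enum_val_bij.
apply: eq_bigr => q _; rewrite cdot_mulmx /entries /v /xi.
rewrite (bigD1 (u (enum_val p)).2) //= (bigD1 (u (enum_val q)).2) //= !big1 ?addr0.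
- by rewrite !mxE !eqxx !mulr1.
- move=> i /negPf ip; rewrite big1 // => j _; rewrite !mxE ip /= mulr0 rmorph0 mulr0.
  by [].
- by move=> j /negPf jq; rewrite !mxE jq /= !mulr0 mul0r.
Qed.

Lemma entries_positive n U (L : V -> V -> 'M[C]_n) : sesquiholomorphic U L ->
  pdk [set p | U p.1] (entries L) -> positive_definite_kernel U L.
Proof.
move=> hs h; split=> // l u xi Uu.
apply: le_trans (h ('I_l * 'I_n)%type (fun p => (u p.1, p.2)) (fun p => xi p.1 p.2 0) (fun p => Uu _)) _.
rewrite le_eqVlt; apply/orP; left; apply/eqP.
rewrite -(pair_bigA _ (fun (p : 'I_l) (i : 'I_n) => \sum_(q : 'I_l * 'I_n) entries L (u p, i) (u q.1, q.2) *
  xi q.1 q.2 0 * Num.conj (xi p i 0))) /=.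
apply: eq_bigr => p _.
transitivity (\sum_i \sum_q \sum_j L (u p) (u q) i j * xi q j 0 * Num.conj (xi p i 0)).
  by apply: eq_bigr => i _; rewrite pair_bigA.
by rewrite exchange_big /=; apply: eq_bigr => q _; rewrite cdot_mulmx.
Qed.

Lemma pdk_scalar U (L : V -> V -> 'M[C]_1) : positive_definite_kernel U L ->
  pdk U (fun z w => L z w 0 0).
Proof. by move=> h; exact: (@pdk_map _ _ _ _ _ _ (fun z : V => (z, 0)) (pdk_entries h)). Qed.

Lemma scalar_positive U (k : V -> V -> C) : sesquiholomorphic U (scalar_kernel k) ->
  pdk U k -> positive_definite_kernel U (scalar_kernel k).
Proof.
move=> hs h; apply: entries_positive => //.
apply: pdk_eq (@pdk_map _ _ _ [set p : V * 'I_1 | U p.1] _ _ (fun p => p.1) h _) => // z w _ _.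
by rewrite /entries /scalar_kernel !ord1 mxE eqxx mulr1n.
Qed.

Lemma sesqholo_scalar U (k : V -> V -> C) :
  (forall w, U w -> holomorphic U (fun z => k z w)) ->
  (forall z, U z -> antiholomorphic U (fun w => k z w)) ->
  sesquiholomorphic U (scalar_kernel k).
Proof.
move=> h1 h2 i j; rewrite !ord1.
have e : (fun z w => scalar_kernel k z w 0 0) = k.
  by apply/funext => z; apply/funext => w; rewrite mxE eqxx mulr1n.
have e1 w : (fun z => scalar_kernel k z w 0 0) = (fun z => k z w).
  by apply/funext => z; rewrite mxE eqxx mulr1n.
have e2 z : (fun w => scalar_kernel k z w 0 0) = k z.
  by apply/funext => w; rewrite mxE eqxx mulr1n.
by split=> [w Uw|z Uz]; [rewrite e1; exact: h1|rewrite e2; exact: h2].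
Qed.

Lemma scalar_sesqholo U (k : V -> V -> C) : sesquiholomorphic U (scalar_kernel k) ->
  (forall z w, U z -> U w -> differentiable (fun z => k z w) z) /\
  (forall z w, U z -> U w -> differentiable (fun w => Num.conj (k z w)) w).
Proof.
move=> h; have [h1 h2] := h 0 0.
have e1 w : (fun z => scalar_kernel k z w 0 0) = (fun z => k z w).
  by apply/funext => z; rewrite mxE eqxx mulr1n.
have e2 z : (fun w => Num.conj (scalar_kernel k z w 0 0)) = (fun w => Num.conj (k z w)).
  by apply/funext => w; rewrite mxE eqxx mulr1n.
split=> z w Uz Uw; first by have := h1 w Uw z Uz; rewrite e1; exact.
by have := h2 z Uz w Uw; rewrite e2; exact.
Qed.

Lemma scalar_kernel00 (k : V -> V -> C) z w : scalar_kernel k z w 0 0 = k z w.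
Proof. by rewrite mxE eqxx mulr1n. Qed.

Lemma sesqholo_sesq n U (L : V -> V -> 'M[C]_n) i j a rho M : sesquiholomorphic U L ->
  rball a rho `<=` U -> (forall z w, rball a rho z -> rball a rho w -> rnorm (L z w i j) <= M) ->
  sesq (fun z w => L z w i j) a rho M.
Proof.
move=> h sub hM z w za wa; have [h1 h2] := h i j; split; last exact: hM.
  exact: (h1 w (sub w wa) z (sub z za)).
exact: (h2 z (sub z za) w (sub w wa)).
Qed.

Lemma sesqB (F G : V -> V -> C) a rho M M' : sesq F a rho M -> sesq G a rho M' ->
  sesq (fun z w => F z w - G z w) a rho (M + M').
Proof.
move=> hF hG z w za wa; split.
- exact: differentiableB (sesq_diffl hF za wa) (sesq_diffl hG za wa).
- have -> : (fun w => Num.conj (F z w - G z w)) = (fun w => Num.conj (F z w) - Num.conj (G z w)).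
    by apply/funext => y; rewrite conjB.
  exact: differentiableB (sesq_diffr hF za wa) (sesq_diffr hG za wa).
- apply: (le_trans (rnormCD _ _)); rewrite rnormN.
  by apply: lerD; [exact: (sesq_bound hF)|exact: (sesq_bound hG)].
Qed.

Lemma sesq_comp (phi : C -> C) (F : V -> V -> C) a rho M M' :
  (forall x, phi (Num.conj x) = Num.conj (phi x)) ->
  (forall z w, rball a rho z -> rball a rho w ->
     [/\ differentiable phi (F z w), differentiable phi (Num.conj (F z w)) & rnorm (phi (F z w)) <= M']) ->
  sesq F a rho M -> sesq (fun z w => phi (F z w)) a rho M'.
Proof.
move=> hc hphi hF z w za wa; have [d1 d2 d3] := hphi z w za wa; split; last exact: d3.
  exact: (differentiable_comp (sesq_diffl hF za wa) d1).
have -> : (fun w => Num.conj (phi (F z w))) = phi \o (fun w => Num.conj (F z w)).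
  by apply/funext => y; rewrite /= hc.
exact: (differentiable_comp (sesq_diffr hF za wa) d2).
Qed.

Lemma sesq_cexp (F : V -> V -> C) a rho M (t : R) : 0 <= t -> sesq F a rho M ->
  sesq (fun z w => cexp (t%:C * F z w)) a rho (expR (t * M)).
Proof.
move=> t0 hF; apply: (@sesq_comp (fun x => cexp (t%:C * x)) F a rho M _ _ _ hF) => [x|z w za wa].
  rewrite -cexp_conj conj_prod; have -> // : Num.conj t%:C = t%:C :> C by exact: conjc_real.
have d x : differentiable (fun x => cexp (t%:C * x)) x.
  apply: (@differentiable_comp _ _ _ _ (fun x : C => t%:C * x) (@cexp R)); last exact: differentiable_cexp.
  by apply: differentiableM => //; exact: differentiable_cst.
split; [exact: d|exact: d|].
rewrite rnorm_cexp ler_expR; apply: (le_trans (ler_norm _)); apply: (le_trans (Re_le_rnorm _)).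
by rewrite rnormM rnorm_real ger0_norm // ler_wpM2l // (sesq_bound hF).
Qed.

(** Near a diagonal point the values of the kernel stay in a right half-plane, where the principal
   logarithm is holomorphic. *)
Lemma sesq_clog (F : V -> V -> C) a rho M : 0 < rho -> sesq F a rho M -> 0 < F a a ->
  exists r M', [/\ 0 < r, r <= rho, forall z w, rball a r z -> rball a r w -> 0 < complex.Re (F z w) &
    sesq (fun z w => clog (F z w)) a r M'].
Proof.
move=> r0 hF Fa; have [ImF ReF] : complex.Im (F a a) = 0 /\ 0 < complex.Re (F a a).
  by move: Fa; rewrite ltcE /= => /andP[/eqP].
have M0 := bhol_ge0 r0 (sesq_bhol hF (rball_center _ r0)).
set c := complex.Re (F a a) in ReF *.
have K0 : 0 < 16 * M / rho + 1 by rewrite ltr_wpDl // divr_ge0 ?mulr_ge0 // ltW.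
pose r := Num.min (rho / 2) (c / (16 * M / rho + 1)).
have rr : 0 < r by rewrite lt_min !divr_gt0.
have r1 : r <= rho / 2 by rewrite ge_min lexx.
have r2 : r * (16 * M / rho + 1) <= c by rewrite -ler_pdivlMr // ge_min lexx orbT.
have near z w : rball a r z -> rball a r w -> rnorm (F z w - F a a) <= c / 2.
  move=> za wa.
  have lip (f : V -> C) x : bhol f a rho M -> rball a r x -> rnorm (f x - f a) <= 4 * M / rho * r.
    move=> hf xa; have x2 : rnorm (x - a) < rho / 2 by apply: lt_le_trans r1.
    have a2 : rball a (rho / 2) a by apply: rball_center; rewrite divr_gt0.
    have := bhol_lipschitz r0 hf a2 x2; rewrite [a + _]addrC subrK => /le_trans; apply.
    apply: ler_wpM2l (ltW xa); apply: divr_ge0 (ltW r0); exact: mulr_ge0.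
  have wa1 : rball a rho w by apply: rball_le wa; lra.
  have h1 := lip _ z (sesq_bhol hF wa1) za.
  have h2 := lip _ w (sesq_bhol_conj hF (rball_center _ r0)) wa.
  rewrite -conjB rnorm_conj in h2.
  have -> : F z w - F a a = (F z w - F a w) + (F a w - F a a) by ring.
  apply: (le_trans (rnormCD _ _)); apply: (le_trans (lerD h1 h2)).
  have : r * (16 * M / rho + 1) = 4 * (4 * M / rho * r) + r by ring.
  by lra.
have half z w : rball a r z -> rball a r w -> c / 2 <= complex.Re (F z w).
  move=> za wa; have := le_trans (Re_le_rnorm _) (near z w za wa).
  by rewrite raddfB /= -/c ler_norml => /andP[? ?]; lra.
have c2 : 0 < c / 2 by rewrite divr_gt0.
have pos z w : rball a r z -> rball a r w -> 0 < complex.Re (F z w).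
  by move=> za wa; exact: lt_le_trans (half z w za wa).
exists r, (`|ln (c / 2)| + `|ln M| + pi); split=> //; first by lra.
have hFr : sesq F a r M by apply: sesq_sub hF _; apply: rball_le; lra.
apply: (sesq_comp _ _ hFr) => [x|z w za wa]; first exact: clog_conj.
have p := pos z w za wa; split; first exact: differentiable_clog.
  by apply: differentiable_clog; move: p; case: (F z w).
apply: (le_trans (rnorm_le_ReIm _)); rewrite /clog /=.
have n1 : c / 2 <= rnorm (F z w).
  by apply: (le_trans (half z w za wa)); apply: le_trans (ler_norm _) (Re_le_rnorm _).
have n2 : rnorm (F z w) <= M by exact: (sesq_bound hFr).
have n3 : 0 < rnorm (F z w) by exact: lt_le_trans n1.
have l1 : ln (c / 2) <= ln (rnorm (F z w)) by rewrite ler_ln ?posrE.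
have l2 : ln (rnorm (F z w)) <= ln M by rewrite ler_ln ?posrE // (lt_le_trans n3).
apply: lerD.
  rewrite ler_norml; apply/andP; split.
    have := ler_norm (- ln (c / 2)); rewrite normrN; have := normr_ge0 (ln M); lra.
  have := ler_norm (ln M); have := normr_ge0 (ln (c / 2)); lra.
have := atan_gtNpi2 (complex.Im (F z w) / complex.Re (F z w)).
have := atan_ltpi2 (complex.Im (F z w) / complex.Re (F z w)).
have := pi_gt0 R; move: (atan _) (pi) => x y y0 h1 h2.
by rewrite ler_norml; apply/andP; split; lra.
Qed.

(** The logarithms of K and kk are taken separately, since both kernels are hermitian and bounded near
   some diagonal point. The ball is centred at the point produced by the Baire argument and not at a
   given point of U. *)
Lemma log_quotient (U : set V) (kk K : V -> V -> C) : open U -> U !=set0 ->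
  positive_definite_kernel U (scalar_kernel kk) -> positive_definite_kernel U (scalar_kernel K) ->
  (forall w, U w -> 0 < kk w w) -> (forall w, U w -> 0 < K w w) ->
  exists b rho M l, [/\ 0 < rho, rball b rho `<=` U, sesq l b rho M &
    forall z w, rball b rho z -> rball b rho w -> [/\ kk z w != 0,
      kernel_quotient kk K z w = cexp (l z w) & l w z = Num.conj (l z w)]] /\
    forall w, rball b rho w -> diag_log (kernel_quotient kk K) w = l w w.
Proof.
move=> oU [a0 Ua0] hkk hK kk0 K0.
have [dkk1 dkk2] := scalar_sesqholo hkk.1; have [dK1 dK2] := scalar_sesqholo hK.1.
have cont (k : V -> V -> C) z w : differentiable (fun w => Num.conj (k z w)) w -> {for w, continuous (k z)}.
  move=> /differentiable_continuous /continuous_rballP h; apply/continuous_rballP => e /h[d d0 hd].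
  by exists d => // y /hd; rewrite -conjB rnorm_conj.
have [r1 r10 sub1] := open_rballP oU Ua0.
have [b1 [s1 [M1 [s10 sub2 bd1]]]] : exists b s M, [/\ 0 < s, rball b s `<=` rball a0 r1 &
    forall z w, rball b s z -> rball b s w -> rnorm (K z w) <= M].
  apply: separately_continuous_bounded; [exact: r10| |] => z w /sub1 Uz /sub1 Uw.
    exact: differentiable_continuous (dK1 z w Uz Uw).
  exact: cont (dK2 z w Uz Uw).
have [b [s [M2 [s0 sub3 bd2]]]] : exists b s M, [/\ 0 < s, rball b s `<=` rball b1 s1 &
    forall z w, rball b s z -> rball b s w -> rnorm (kk z w) <= M].
  apply: separately_continuous_bounded; [exact: s10| |] => z w /sub2/sub1 Uz /sub2/sub1 Uw.
    exact: differentiable_continuous (dkk1 z w Uz Uw).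
  exact: cont (dkk2 z w Uz Uw).
have sub x : rball b s x -> U x by move=> /sub3/sub2/sub1.
have sK : sesq K b s M1.
  move=> z w zb wb; split; [exact: dK1 (sub z zb) (sub w wb)|exact: dK2 (sub z zb) (sub w wb)|].
  by apply: bd1; exact: sub3.
have skk : sesq kk b s M2.
  move=> z w zb wb; split; [exact: dkk1 (sub z zb) (sub w wb)|exact: dkk2 (sub z zb) (sub w wb)|].
  exact: bd2.
have Ub := sub b (rball_center b s0).
have [t1 [N1 [t10 t1s pK lK]]] := sesq_clog s0 sK (K0 b Ub).
have [t2 [N2 [t20 t2s pkk lkk]]] := sesq_clog s0 skk (kk0 b Ub).
pose rho := Num.min t1 t2.
have rho1 : rho <= t1 by rewrite ge_min lexx.
have rho2 : rho <= t2 by rewrite ge_min lexx orbT.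
have rho0 : 0 < rho by rewrite lt_min t10.
have pK' := pdk_scalar hK; have pkk' := pdk_scalar hkk.
have subr x : rball b rho x -> U x by move=> /(rball_le rho1)/(rball_le t1s)/sub.
exists b, rho, (N1 + N2), (fun z w => clog (K z w) - clog (kk z w)); split; first (split; [exact: rho0|exact: subr| |]).
- by apply: sesqB; [apply: sesq_sub lK _; exact: rball_le|apply: sesq_sub lkk _; exact: rball_le].
- move=> z w zb wb.
  have p1 : 0 < complex.Re (K z w) by apply: pK; exact: rball_le rho1 _ _.
  have p2 : 0 < complex.Re (kk z w) by apply: pkk; exact: rball_le rho2 _ _.
  have kn : kk z w != 0 by apply: contraTneq p2 => ->; rewrite ltxx.
  split=> //.
    apply: (mulfI kn); rewrite /kernel_quotient mulVKf // -{1}(cexp_clog p2) -cexpD subrKC.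
    by rewrite cexp_clog.
  rewrite conjB -!clog_conj; congr (clog _ - clog _).
    by have := pdk_herm pK' (subr z zb) (subr w wb); rewrite !scalar_kernel00.
  by have := pdk_herm pkk' (subr z zb) (subr w wb); rewrite !scalar_kernel00.
- move=> w wb; rewrite /diag_log /kernel_quotient.
  have real_pos (x : C) : 0 < x -> x = (complex.Re x)%:C /\ 0 < complex.Re x.
    by case: x => x y; rewrite ltcE /= => /andP[/eqP -> ?].
  have [eK K1] := real_pos _ (K0 w (subr w wb)); have [ek kk1] := real_pos _ (kk0 w (subr w wb)).
  rewrite eK ek -fmorphV -rmorphM /= !clog_real // -rmorphB; congr (_%:C).
  by rewrite lnM ?posrE ?invr_gt0 // lnV ?posrE // addrC.
Qed.

End Bridge.

(** * The two implications *)

Section BothDirections.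
Variables (R : realType) (m : nat).
Local Notation C := R[i].
Local Notation V := 'rV[C]_m.
Implicit Types kk K : V -> V -> C.

Lemma positive_definite_kernel_sub n (U W : set V) (L : V -> V -> 'M[C]_n) : W `<=` U ->
  positive_definite_kernel U L -> positive_definite_kernel W L.
Proof.
move=> sub [hs hp]; split.
  move=> i j; have [h1 h2] := hs i j; split=> [w Ww z Wz|z Wz w Ww].
    exact: (h1 w (sub w Ww) z (sub z Wz)).
  exact: (h2 z (sub z Wz) w (sub w Ww)).
by move=> l u xi Wu; apply: hp => p; apply: sub.
Qed.

Lemma diag_powerE (L : V -> V -> C) (t : R) w : 0 < L w w ->
  diag_power L t w = cexp (t%:C * diag_log L w).
Proof.
move=> L0; rewrite /diag_power /diag_log -rmorphM cexp_real /powR ifF //.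
apply/negP => /eqP e0; move: L0; rewrite ltcE /= e0 ltxx andbF.
by [].
Qed.

Lemma kernel_quotient_gt0 kk K w : 0 < kk w w -> 0 < K w w -> 0 < kernel_quotient kk K w w.
Proof. by move=> h1 h2; rewrite /kernel_quotient mulr_gt0 ?invr_gt0. Qed.

Variables (Omega : set V) (kk K : V -> V -> C).
Hypothesis hkk : positive_definite_kernel Omega (scalar_kernel kk).
Hypothesis hK : positive_definite_kernel Omega (scalar_kernel K).
Hypothesis kk_gt0 : forall w, Omega w -> 0 < kk w w.
Hypothesis K_gt0 : forall w, Omega w -> 0 < K w w.

Lemma kernel_quotient_sesqholo (U : set V) : U `<=` Omega ->
  (forall z w, U z -> U w -> kk z w != 0) -> sesquiholomorphic U (scalar_kernel (kernel_quotient kk K)).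
Proof.
move=> sub kn; have [dkk1 dkk2] := scalar_sesqholo hkk.1; have [dK1 dK2] := scalar_sesqholo hK.1.
apply: sesqholo_scalar => [w Uw z Uz|z Uz w Uw].
  have h := dkk1 z w (sub z Uz) (sub w Uw).
  exact: differentiableM (differentiableV h (kn z w Uz Uw)) (dK1 z w (sub z Uz) (sub w Uw)).
have -> : (fun w => Num.conj (kernel_quotient kk K z w)) =
    (fun w => (Num.conj (kk z w))^-1 * Num.conj (K z w)).
  by apply/funext => y; rewrite /kernel_quotient conj_prod fmorphV.
have h := dkk2 z w (sub z Uz) (sub w Uw).
have kn' : Num.conj (kk z w) != 0 by rewrite conjC_eq0 kn.
exact: differentiableM (differentiableV h kn') (dK2 z w (sub z Uz) (sub w Uw)).
Qed.

(** Positivity bounds the given polarization of the Hessian by its diagonal, where it equals the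
   derivatives of l; boundedness is what the uniqueness of polarizations asks for. *)
Lemma infinitely_divisible_of_hessian (Omega0 : set V) : domain Omega0 -> Omega0 `<=` Omega ->
  positive_definite_function Omega0 (log_hessian (kernel_quotient kk K)) ->
  infinitely_divisible_wrt Omega kk K.
Proof.
move=> [oO _ neO] sub [Gt [sGt dGt] pGt].
have [b [rho [M [l [[rho0 subb hl hquot] hdiag]]]]] := log_quotient oO neO
  (positive_definite_kernel_sub sub hkk) (positive_definite_kernel_sub sub hK)
  (fun w Ow => kk_gt0 (sub w Ow)) (fun w Ow => K_gt0 (sub w Ow)).
pose H (p q : V * 'I_m) := dz p.2 (dw q.2 l) p.1 q.1.
have r8 : 0 < rho / 8 by rewrite divr_gt0.
pose MH (i j : 'I_m) := 4 * (4 * M / rho * rnorm (delta_mx 0 j : V)) / (rho / 8) * rnorm (delta_mx 0 i : V).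
have sH i j : sesq (dz i (dw j l)) b (rho / 64) (MH i j).
  have -> : rho / 64 = rho / 8 / 8 by field.
  exact: (sesq_dz i r8 (sesq_dw j rho0 hl)).
have HE w i j : rball b (rho / 64) w -> Gt w w i j = dz i (dw j l) w w.
  move=> wb; rewrite dGt; last by apply: subb; apply: rball_le wb; lra.
  rewrite mxE; apply: (wirtinger_hessian _ _ rho0 hl hdiag).
  by apply: rball_le wb; lra.
have pG := pdk_entries pGt.
have sub64 : rball b (rho / 64) `<=` Omega0.
  by move=> x xb; apply: subb; apply: rball_le xb; lra.
have sG i j : sesq (fun z w => Gt z w i j) b (rho / 64) (MH i i + MH j j).
  apply: (sesqholo_sesq sGt sub64) => z w zb wb.
  have := @pdk_bound _ _ _ _ (z, i) (w, j) pG (sub64 z zb) (sub64 w wb).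
  move=> /le_trans; apply; rewrite /entries /= !HE //.
  have hh x k : rball b (rho / 64) x -> complex.Re (dz k (dw k l) x x) <= MH k k.
    move=> xb; apply: (le_trans (ler_norm _)); apply: (le_trans (Re_le_rnorm _)).
    exact: (sesq_bound (sH k k) xb xb).
  by apply: lerD; exact: hh.
have r64 : 0 < rho / 64 by rewrite divr_gt0.
have GH z w i j : rball b (rho / 64 / 16) z -> rball b (rho / 64 / 16) w -> Gt z w i j = dz i (dw j l) z w.
  move=> zb wb; apply/eqP; rewrite -subr_eq0; apply/eqP.
  apply: (sesq_uniqueness r64 (sesqB (sG i j) (sH i j)) _ zb wb) => x xb.
  by rewrite HE // subrr.
pose r := rho / 64 / 16; have r0 : 0 < r by apply: divr_gt0.
have rb : rball b r `<=` rball b rho by apply: rball_le; rewrite /r; lra.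
have sub0 : rball b r `<=` Omega0 by move=> x /rb /subb.
have pH : pdk [set p : V * 'I_m | rball b r p.1] H.
  apply: pdk_eq (@pdk_map _ _ _ _ _ _ (fun p : V * 'I_m => p) pG _) => [[z i] [w j] zb wb|[z i] zb].
    exact: (GH z w i j zb wb).
  exact: sub0.
have r64' : r <= rho / 64 by rewrite /r; lra.
have pn := hessian_log_kernel rho0 hl r0 r64' pH.
have herm z w : rball b r z -> rball b r w -> l w z = Num.conj (l z w).
  by move=> /rb zb /rb wb; have [] := hquot z w zb wb.
exists (rball b r); split.
- exact: rball_domain.
- by move=> x /sub0 /sub.
- by move=> z w /rb zb /rb wb; have [] := hquot z w zb wb.
split.
- apply: kernel_quotient_sesqholo; first by move=> x /sub0 /sub.
  by move=> z w /rb zb /rb wb; have [] := hquot z w zb wb.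
- by move=> w /sub0 /sub Ow; apply: kernel_quotient_gt0; [exact: kk_gt0|exact: K_gt0].
move=> t t0; have sL := sesq_cexp (ltW t0) hl.
have sS : sesquiholomorphic (rball b r) (scalar_kernel (fun z w => cexp (t%:C * l z w))).
  apply: sesqholo_scalar => [w wb z zb|z zb w wb].
    exact: (sesq_diffl sL (rb z zb) (rb w wb)).
  exact: (sesq_diffr sL (rb z zb) (rb w wb)).
exists (scalar_kernel (fun z w => cexp (t%:C * l z w))).
  split=> // w wb; rewrite /scalar_kernel /scalar_fun diag_powerE ?hdiag //; first exact: rb.
  by have Ow := sub _ (sub0 w wb); apply: kernel_quotient_gt0; [exact: kk_gt0|exact: K_gt0].
apply: scalar_positive sS _; apply: (pdk_exp_of_normalized t0 (rball_center b r0) herm pn).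
Qed.

(** Likewise the polarization of each power of L is bounded through its diagonal and hence equal to
   exp (t l). *)
Lemma hessian_of_infinitely_divisible : infinitely_divisible_wrt Omega kk K ->
  exists Omega0 : set V, [/\ domain Omega0, Omega0 `<=` Omega &
    positive_definite_function Omega0 (log_hessian (kernel_quotient kk K))].
Proof.
case=> Omega0 [[oO _ neO] sub _ [_ L0 hdiv]].
have [b [rho [M [l [[rho0 subb hl hquot] hdiag]]]]] := log_quotient oO neO
  (positive_definite_kernel_sub sub hkk) (positive_definite_kernel_sub sub hK)
  (fun w Ow => kk_gt0 (sub w Ow)) (fun w Ow => K_gt0 (sub w Ow)).
have pexp (t : R) : 0 < t -> pdk (rball b (rho / 16)) (fun z w => cexp (t%:C * l z w)).
  move=> t0; have [Lt [sLt dLt] pLt] := hdiv t t0.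
  have sL := sesq_cexp (ltW t0) hl; have pk := pdk_scalar pLt.
  have diag w : rball b rho w -> Lt w w 0 0 = cexp (t%:C * l w w).
    move=> wb; have Ow := subb w wb.
    by rewrite dLt // /scalar_fun mxE eqxx mulr1n diag_powerE ?hdiag //; exact: L0.
  have sk : sesq (fun z w => Lt z w 0 0) b rho (expR (t * M) + expR (t * M)).
    apply: (sesqholo_sesq sLt subb) => z w zb wb.
    apply: (le_trans (pdk_bound pk (subb z zb) (subb w wb))); rewrite !diag //.
    have hh x : rball b rho x -> complex.Re (cexp (t%:C * l x x)) <= expR (t * M).
      move=> xb; apply: (le_trans (ler_norm _)); apply: (le_trans (Re_le_rnorm _)).
      exact: (sesq_bound sL xb xb).
    by apply: lerD; exact: hh.
  have pk' : pdk (rball b (rho / 16)) (fun z w => Lt z w 0 0).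
    apply: (@pdk_map _ _ _ _ _ _ (fun z : V => z) pk) => z zb; apply: subb.
    by apply: rball_le zb; lra.
  apply: pdk_eq pk' => z w zb wb; apply/eqP; rewrite -subr_eq0; apply/eqP.
  by apply: (sesq_uniqueness rho0 (sesqB sk sL) _ zb wb) => x xb; rewrite diag // subrr.
pose r := rho / 64; have r0 : 0 < r by rewrite divr_gt0.
have pH : pdk [set p : V * 'I_m | rball b r p.1] (fun p q => dz p.2 (dw q.2 l) p.1 q.1).
  apply: (log_kernels_hessian rho0 hl r0) => [|t t0]; first by rewrite /r.
  apply: (@pdk_map _ _ _ _ _ _ (fun z : V => z) (pexp t t0)) => z.
  by apply: rball_le; rewrite /r; lra.
have r8 : 0 < rho / 8 by rewrite divr_gt0.
have r64 : rho / 64 = rho / 8 / 8 by field.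
have sH i j := sesq_dz i r8 (sesq_dw j rho0 hl).
have rb : rball b r `<=` rball b (rho / 8 / 8) by rewrite /r r64.
have rb1 : rball b r `<=` rball b rho by apply: rball_le; rewrite /r; lra.
pose Gt z w : 'M[C]_m := \matrix_(i, j) dz i (dw j l) z w.
have sGt : sesquiholomorphic (rball b r) Gt.
  move=> i j.
  have e1 w : (fun z => Gt z w i j) = (fun z => dz i (dw j l) z w).
    by apply/funext => z; rewrite mxE.
  have e2 z : (fun w => Num.conj (Gt z w i j)) = (fun w => Num.conj (dz i (dw j l) z w)).
    by apply/funext => w; rewrite mxE.
  split=> [w wb|z zb].
    by rewrite e1 => z zb; exact: (sesq_diffl (sH i j) (rb z zb) (rb w wb)).
  by rewrite /antiholomorphic e2 => w wb; exact: (sesq_diffr (sH i j) (rb z zb) (rb w wb)).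
exists (rball b r); split; first exact: rball_domain.
  by move=> x /rb1 /subb /sub.
exists Gt.
  split=> // w wb; apply/matrixP => i j; rewrite !mxE; apply/esym.
  apply: (wirtinger_hessian _ _ rho0 hl hdiag).
  by apply: rball_le wb; rewrite /r; lra.
apply: entries_positive => //; apply: pdk_eq pH => -[z i] [w j] _ _.
by rewrite /entries /Gt mxE.
Qed.

End BothDirections.

Theorem theorem4p1 (R : realType) (m : nat) (Omega : set 'rV[R[i]]_m)
    (kk K : 'rV[R[i]]_m -> 'rV[R[i]]_m -> R[i])
    (H : completeNormedModType R[i]) (dot : {dot H for Num.conj})
    (ev : H -> 'rV[R[i]]_m -> R[i])
    (M Mstar : 'I_m -> {linear H -> H}) :
  (0 < m)%N ->
  domain Omega -> bounded_set Omega ->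
  positive_definite_kernel Omega (scalar_kernel kk) ->
  positive_definite_kernel Omega (scalar_kernel K) ->
  (forall w, Omega w -> 0 < kk w w) ->
  (forall w, Omega w -> 0 < K w w) ->
  is_rkhs Omega K dot ev ->
  coordinate_multiplication Omega ev M ->
  adjoint_tuple dot M Mstar ->
  B1 (conj_set Omega) Mstar ->
  (exists Omega0 : set 'rV[R[i]]_m,
     [/\ domain Omega0, Omega0 `<=` Omega &
         positive_definite_function Omega0
           (log_hessian (kernel_quotient kk K))]) <->
  infinitely_divisible_wrt Omega kk K.
Proof.
move=> _ _ _ hkk hK kk0 K0 _ _ _ _; split; first case=> Omega0 [dom sub hG].
  exact: (infinitely_divisible_of_hessian hkk hK kk0 K0 dom sub hG).
exact: hessian_of_infinitely_divisible.
Qed.
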